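(* For every $k\ge 9$, the connected components of $\mathbf{DCM}_k$ form exactly three isomorphism classes: there is a positive number of pairwise isomorphic components of the smallest order, a positive number of pairwise isomorphic components of the second smallest order, and exactly one component of the largest order.
   Context: Let $k\ge 1$ and let $X_{2k}=\{P_1,\dots,P_{2k}\}$ be $2k$ points in convex position in the plane, labeled in clockwise cyclic order; indices are taken modulo $2k$ (so $P_{2k}$ and $P_1$ are consecutive). A matching of $X_{2k}$ means a set of $k$ pairwise non-crossing straight segments (edges) with endpoints in $X_{2k}$ covering every point exactly once; its size is $k$. Two matchings $M,M'$ of $X_{2k}$ are disjoint compatible if they have no common edge and no edge of $M$ crosses an edge of $M'$. $\mathbf{DCM}_k$ is the graph whose vertices are the matchings of $X_{2k}$, two being adjacent iff they are disjoint compatible (this graph depends only on $k$). The order of a component is its number of vertices. *)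

(* Defs.v *)
From mathcomp Require Import all_boot.
Set Implicit Arguments. Unset Strict Implicit. Unset Printing Implicit Defensive.

(* Points P_1..P_{2k} in clockwise order are represented by 'I_(2k)
   (label i+1 ~ ordinal i).  An edge is a 2-element subset of points. *)
Notation point k := 'I_(2 * k).

(* Two segments with endpoint sets e, f (each of size 2) of points in strictly
   convex position cross iff they have 4 distinct endpoints and interleave in
   the cyclic order, i.e. exactly one endpoint of f lies strictly between the
   two endpoints of e (in the linear order of labels, which is equivalent to
   the cyclic one). *)
Definition crossing (k : nat) (e f : {set point k}) : bool :=
  [disjoint e & f] &&
  [exists a in e, exists b in e,
     (a < b) && (#|[set c in f | (a < c) && (c < b)]| == 1)].

Definition is_matching (k : nat) (M : {set {set point k}}) : bool :=
  [forall e in M, #|e| == 2] &&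
  [forall x : point k, #|[set e in M | x \in e]| == 1] &&
  [forall e in M, forall f in M, ~~ crossing e f].

Definition matching (k : nat) := {M : {set {set point k}} | is_matching M}.

Definition dcm (k : nat) : rel (matching k) := fun M N =>
  [disjoint val M & val N] &&
  [forall e in val M, forall f in val N, ~~ crossing e f].

Definition component (k : nat) (M : matching k) : {set matching k} :=
  [set N | connect (@dcm k) M N].

Definition iso_sub (k : nat) (C1 C2 : {set matching k}) : Prop :=
  exists f : matching k -> matching k,
    [/\ {in C1 &, injective f}, f @: C1 = C2 &
        {in C1 &, forall x y, dcm (f x) (f y) = dcm x y}].

(* Main.v *)
From Stdlib Require Import Ascii String.
Require Import Defs.
From mathcomp Require Import all_boot zify.

Set Implicit Arguments. Unset Strict Implicit. Unset Printing Implicit Defensive.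

(** Write a matching as a Dyck word, an opening bracket standing for a point
    whose partner comes later.  The union of two disjoint compatible matchings
    is a family of non-crossing convex polygons whose edges alternate between
    the two matchings, so adjacency is recognised by a stack automaton reading
    both words in parallel.  If an edge [e] separates the other points into two
    sides, then a neighbour consists of a neighbour of one side together with
    [e] and a neighbour of the other side alone ([adj_cut]).  This determines
    the neighbours in the special families: caterpillars [cM t], [cN t], [cX t]
    indexed by a sequence [t] of turns.  For odd [k] they give isolated matchings and stars
    around [cX t]; for even [k] they give single edges [cM t -- cN t] and
    components with [6 (k/2 - 1)] vertices.

    For [k >= 9], every other non-isolated matching is joined to the ring
    matching [leaves k].  Since some polygon of a compatible pair is an ear, a
    non-isolated matching is, up to rotation and within its component, a smaller
    non-isolated matching with two edges on four consecutive points inserted.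
    Insertion commutes with walks and rotations, so the induction from [k] to
    [k + 2] only has to insert such quadrilaterals into one representative per
    component.  For an insertion near one end of a caterpillar, the
    other end can be shortened without affecting the claim, which leaves
    finitely many cases; these are settled by explicit paths for [k <= 10]. *)

(** * Compatible pairs of words *)

(** Inserting a block does not leave it unchanged along a walk: adjacent matchings must carry
    different matchings of the inserted points, so the block flips at every step and its final form
    depends on the parity of the walk. Hence representatives are tested with both members of [quad],
    and claims are made up to rotation, which is a graph automorphism. Parity also explains how one
    explicit walk on nine edges serves all larger sizes: an even walk returns an appended ring block
    to its initial form.

    Ears do not always yield a quadrilateral: a hexagonal ear minus two edges leaves a lone edge,
    which has no neighbour by itself and must be absorbed into another polygon.

    The bound 9 is where the extra components vanish: there is one up to rotation for each of
    [k = 7] and [k = 8], and an insertion into either of them leads to the ring on 9 or 10 edges.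
    The order of the ring component is never computed. It suffices that it is at least [3k - 5],
    since the middle component for even [k] has order [3k - 6]. Isolated matchings exist only for
    odd [k], because an even number of edges can be removed completely in quadrilateral steps. *)

Notation word := (seq bool).
Notation letter := (bool * bool)%type.
Notation state := (option (bool * bool)).
Notation stack := (seq state).

(* The stack holds the polygons met by the scan, innermost first.  [None]: only the
   first vertex has been read, so both its edges are pending.  [Some (c, d)]: one
   edge is pending at the first vertex and one at the last vertex read; it belongs
   to the left matching iff [c], respectively [d]. *)
Definition step (l : letter) (s : stack) : option stack :=
  match l, s with
  | (true, true), _ => Some (None :: s)
  | (false, false), Some (c, d) :: s' => if c != d then Some s' else None
  | (a, _), None :: s' => if a == l.2 then None else Some (Some (a, a) :: s')
  | (a, _), Some (c, d) :: s' => if d != a then Some (Some (c, a) :: s') else None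
  | _, [::] => None
  end.

Arguments step : simpl never.

Fixpoint run (z : seq letter) (s : stack) : option stack :=
  if z is l :: z' then obind (run z') (step l s) else Some s.

Definition adj (w v : word) := (size w == size v) && (run (zip w v) [::] == Some [::]).

Lemma run_cat z1 z2 s : run (z1 ++ z2) s = obind (run z2) (run z1 s).
Proof. by elim: z1 s => //= l z IH s; case: (step l s). Qed.

Lemma step_cat l q s r : step l ((q :: s) ++ r) = omap (cat^~ r) (step l (q :: s)).
Proof. by case: l q => [[] []] [[[] []]|]. Qed.

Lemma step_frame l s s' r : step l s = Some s' -> step l (s ++ r) = Some (s' ++ r).
Proof.
case: s => [|q s]; first by case: l => [[] []] //; rewrite /step => -[<-].
by rewrite step_cat => ->.
Qed.

(** A step reads and changes only the innermost polygon, so a successful run is unaffected by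
    polygons lying below on the stack. *)
Lemma run_frame z s s' r : run z s = Some s' -> run z (s ++ r) = Some (s' ++ r).
Proof.
elim: z s => [|l z IH] s /=; first by case=> <-.
by case E: (step l s) => [t|] //= /IH; rewrite (step_frame _ E).
Qed.

Definition swap (l : letter) : letter := (l.2, l.1).
Definition neg_state (q : state) : state :=
  if q is Some (c, d) then Some (~~ c, ~~ d) else None.

Lemma step_swap l s :
  step (swap l) (map neg_state s) = omap (map neg_state) (step l s).
Proof. by case: l s => [[] []] [|[[[] []]|] s]. Qed.

Lemma run_swap z s :
  run (map swap z) (map neg_state s) = omap (map neg_state) (run z s).
Proof.
by elim: z s => //= l z IH s; rewrite step_swap; case: (step l s) => //= t; rewrite IH.
Qed.

Lemma zip_swap (w v : word) : zip v w = map swap (zip w v).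
Proof. by elim: w v => [|a w IH] [|b v] //=; rewrite IH. Qed.

Lemma adj_sym w v : adj w v = adj v w.
Proof.
rewrite /adj eq_sym; case: eqP => //= E.
have := run_swap (zip w v) [::]; rewrite -zip_swap /= => ->.
by case: (run _ _) => [[|q s]|].
Qed.

(** The number of edges of the left matching pending at a polygon; [no] is its counterpart on the
    right. Their sums over the stack are the heights of the two words, so an accepted pair consists
    of Dyck words. *)
Definition mo (q : state) : nat := if q is Some (c, d) then c + d else 1.
Definition mos (s : stack) : nat := sumn (map mo s).
Definition no (q : state) : nat := if q is Some (c, d) then ~~ c + ~~ d else 1.
Definition nos (s : stack) : nat := sumn (map no s).

Arguments mos : simpl never.
Arguments nos : simpl never.

Lemma step_mos a b s s' : step (a, b) s = Some s' -> mos s' + ~~ a = mos s + a.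
Proof. by rewrite /step; case: a b s => [] [] [|[[[] []]|] s] //= [<-] /=; rewrite /mos /=; lia. Qed.

Lemma step_nos a b s s' : step (a, b) s = Some s' -> nos s' + ~~ b = nos s + b.
Proof. by rewrite /step; case: a b s => [] [] [|[[[] []]|] s] //= [<-] /=; rewrite /nos /=; lia. Qed.

Fixpoint dy (h : nat) (w : word) : bool :=
  match w, h with
  | [::], _ => h == 0
  | true :: w', _ => dy h.+1 w'
  | false :: w', h'.+1 => dy h' w'
  | false :: _, 0 => false
  end.

Notation dyck := (dy 0).

Lemma dy_cat h h' w v : dy h w -> dy h' v -> dy (h + h') (w ++ v).
Proof.
elim: w h => [|a w IH] [|h] //=; first by case: a => // /IH H /H.
by case: a => // /IH H /H; rewrite ?addSn.
Qed.

Lemma dyck_wrap u : dyck u -> dyck (true :: rcons u false).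
Proof. by move=> du; rewrite -cats1 /=; apply: (@dy_cat 0 1 _ [:: false]). Qed.

Lemma dyck_cat u v : dyck u -> dyck v -> dyck (u ++ v).
Proof. exact: dy_cat. Qed.

Lemma run_dy w v s : size w = size v -> run (zip w v) s = Some [::] -> dy (mos s) w.
Proof.
elim: w v s => [|a w IH] [|b v] s //=; first by move=> _ [->].
case=> sz; case E: (step _ _) => [t|] //= R; have := IH _ _ sz R.
by have := step_mos E; case: (a) => /= e; [have -> : mos t = (mos s).+1 by lia|
  have -> : mos s = (mos t).+1 by lia].
Qed.

Lemma adj_size w v : adj w v -> size w = size v.
Proof. by case/andP=> /eqP. Qed.

Lemma adj_dyck w v : adj w v -> dyck w.
Proof. by case/andP=> /eqP sz /eqP /(run_dy sz). Qed.

Lemma dy_split h w : dy h.+1 w ->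
  exists u v, [/\ w = u ++ false :: v, dyck u & dy h v].
Proof.
elim: {w}(size w) {-2}w (leqnn (size w)) h => [|n IH] [|a w] //= sz h.
case: a => [d|d]; last by exists [::], w.
have [u [v [e du dv]]] := IH _ sz _ d.
have szv : size v <= n by move: sz; rewrite e size_cat /=; lia.
have [u' [v' [e' du' dv']]] := IH _ szv _ dv.
exists (true :: rcons u false ++ u'), v'; split=> //.
  by rewrite e e' -cats1 /= -!catA.
by apply: (@dy_cat 0 0 (true :: rcons u false)); first exact: dyck_wrap.
Qed.

Lemma dyck_ind (P : word -> Prop) :
  P [::] ->
  (forall u v, dyck u -> dyck v -> P u -> P v -> P (true :: u ++ false :: v)) ->
  forall w, dyck w -> P w.
Proof.
move=> P0 PS w; elim: {w}(size w) {-2}w (leqnn (size w)) => [|n IH] [|[] w] //= sz d.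
have [u [v [e du dv]]] := dy_split d.
move: sz; rewrite e size_cat /= => sz.
by apply: PS => //; apply: IH => //; lia.
Qed.

Lemma dyck_even w : dyck w -> ~~ odd (size w).
Proof.
move: w; apply: dyck_ind => // u v _ _ /negbTE Hu /negbTE Hv.
by rewrite /= size_cat /= oddD /= Hu Hv.
Qed.

(** * Rotations *)

(* [turn] moves the first point of the polygon to the end; [reopen] turns the
   bracket that closed the edge of that point into an opening one. *)
Fixpoint reopen (h : nat) (w : word) : word :=
  match w with
  | [::] => [::]
  | true :: w' => true :: reopen h.+1 w'
  | false :: w' => if h is h'.+1 then false :: reopen h' w' else true :: w'
  end.

Definition turn (w : word) : word :=
  if w is _ :: w' then rcons (reopen 0 w') false else [::].

Lemma size_reopen h w : size (reopen h w) = size w.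
Proof. by elim: w h => [|[] w IH] [|h] //=; rewrite IH. Qed.

Lemma size_turn w : size (turn w) = size w.
Proof. by case: w => //= a w; rewrite size_rcons size_reopen. Qed.

Lemma size_iter_turn r w : size (iter r turn w) = size w.
Proof. by elim: r => //= r IH; rewrite size_turn. Qed.

Lemma reopen_dyck h u v : dyck u -> reopen h (u ++ v) = u ++ reopen h v.
Proof.
move=> du; move: u du h v; apply: dyck_ind => // u v' du dv IHu IHv h v /=.
by rewrite -!catA IHu /= IHv.
Qed.

(** For [x = (u)v] one turn gives [u(vy)], induction moves [u] behind to give [(vy)u], another turn
    gives [vy(u)], and induction moves [v] behind. *)
Lemma iter_turn_cat x y : dyck x -> dyck y -> iter (size x) turn (x ++ y) = y ++ x.
Proof.
move=> dx; move: x dx y; apply: dyck_ind => [|u v du dv IHu IHv] y dy0; first by rewrite cats0.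
have -> : size (true :: u ++ false :: v) = size v + (1 + (size u + 1)).
  by rewrite /= size_cat /=; lia.
rewrite iterD iterD iterD.
have -> : iter 1 turn ((true :: u ++ false :: v) ++ y) = u ++ (true :: rcons (v ++ y) false).
  by rewrite /= -catA /= reopen_dyck // rcons_cat.
rewrite IHu; last exact/dyck_wrap/dyck_cat.
have -> : iter 1 turn ((true :: rcons (v ++ y) false) ++ u) = (v ++ (y ++ true :: rcons u false)).
  by rewrite /= cat_rcons reopen_dyck ?dyck_cat // rcons_cat /= -catA.
rewrite IHv; last exact/dyck_cat/dyck_wrap.
by rewrite -!catA /= cat_rcons.
Qed.

Lemma iter_turn_size w : dyck w -> iter (size w) turn w = w.
Proof. by move=> dw; have := iter_turn_cat dw (isT : dyck [::]); rewrite cats0. Qed.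

(* After the turn the polygon of the first point becomes the polygon of the last one. *)
Lemma run_reopen1 (w v : word) (T : stack) d (e : state) : size w = size v ->
  (if d then e = Some (true, true) else e = None \/ e = Some (true, false)) ->
  run (zip w v) (T ++ [:: Some (false, d)]) = Some [::] ->
  run (zip w (reopen (nos T + ~~ d) v)) (T ++ [:: e]) = Some [:: Some (true, false)].
Proof.
elim: w v T d e => [|a w IH] [|b v] T d e //.
  by case: T => //.
rewrite [size _]/= [size _ in RHS]/= => -[sz] He.
rewrite [zip (a :: w) (b :: v)]/= [run _ _]/=.
case E: (step _ _) => [S|] //= R.
case: T E R => [|q T] E R; last first.
  move: E; rewrite step_cat; case E: (step _ _) => [S'|] //= [Es].
  have hn := step_nos E; rewrite -Es in R.
  have := IH _ S' d e sz He R.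
  case: b E hn => E hn.
    have -> : (nos (q :: T) + ~~ d).+1 = nos S' + ~~ d by move: hn => /=; lia.
    by move=> <-; rewrite /= -cat_cons (step_frame _ E).
  have -> : nos (q :: T) + ~~ d = (nos S' + ~~ d).+1 by move: hn => /=; lia.
  by move=> <-; rewrite /= -cat_cons (step_frame _ E).
case: a b E => [] [] /=.
- case=> Es; rewrite -Es in R.
  by have := IH _ [:: None] d e sz He R.
- case: d He => //= He [Es]; rewrite -Es in R.
  have := IH _ [::] true (Some (true, true)) sz (erefl _) R; rewrite /= => <-.
  by case: He => ->.
- case: d He => //= He [Es]; rewrite -Es in R.
  have := IH _ [::] false (Some (true, false)) sz (or_intror (erefl _)) R; rewrite /= => <-.
  by rewrite He.
- case: d He => //= -> [Es]; rewrite -Es in R.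
  by have := run_frame [:: Some (true, false)] R.
Qed.

(** Both edges of the first point are still pending at the bottom of the stack. Once one of them
    closes, [run_reopen1] applies: directly if it is the left one, after exchanging the two words if
    it is the right one. *)
Lemma run_reopen (w v : word) (T : stack) : size w = size v ->
  run (zip w v) (T ++ [:: None]) = Some [::] ->
  exists c, run (zip (reopen (mos T) w) (reopen (nos T) v)) T = Some [:: Some (c, ~~ c)].
Proof.
elim: w v T => [|a w IH] [|b v] T //.
  by case: T => //.
rewrite [size _]/= [size _ in RHS]/= => -[sz].
rewrite [zip (a :: w) (b :: v)]/= [run _ _]/=.
case E: (step _ _) => [S|] // R; rewrite [obind _ _]/= in R.
case: T E R => [|q T] E R; last first.
  move: E; rewrite step_cat; case E: (step _ _) => [S'|] // [Es].
  have hn := step_nos E; have hm := step_mos E; rewrite -Es in R.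
  have [c Hc] := IH _ S' sz R; exists c; rewrite -Hc.
  have -> : reopen (mos (q :: T)) (a :: w) = a :: reopen (mos S') w.
    case: (a) hm => /= hm; first by congr (_ :: reopen _ _); lia.
    by have -> : mos (q :: T) = (mos S').+1 by lia.
  have -> : reopen (nos (q :: T)) (b :: v) = b :: reopen (nos S') v.
    case: (b) hn => /= hn; first by congr (_ :: reopen _ _); lia.
    by have -> : nos (q :: T) = (nos S').+1 by lia.
  by rewrite [zip _ _]/= [run _ _]/= E.
case: a b E => [] [] //=.
- case=> Es; rewrite -Es in R.
  by have := IH _ [:: None] sz R.
- case=> Es; rewrite -Es in R.
  exists false.
  have R' : run (zip v w) ([::] ++ [:: Some (false, false)]) = Some [::].
    by rewrite zip_swap (_ : _ ++ _ = map neg_state [:: Some (true, true)]) // run_swap R.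
  have /= := run_reopen1 (d := false) (esym sz) (or_introl (erefl None)) R'.
  rewrite zip_swap => H; have := run_swap (map swap (zip (reopen 1 w) v)) [:: None].
  rewrite H -map_comp (eq_map (_ : _ =1 id)) ?map_id; last by case.
  by rewrite /nos /mos /= => ->.
- case=> Es; rewrite -Es in R.
  exists true.
  by have /= := run_reopen1 (T := [::]) (d := false) sz (or_introl (erefl None)) R.
Qed.

Lemma adj_turn w v : adj w v -> adj (turn w) (turn v).
Proof.
case/andP=> /eqP sz /eqP R; rewrite /adj !size_turn sz eqxx /=.
case: w v sz R => [|a w] [|b v] //= [sz].
case: a b => [] [] //= R.
have [c Hc] := run_reopen (T := [::]) sz R.
rewrite -!cats1 zip_cat ?size_reopen // run_cat Hc /=.
by case: (c).
Qed.

(** An accepted factor returns the stack to its previous value, so it can be skipped. *)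
Lemma adj_cat3 (x p y x' p' y' : word) : size x = size x' ->
  adj p p' -> adj (x ++ p ++ y) (x' ++ p' ++ y') = adj (x ++ y) (x' ++ y').
Proof.
move=> sx /andP[/eqP sp /eqP rp]; rewrite /adj !size_cat sx sp !eqn_add2l.
case: eqP => //= sy; rewrite !zip_cat // !run_cat.
case: (run (zip x x') _) => //= s; rewrite run_cat.
by have /= -> := run_frame s rp.
Qed.

Lemma adj_cat (x x' y y' : word) : adj x x' -> adj y y' -> adj (x ++ y) (x' ++ y').
Proof.
move=> ax ay; have := @adj_cat3 [::] x y [::] x' y' (erefl _) ax.
by rewrite /= => ->.
Qed.

(** * Cutting a pair of words along an edge of the first one *)

(** A left edge pending at the last vertex blocks its polygon: [step] rejects a letter that opens
    another left edge there, and the balanced left word contains no bracket that would close it.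
    Everything in between happens above this polygon. *)
Lemma run_locked z t c s1 s2 : dy (mos t) (unzip1 z) ->
  run z (t ++ Some (c, true) :: s1) = Some s2 ->
  exists t', [/\ s2 = t' ++ Some (c, true) :: s1, run z t = Some t' & mos t' = 0].
Proof.
elim: z t => [|[a b] z IH] t.
  by move=> /eqP h [<-]; exists t.
case: t => [|q t] d /=; last first.
  rewrite -cat_cons step_cat; case E: (step _ _) => [t'|] //= R.
  apply: IH R; have := step_mos E; case: (a) d => /= d e.
    by have -> : mos t' = (mos (q :: t)).+1 by lia.
  by move: d; have -> : mos (q :: t) = (mos t').+1 by lia.
case: a b d => [] [] //= d R.
by apply: (IH [:: None]).
Qed.

(** The component [true] is the cut edge, pending at the first vertex of its polygon; [d] tells
    whether a left edge is pending at the last vertex. Thus [mos t + d] counts the left edges opened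
    inside the cut edge, all of which are closed at the end. *)
Lemma run_half (z : seq letter) (t : stack) (d : bool) s1 s2 : dy (mos t + d) (unzip1 z) ->
  run z (t ++ Some (true, d) :: s1) = Some s2 ->
  exists t' d', [/\ s2 = t' ++ Some (true, d') :: s1,
    run z (t ++ [:: Some (true, d)]) = Some (t' ++ [:: Some (true, d')]) & mos t' + d' = 0].
Proof.
elim: z t d => [|[a b] z IH] t d.
  by move=> /eqP h [<-]; exists t, d.
case: t => [|q t] h /=; last first.
  rewrite -!cat_cons !step_cat; case E: (step _ _) => [t'|] //= R.
  apply: IH R; have := step_mos E; case: (a) h => /= h e.
    by have -> : mos t' + d = (mos (q :: t) + d).+1 by lia.
  by move: h; have -> : mos (q :: t) + d = (mos t' + d).+1 by lia.
case: a b d h => [] [] [] //= h R.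
- by apply: (IH [:: None] true).
- by apply: (IH [:: None] false).
- by apply: (IH [::] true).
- by apply: (IH [::] false).
Qed.

(** The polygon has just been started by the cut edge. Its right edge either passes beyond the part
    read, and the state stays [None], or it closes inside, and then the polygon remains on the inner
    side. *)
Lemma run_fresh (z : seq letter) (t : stack) s1 s2 : dy (mos t) (unzip1 z) ->
  run z (t ++ None :: s1) = Some s2 ->
  exists t', mos t' = 0 /\
   ((s2 = t' ++ None :: s1 /\ run z t = Some t') \/
    (exists d, [/\ d = false, s2 = t' ++ Some (true, d) :: s1 &
       run z (t ++ [:: None]) = Some (t' ++ [:: Some (true, d)])])).
Proof.
elim: z t => [|[a b] z IH] t.
  by move=> /eqP h [<-]; exists t; split=> //; left.
case: t => [|q t] h /=; last first.
  rewrite -!cat_cons !step_cat; case E: (step _ _) => [t'|] //= R.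
  apply: IH R; have := step_mos E; case: (a) h => /= h e.
    by have -> : mos t' = (mos (q :: t)).+1 by lia.
  by move: h; have -> : mos (q :: t) = (mos t').+1 by lia.
case: a b h => [] [] //= h R.
- by apply: (IH [:: None]).
- have [t' [d' [-> R' m0]]] := @run_half z [::] true s1 s2 h R.
  by exists t'; split; [lia|right; exists d'; split=> //; case: (d') m0 => //=; lia].
Qed.

Lemma split_size (T : Type) (s : seq T) n m : size s = n + m ->
  exists x y, [/\ s = x ++ y, size x = n & size y = m].
Proof.
move=> e; exists (take n s), (drop n s).
by rewrite cat_take_drop size_take size_drop e; split=> //; [case: ltnP => h|]; lia.
Qed.

Lemma step_close_mos0 t q s : mos t = 0 -> t <> [::] -> forall b, step (false, b) (t ++ q :: s) = None.
Proof. by case: t => [|[[[] []]|] t] // _ _ []. Qed.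

(** The polygon of the cut edge lies on one of its two sides. If it lies outside, the inner part is
    a compatible pair by itself and can be deleted; if inside, the edge goes with the inner part. *)
Lemma adj_cut (x u y V : word) : dyck u -> adj (x ++ true :: u ++ false :: y) V ->
  exists x' a u' b y', [/\ V = x' ++ a :: u' ++ b :: y', size x' = size x, size y' = size y &
    (adj u u' /\ adj (x ++ true :: false :: y) (x' ++ a :: b :: y')) \/
    (adj (x ++ y) (x' ++ y') /\ adj (true :: rcons u false) (a :: rcons u' b))].
Proof.
move=> du av; have /esym sV := adj_size av.
move: sV; rewrite size_cat /= size_cat /= => sV.
have [x' [V1 [eV sx sV1]]] := split_size sV.
case: V1 sV1 eV => [//|a V1] /= [sV1] eV.
have [u' [V2 [eV1 su sV2]]] := split_size sV1.
case: V2 sV2 eV1 => [//|b y'] /= [sy] eV1.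
exists x', a, u', b, y'; rewrite eV eV1; split=> //.
move: av; rewrite eV eV1 /adj => /andP[_ /eqP].
rewrite zip_cat // run_cat; case Ex: (run (zip x x') [::]) => [s|] //=.
case Ea: (step (true, a) s) => [s'|] //=.
rewrite zip_cat // run_cat.
case Eu: (run (zip u u') s') => [s2|] //=.
case Eb: (step (false, b) s2) => [s3|] //= Ey.
have du' : dy (mos [::]) (unzip1 (zip u u')) by rewrite unzip1_zip ?su.
have inner : run (zip u u') [::] = Some [::] -> s2 = s' ->
  (size u == size u') && (run (zip u u') [::] == Some [::]) /\
  (size (x ++ true :: false :: y) == size (x' ++ a :: b :: y')) &&
  (run (zip (x ++ true :: false :: y) (x' ++ a :: b :: y')) [::] == Some [::]).
  move=> Ru es; rewrite su Ru !eqxx; split=> //.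
  rewrite !size_cat /= sx sy eqxx zip_cat // run_cat Ex /= Ea /= -es Eb /= Ey.
  by rewrite eqxx.
(* The cut edge either continues a polygon already present, which is then locked, or starts a new
   one. Only the latter can turn out to lie inside. *)
have cs : (exists c s1, s' = Some (c, true) :: s1) \/ s' = None :: s /\ a = true.
  case: (a) s Ea {Ex} => [] [|[[c []]|] s] //=; rewrite /step /= => -[<-];
    by [right | left; exists c, s | left; exists true, s].
case: cs => [[c [s1 es]]|[es ea]].
  rewrite es in Eu.
  have [t' [e2 Rt m0]] := @run_locked _ [::] c s1 s2 du' Eu.
  left; apply: inner.
    case: t' e2 Rt m0 => [//|q t'] e2 Rt m0.
    by rewrite e2 step_close_mos0 in Eb.
  case: t' e2 Rt m0 => [|q t'] e2 Rt m0; first by rewrite e2 es.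
  by rewrite e2 step_close_mos0 in Eb.
rewrite es in Eu.
have [t' [m0 []]] := @run_fresh _ [::] s s2 du' Eu.
  case=> e2 Rt; left; apply: inner.
    case: t' e2 Rt m0 => [//|q t'] e2 Rt m0.
    by rewrite e2 step_close_mos0 in Eb.
  case: t' e2 Rt m0 => [|q t'] e2 Rt m0; first by rewrite e2 es.
  by rewrite e2 step_close_mos0 in Eb.
case=> d [-> e2 Rt]; right.
case: t' m0 e2 Rt => [|q t'] m0 e2 Rt; last by rewrite e2 step_close_mos0 in Eb.
move: Eb; rewrite e2; clear inner eV eV1; case: b Ey => Ey //; rewrite /step /= => -[es3].
rewrite !size_cat sx sy eqxx zip_cat // run_cat Ex /= es3 Ey; split=> //.
rewrite !size_rcons su eqxx ea /= -!cats1 zip_cat // run_cat.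
by move: Rt; rewrite /step /= => ->.
Qed.

Definition ins i (p w : word) : word := take i w ++ p ++ drop i w.

Lemma insE (x y p : word) : ins (size x) p (x ++ y) = x ++ p ++ y.
Proof. by rewrite /ins take_size_cat // drop_size_cat. Qed.

Lemma size_ins i p w : size (ins i p w) = size p + size w.
Proof. by rewrite /ins !size_cat -{3}(cat_take_drop i w) size_cat; lia. Qed.

Lemma adj_ins i p p' w v : adj p p' -> adj w v -> adj (ins i p w) (ins i p' v).
Proof.
move=> ap aw; rewrite /ins (adj_cat3 _ _ _ ap) ?cat_take_drop //.
by rewrite !size_take (adj_size aw).
Qed.

Inductive conn (w : word) : word -> Prop :=
| conn_refl : conn w w
| conn_step v u : conn w v -> adj v u -> conn w u.

Lemma conn1 w v : adj w v -> conn w v.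
Proof. exact/conn_step/conn_refl. Qed.

Lemma conn_trans v w u : conn w v -> conn v u -> conn w u.
Proof. by move=> cw; elim=> // x y _ cx; apply: conn_step. Qed.

Lemma conn_sym w v : conn w v -> conn v w.
Proof.
elim=> [|x y _ cx axy]; first exact: conn_refl.
by apply: conn_trans cx; apply: conn1; rewrite adj_sym.
Qed.

Lemma conn_size w v : conn w v -> size w = size v.
Proof. by elim=> // x y _ -> /adj_size. Qed.

Lemma conn_turn w v : conn w v -> conn (turn w) (turn v).
Proof.
by elim=> [|x y _ c a]; [exact: conn_refl|exact: conn_step c (adj_turn a)].
Qed.

Lemma conn_iter_turn r w v : conn w v -> conn (iter r turn w) (iter r turn v).
Proof. by move=> c; elim: r => //= r; apply: conn_turn. Qed.

(* The factor alternates along the walk, so only one of the two colours can be prescribed. *)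
Lemma conn_ins i p p' w v : adj p p' -> conn w v ->
  forall q, q \in [:: p; p'] ->
  exists2 q', q' \in [:: p; p'] & conn (ins i q w) (ins i q' v).
Proof.
move=> ap; elim=> [|x y _ IH axy] q hq; first by exists q => //; apply: conn_refl.
have [q' hq' c] := IH q hq.
move: hq'; rewrite !inE => /orP[] /eqP e; subst q'.
  by exists p'; rewrite ?inE ?eqxx ?orbT //; apply: conn_step c _; apply: adj_ins.
exists p; rewrite ?inE ?eqxx //; apply: conn_step c _; apply: adj_ins => //.
by rewrite adj_sym.
Qed.

Lemma reopen_ins j h p w : dyck p -> j <= size w -> reopen h (ins j p w) = ins j p (reopen h w).
Proof.
move=> dp; rewrite /ins.
elim: w j h => [|a w IH] [|j] h le //; try by rewrite !take0 !drop0 !cat0s reopen_dyck.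
case: a le => le /=; first by rewrite IH.
by case: h => [|h] //=; rewrite IH.
Qed.

Lemma turn_ins i p w : dyck p -> i < size w -> turn (ins i.+1 p w) = ins i p (turn w).
Proof.
case: w => [//|a w] dp le.
have -> : ins i.+1 p (a :: w) = a :: ins i p w by [].
rewrite /= reopen_ins // /ins -!cats1 -!catA /= takel_cat ?drop_cat ?size_reopen //.
move: le => /=; rewrite ltnS leq_eqVlt => /orP[/eqP->|->] //.
by rewrite ltnn subnn drop0 -{2}(size_reopen 0 w) drop_size.
Qed.

Lemma iter_turn_ins j i p w : dyck p -> j <= i -> i <= size w ->
  iter j turn (ins i p w) = ins (i - j) p (iter j turn w).
Proof.
move=> dp; elim: j => [|j IH] le li; first by rewrite subn0.
rewrite !iterS IH ?(ltnW le) //.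
have -> : i - j = (i - j.+1).+1 by lia.
by rewrite turn_ins // size_iter_turn; lia.
Qed.

(** * Ears *)

Definition leaves n : word := flatten (nseq n [:: true; false]).
Definition wrap (u : word) : word := true :: rcons u false.

Lemma size_leaves n : size (leaves n) = 2 * n.
Proof. by elim: n => //= n ->; lia. Qed.

Lemma size_wrap u : size (wrap u) = (size u).+2.
Proof. by rewrite /= size_rcons. Qed.

Lemma leavesD m n : leaves (m + n) = leaves m ++ leaves n.
Proof. by rewrite /leaves nseqD flatten_cat. Qed.

Lemma dyck_leaves n : dyck (leaves n).
Proof. by elim: n. Qed.

Fixpoint alt (a : bool) j : seq letter :=
  if j is j'.+1 then (a, ~~ a) :: (~~ a, a) :: alt a j' else [::].

(** A polygon on [2j + 4] consecutive points. For [a = false] the left word is the row of short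
    edges, for [a = true] the wrapped one. *)
Definition ear a j : seq letter := (true, true) :: rcons (alt a j.+1) (false, false).

(** The polygon on top is either finished without interruption, which forces alternating letters up
    to [(false, false)], or another polygon starts before; an innermost polygon of this kind is an
    ear. *)
Lemma run_alt_ear z q s : run z (q :: s) = Some [::] ->
  (exists u a j v, z = u ++ ear a j ++ v) \/
  (match q with
   | None => exists a j v, z = alt a j.+1 ++ (false, false) :: v
   | Some (c, d) => exists j v, z = (if d == c then (~~ c, c) :: alt c j else alt c j) ++ (false, false) :: v
   end).
Proof.
elim: z q s => [//|[a b] z IH] q s /=.
case E: (step _ _) => [s'|] //= R.
case: a b E => [] [] E.
- move: E => -[es]; rewrite -es in R.
  case: (IH _ _ R) => [[u [a [j [v ->]]]]|[a [j [v ->]]]].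
    by left; exists ((true, true) :: u), a, j, v.
  by left; exists [::], a, j, v; rewrite /ear /= -cats1 -!catA.
- case: q E => [[c d]|] //=; rewrite /step /=.
    case: d => //= -[es]; rewrite -es in R.
    case: (IH _ _ R) => [[u [a [j [v ->]]]]|[j [v ->]]].
      by left; exists ((true, false) :: u), a, j, v.
    by right; case: c R es => _ _; [exists j.+1, v|exists j, v].
  move=> [es]; rewrite -es in R.
  case: (IH _ _ R) => [[u [a [j [v ->]]]]|[j [v ->]]].
    by left; exists ((true, false) :: u), a, j, v.
  by right; exists true, j, v.
- case: q E => [[c d]|] //=; rewrite /step /=.
    case: d => //= -[es]; rewrite -es in R.
    case: (IH _ _ R) => [[u [a [j [v ->]]]]|[j [v ->]]].
      by left; exists ((false, true) :: u), a, j, v.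
    by right; case: c R es => _ _; [exists j, v|exists j.+1, v].
  move=> [es]; rewrite -es in R.
  case: (IH _ _ R) => [[u [a [j [v ->]]]]|[j [v ->]]].
    by left; exists ((false, true) :: u), a, j, v.
  by right; exists false, j, v.
- case: q E => [[c d]|] //=; rewrite /step /=.
  case: eqP => //= ne [es].
  right; case: c d ne es => [] [] //= _ _; by exists 0, z.
Qed.

Lemma unzip1_alt a j : unzip1 (alt a j) = flatten (nseq j [:: a; ~~ a]).
Proof. by elim: j => //= j ->. Qed.

Lemma unzip2_alt a j : unzip2 (alt a j) = flatten (nseq j [:: ~~ a; a]).
Proof. by elim: j => //= j ->. Qed.

Lemma leaves_shift j : true :: rcons (flatten (nseq j [:: false; true])) false = leaves j.+1.
Proof. by elim: j => //= j [->]. Qed.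

(** The union is the boundary of the convex hull of all points; these are the two ring matchings. *)
Lemma adj_leaves j : adj (leaves j.+2) (wrap (leaves j.+1)).
Proof.
rewrite /adj size_leaves size_wrap size_leaves; apply/andP; split; first by apply/eqP; lia.
suff H n : run (zip (false :: leaves n) (rcons (leaves n) false)) [:: Some (false, true)] = Some [::].
  exact/eqP/(H j).
by elim: n.
Qed.

Lemma zip_cat_inv (w v : word) z1 z2 : size w = size v -> zip w v = z1 ++ z2 ->
  exists w1 w2 v1 v2, [/\ w = w1 ++ w2, v = v1 ++ v2, size w1 = size v1, zip w1 v1 = z1 & zip w2 v2 = z2].
Proof.
move=> sz e; have sw : size w = size z1 + size z2.
  by rewrite -size_cat -e size_zip -sz minnn.
have [w1 [w2 [ew s1 s2]]] := split_size sw.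
have [v1 [v2 [ev t1 t2]]] := split_size (etrans (esym sz) sw).
exists w1, w2, v1, v2; split=> //; first by rewrite s1 t1.
  move: (congr1 (take (size z1)) e).
  rewrite ew ev zip_cat ?s1 ?t1 // !take_size_cat //.
  by rewrite size_zip s1 t1 minnn.
move: (congr1 (drop (size z1)) e).
rewrite ew ev zip_cat ?s1 ?t1 // !drop_size_cat //.
by rewrite size_zip s1 t1 minnn.
Qed.

Lemma zip_unzip (w v : word) z : size w = size v -> zip w v = z -> w = unzip1 z /\ v = unzip2 z.
Proof. by move=> sz <-; rewrite unzip1_zip ?unzip2_zip ?sz. Qed.

Lemma ear_words (w v : word) a j : size w = size v -> zip w v = ear a j ->
  (w = leaves j.+2 /\ v = wrap (leaves j.+1)) \/ (v = leaves j.+2 /\ w = wrap (leaves j.+1)).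
Proof.
move=> sz /(zip_unzip sz) [-> ->]; rewrite /ear /unzip1 /unzip2 !map_cons !map_rcons.
rewrite -!/(unzip1 _) -!/(unzip2 _) unzip1_alt unzip2_alt.
by case: a; [right|left]; rewrite leaves_shift.
Qed.

Lemma adj_ear w v : adj w v -> w <> [::] -> exists x y x' y' g g' j,
  [/\ w = x ++ g ++ y, v = x' ++ g' ++ y', size x = size x', adj (x ++ y) (x' ++ y') &
   (g = leaves j.+2 /\ g' = wrap (leaves j.+1)) \/ (g' = leaves j.+2 /\ g = wrap (leaves j.+1))].
Proof.
move=> aw nw; have sz := adj_size aw.
have : exists u a j r, zip w v = u ++ ear a j ++ r.
  case: w v aw nw sz => [//|a w] [//|b v] /andP[_ /eqP R] _ [sz].
  move: R => /=; case: a b => [] [] //= R.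
  case: (run_alt_ear R) => [[u [a [j [r ->]]]]|[a [j [r ->]]]].
    by exists ((true, true) :: u), a, j, r.
  by exists [::], a, j, r; rewrite /ear /= -cats1 -!catA.
case=> u [a [j [r e]]].
have [x [w2 [x' [v2 [ew ev sx _ e2]]]]] := zip_cat_inv sz e.
have s2 : size w2 = size v2 by move: sz; rewrite ew ev !size_cat; lia.
have [g [y [g' [y' [ew2 ev2 sg eg _]]]]] := zip_cat_inv s2 e2.
have H := ear_words sg eg.
exists x, y, x', y', g, g', j; split=> //; rewrite -?ew2 -?ev2 //.
have ag : adj g g'.
  by case: H => [[-> ->]|[-> ->]]; [|rewrite adj_sym]; apply: adj_leaves.
by rewrite -(adj_cat3 _ _ sx ag) -ew2 -ev2 -ew -ev.
Qed.

Definition quad : seq word := [:: leaves 2; wrap (leaves 1)].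

Lemma quadP p : p \in quad -> exists2 p', p' \in quad & adj p p'.
Proof.
by rewrite !inE => /orP[] /eqP ->; [exists (wrap (leaves 1))|exists (leaves 2)].
Qed.

Lemma quad_dyck p : p \in quad -> dyck p.
Proof. by rewrite !inE => /orP[] /eqP ->. Qed.

Lemma quad_size p : p \in quad -> size p = 4.
Proof. by rewrite !inE => /orP[] /eqP ->. Qed.

Definition flex (w : word) := exists v, adj w v.

(** A vertex with both edges pending may be split into two vertices with one edge each. The edge
    that closes first has to start at the later of the two, and this decides between the
    alternatives. *)
Lemma run_open z T s : run z (T ++ None :: s) = Some [::] ->
  run z (T ++ Some (false, true) :: s) = Some [::] \/ run z (T ++ Some (true, false) :: s) = Some [::].
Proof.
elim: z T => [|[a b] z IH] T; first by case: T.
rewrite [run (_ :: _) _]/= [run (_ :: _) _ in X in X \/ _]/= [run (_ :: _) _ in X in _ \/ X]/=.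
case: T => [|q T]; last first.
  rewrite !step_cat; case: (step _ _) => [S|] //=; exact: IH.
case: a b => [] [] //=.
- by move=> R; apply: (IH [:: None]).
- by right.
- by left.
Qed.

(** The polygon through the first point is lengthened by two vertices, one edge of which is the
    added [leaves 1]. Which of the two matchings receives this edge depends on the alternative in
    [run_open]. *)
Lemma adj_absorb w v : adj w v -> w <> [::] -> flex (leaves 1 ++ w) \/ flex (leaves 1 ++ v).
Proof.
move=> /andP[/eqP sz /eqP]; case: w v sz => [|a w] [|b v] //= [sz].
case: a b => [] [] //= R _.
case: (run_open (T := [::]) R) => /= R'.
  left; exists (true :: true :: false :: v); rewrite /adj /= sz eqxx /=.
  by rewrite /step /= R'.
right; exists (true :: true :: false :: w); rewrite /adj /= sz eqxx /=.
have := run_swap (zip w v) [:: Some (true, false)].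
by rewrite -zip_swap R' /step /= => ->.
Qed.

Lemma adj_iter_turn r w v : adj w v -> adj (iter r turn w) (iter r turn v).
Proof. by move=> a; elim: r => //= r; apply: adj_turn. Qed.

(** A quadrilateral ear is removed whole, and an ear with at least eight vertices stays an ear after
    the loss of two short edges. A hexagon ([j = 1]) leaves one lone edge: it is rotated to the
    front, and the rest absorbs that edge by [adj_absorb], possibly after passing to the neighbour.
    Only the hexagon alone has no rest. *)
Lemma flex_quad_ear w : flex w -> w <> [::] ->
  (w \in [:: leaves 3; wrap (leaves 2)]) \/
  exists r i p w0, [/\ p \in quad, i <= size w0, flex w0 & conn (iter r turn w) (ins i p w0)].
Proof.
case=> v aw nw.
have [x [y [x' [y' [g [g' [j [ew ev sx axy H]]]]]]]] := adj_ear aw nw.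
have main : forall x y x' y' j, size x = size x' -> adj (x ++ y) (x' ++ y') -> j != 1 ->
    exists i p w0, [/\ p \in quad, i <= size w0, flex w0 & x ++ leaves j.+2 ++ y = ins i p w0].
  clear x y x' y' j ew ev sx axy H; move=> x y x' y' [|[//|j]] sx axy _.
    exists (size x), (leaves 2), (x ++ y); rewrite insE size_cat leq_addr.
    by split=> //; eexists; exact: axy.
  exists (size x), (leaves 2), (x ++ leaves j.+2 ++ y); rewrite insE size_cat leq_addr.
  split=> //; exists (x' ++ wrap (leaves j.+1) ++ y').
  by rewrite (adj_cat3 _ _ sx) //; apply: adj_leaves.
have [j1|j1] := eqVneq j 1; last first.
  right; exists 0.
  case: H => [[eg eg']|[eg' eg]].
    have [i [p [w0 [hp hi hw e]]]] := main _ _ _ _ _ sx axy j1.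
    by exists i, p, w0; split=> //; rewrite -e -eg -ew; apply: conn_refl.
  move: axy; rewrite adj_sym => axy.
  have [i [p [w0 [hp hi hw e]]]] := main _ _ _ _ _ (esym sx) axy j1.
  by exists i, p, w0; split=> //; rewrite -e -eg' -ev; apply: conn1.
move: H; rewrite {}j1 => H.
have [xy0|xy0] := eqVneq (x ++ y) [::].
  left; move: xy0 H; rewrite ew; case: (x) => //= -> .
  by case=> [[-> _]|[_ ->]].
right; exists (size x).
have dg : forall g, (g = leaves 3 \/ g = wrap (leaves 2)) -> dyck g.
  by move=> ? [] ->.
have turned : forall a b g, (g = leaves 3 \/ g = wrap (leaves 2)) ->
    iter (size a) turn (a ++ g ++ b) = g ++ iter (size a) turn (a ++ b).
  move=> a b g0 /dg dg0; rewrite -insE iter_turn_ins // ?size_cat ?leq_addr //.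
  by rewrite subnn /ins take0 drop0.
have aT := adj_iter_turn (size x) axy.
have nT : iter (size x) turn (x ++ y) <> [::].
  by move/(congr1 size); rewrite size_iter_turn => /size0nil e; rewrite e in xy0.
have fin : forall a g, (g = leaves 3 \/ g = wrap (leaves 2)) -> flex (leaves 1 ++ a) ->
   exists i p w0, [/\ p \in quad, i <= size w0, flex w0 & g ++ a = ins i p w0].
  move=> a g0 [] -> fa.
    by exists 0, (leaves 2), (leaves 1 ++ a).
  by exists 1, (leaves 2), (leaves 1 ++ a).
have hg : g = leaves 3 \/ g = wrap (leaves 2) by case: H => [[-> _]|[_ ->]]; auto.
have hg' : g' = leaves 3 \/ g' = wrap (leaves 2) by case: H => [[_ ->]|[-> _]]; auto.
case: (adj_absorb aT nT) => ab.
  have [i [p [w0 [? ? ? e]]]] := fin _ _ hg ab.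
  by exists i, p, w0; split=> //; rewrite -e -turned // -ew; apply: conn_refl.
rewrite sx in ab.
have [i [p [w0 [? ? ? e]]]] := fin _ _ hg' ab.
exists i, p, w0; split=> //; rewrite -e -turned // -ev sx.
exact/conn1/adj_iter_turn.
Qed.

Lemma dyck_quad_factor w : dyck w -> 2 < size w ->
  exists i p w0, [/\ p \in quad, i <= size w0, dyck w0 & w = ins i p w0].
Proof.
move: w; apply: dyck_ind => [//|u v du dv IHu IHv].
have [su|su] := leqP 3 (size u).
  have [i [p [w0 [hp hi dw0 e]]]] := IHu su.
  move=> _; exists i.+1, p, (true :: w0 ++ false :: v); split=> //.
  - by rewrite /= ltnS size_cat; lia.
  - by have := dyck_cat (dyck_wrap dw0) dv; rewrite /= cat_rcons.
  rewrite e /ins /= takel_cat // drop_cat; case: ltnP => hi'; first by rewrite -!catA.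
  have -> : i = size w0 by lia.
  by rewrite subnn drop0 drop_size cats0 take_size -!catA.
have [sv|sv] := leqP 3 (size v).
  have [i [p [w0 [hp hi dw0 e]]]] := IHv sv.
  move=> _; exists ((size u).+2 + i), p, (true :: u ++ false :: w0); split=> //.
  - by rewrite /= size_cat /=; lia.
  - by have := dyck_cat (dyck_wrap du) dw0; rewrite /= cat_rcons.
  rewrite e /ins /= take_cat drop_cat.
  rewrite ifF; last by apply/negbTE; rewrite -leqNgt; lia.
  rewrite ifF; last by apply/negbTE; rewrite -leqNgt; lia.
  have -> : ((size u).+1 + i) - size u = i.+1 by lia.
  by rewrite /= -!catA.
have small : forall x, dyck x -> size x < 3 -> x \in [:: [::]; leaves 1].
  by case=> [|[] [|[] [|? ?]]].
move: (small _ du su) (small _ dv sv).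
rewrite !inE => /orP[] /eqP -> /orP[] /eqP -> //= _.
- by exists 0, (leaves 2), [::].
- by exists 0, (wrap (leaves 1)), [::].
- by exists 0, (wrap (leaves 1)), (leaves 1).
Qed.

Lemma flex_ins i p w : p \in quad -> flex w -> flex (ins i p w).
Proof.
move=> /quadP[p' _ ap] [v a]; exists (ins i p' v); exact: adj_ins.
Qed.

(** Two edges on four consecutive points can be removed again and again until nothing is left; a
    neighbour is obtained by flipping each removed block. *)
Lemma even_flex w : dyck w -> ~~ odd (size w)./2 -> flex w.
Proof.
elim: {w}(size w) {-2}w (leqnn (size w)) => [|n IH] w sz dw ow.
  by case: w sz dw ow => // _ _ _; exists [::].
have ew := dyck_even dw.
case: (ltnP 2 (size w)) => h2.
  have [i [p [w0 [hp hi dw0 e]]]] := dyck_quad_factor dw h2.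
  rewrite e; apply: flex_ins => //; apply: IH => //.
    by move: sz; rewrite e size_ins (quad_size hp); lia.
  by move: ow; rewrite e size_ins (quad_size hp) /= negbK.
case: w sz dw ow h2 ew => [|a [|b [|c w]]] // _ _ _ _ _; by exists [::].
Qed.

Lemma cat_inj_size (T : Type) (x1 x2 z1 z2 : seq T) :
  size x1 = size x2 -> x1 ++ z1 = x2 ++ z2 -> x1 = x2 /\ z1 = z2.
Proof.
move=> s e; split.
  by have := congr1 (take (size x1)) e; rewrite take_size_cat // s take_size_cat.
by have := congr1 (drop (size x1)) e; rewrite drop_size_cat // s drop_size_cat.
Qed.

(** The form used for all neighbour computations: [c] is a neighbour of what lies outside, in the
    applications mostly on few points and known by enumeration. *)
Lemma cutP x u y V : dyck u -> adj (x ++ wrap u ++ y) V ->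
  (exists c u', [/\ adj (x ++ leaves 1 ++ y) c, adj u u' & V = ins (size x).+1 u' c]) \/
  (exists c U, [/\ adj (x ++ y) c, adj (wrap u) U & V = ins (size x) U c]).
Proof.
move=> du; rewrite /wrap -cats1 /= -catA => /(adj_cut du).
case=> x' [a [u' [b [y' [-> sx sy [[au ac]|[ac au]]]]]]]; [left|right].
  exists (x' ++ a :: b :: y'), u'; split=> //; rewrite -sx.
  have e : x' ++ a :: b :: y' = rcons x' a ++ b :: y' by rewrite cat_rcons.
  by rewrite e -(size_rcons x' a) insE cat_rcons.
exists (x' ++ y'), (a :: rcons u' b); rewrite -[u ++ _]/(u ++ [:: false]) cats1; split=> //.
by rewrite -sx insE /= cat_rcons.
Qed.

Fixpoint words n : seq word :=
  if n is n'.+1 then [seq b :: w | b <- [:: true; false], w <- words n'] else [:: [::]].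

Lemma mem_words w : w \in words (size w).
Proof.
elim: w => // a w IH; apply/allpairsP; exists (a, w); split=> //.
by case: a; rewrite !inE.
Qed.

Definition nbrs w := [seq v <- words (size w) | adj w v].

Lemma adj_nbrs w v : adj w v -> v \in nbrs w.
Proof. by move=> a; rewrite mem_filter a (adj_size a) mem_words. Qed.

(** * Caterpillars and their components *)

(** A turn [b] tells on which side of the spine the extra edge of a level lies: behind for [true],
    in front for [false]. [wM] and [wN] are the two matchings of a quadrilateral with the remaining
    levels inserted, and [mid] is a row of three edges, one side of a hexagon, with an insertion. *)
Definition lside b : word := if b then [::] else leaves 1.
Definition rside b : word := if b then leaves 1 else [::].
Definition wM b u : word := lside b ++ wrap u ++ rside b.
Definition wN b u : word := wrap (lside b ++ u ++ rside b).
Definition mid b u : word := (lside b ++ leaves 1) ++ u ++ (leaves 1 ++ rside b).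

Definition cM (t : seq bool) : word := foldr wM [::] t.
Definition cN (t : seq bool) : word := foldr wN [::] t.
Definition cX (t : seq bool) : word := wrap (cM t).

Arguments wrap : simpl never.
Arguments wM : simpl never.
Arguments wN : simpl never.
Arguments mid : simpl never.
Arguments cM : simpl never.
Arguments cN : simpl never.

Lemma cM_cons b t : cM (b :: t) = wM b (cM t). Proof. by []. Qed.
Lemma cN_cons b t : cN (b :: t) = wN b (cN t). Proof. by []. Qed.

(** The union of [cX t] with one of these words consists of one hexagon and otherwise
    quadrilaterals; the position in the list is the level of the hexagon. *)
Fixpoint starN (t : seq bool) : seq word :=
  if t is b :: t' then mid b (cN t') :: map (wM b) (starN t') else [::].

(* [LM t] and [LN t] list the two colour classes of the middle component of even
   order: [A1] and [B1] generate its half graph, each [B1] having the pendant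
   neighbours [PB1], [PB2] and each [A1] the pendant neighbours [PA1], [PA2]. *)
Definition A1 b t := mid b (cX t).
Definition B1 b t := wrap (mid b (cN t)).
Definition PB1 b t := if b then leaves 1 ++ wrap (cM t ++ wrap (leaves 1))
                      else wrap (wrap (leaves 1) ++ cM t) ++ leaves 1.
Definition PB2 b t := lside b ++ wrap (wrap (wrap (cM t))) ++ rside b.
Definition PA1 b t := if b then wrap (leaves 1 ++ cN t) ++ wrap (leaves 1)
                      else wrap (leaves 1) ++ wrap (cN t ++ leaves 1).
Definition PA2 b t := wrap (wrap (wN b (cN t))).

Fixpoint LM (t : seq bool) : seq word :=
  if t is b :: t' then [:: A1 b t', PB1 b t', PB2 b t' & map (wM b) (LM t')] else [::].
Fixpoint LN (t : seq bool) : seq word :=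
  if t is b :: t' then [:: B1 b t', PA1 b t', PA2 b t' & map (wN b) (LN t')] else [::].

Ltac weq := rewrite /ins /A1 /B1 /PB1 /PB2 /PA1 /PA2 /cX ?cM_cons ?cN_cons /wM /wN /mid /wrap /lside /rside /leaves /=
  -?cats1 /= -?catA /= -?catA /= ?cats0 ?take0 ?drop0 /=; reflexivity.

Lemma dyckw u : dyck u -> dyck (wrap u). Proof. exact: dyck_wrap. Qed.

Lemma dyck_lside b : dyck (lside b). Proof. by case: b. Qed.
Lemma dyck_rside b : dyck (rside b). Proof. by case: b. Qed.

Ltac dyk := repeat first [exact: dyck_leaves | exact: dyck_lside | exact: dyck_rside
  | assumption | apply: dyckw | apply: dyck_cat].

Lemma dyck_wM b u : dyck u -> dyck (wM b u).
Proof. by move=> du; rewrite /wM; dyk. Qed.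
Lemma dyck_wN b u : dyck u -> dyck (wN b u).
Proof. by move=> du; rewrite /wN; dyk. Qed.
Lemma dyck_mid b u : dyck u -> dyck (mid b u).
Proof. by move=> du; rewrite /mid; dyk. Qed.
Lemma dyck_cM t : dyck (cM t).
Proof. by elim: t => //= b t; apply: dyck_wM. Qed.
Lemma dyck_cN t : dyck (cN t).
Proof. by elim: t => //= b t; apply: dyck_wN. Qed.

Lemma dyck_starN t w : w \in starN t -> dyck w.
Proof.
elim: t w => // b t IH w; rewrite /= inE => /orP[/eqP->|/mapP[v /IH dv ->]].
  exact/dyck_mid/dyck_cN.
exact: dyck_wM.
Qed.

Lemma dyck_LM t w : w \in LM t -> dyck w.
Proof.
elim: t w => // b t IH w; rewrite /= !inE => /or4P[/eqP->|/eqP->|/eqP->|/mapP[v /IH dv ->]].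
- exact/dyck_mid/dyckw/dyck_cM.
- by rewrite /PB1; have := dyck_cM t; case: b => d; dyk.
- by rewrite /PB2; have := dyck_cM t; case: b => d; dyk.
- exact: dyck_wM.
Qed.

Lemma dyck_LN t w : w \in LN t -> dyck w.
Proof.
elim: t w => // b t IH w; rewrite /= !inE => /or4P[/eqP->|/eqP->|/eqP->|/mapP[v /IH dv ->]].
- exact/dyckw/dyck_mid/dyck_cN.
- by rewrite /PA1; have := dyck_cN t; case: b => d; dyk.
- by rewrite /PA2 /wN; have := dyck_cN t; case: b => d; dyk.
- exact: dyck_wN.
Qed.

Lemma size_wM b u : size (wM b u) = (size u).+4.
Proof. by rewrite /wM !size_cat size_wrap; case: b => /=; lia. Qed.
Lemma size_wN b u : size (wN b u) = (size u).+4.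
Proof. by rewrite /wN size_wrap !size_cat; case: b => /=; lia. Qed.
Lemma size_mid b u : size (mid b u) = (size u).+2.+4.
Proof. by rewrite /mid !size_cat; case: b => /=; lia. Qed.
Lemma size_cM t : size (cM t) = 4 * size t.
Proof. by elim: t => // b t IH; rewrite cM_cons size_wM IH /=; lia. Qed.
Lemma size_cN t : size (cN t) = 4 * size t.
Proof. by elim: t => // b t IH; rewrite cN_cons size_wN IH /=; lia. Qed.

Lemma nadj1 c : adj (leaves 1) c = false.
Proof. by apply/negP=> /adj_nbrs. Qed.

Lemma adj_l2 c : adj (leaves 2) c -> c = wrap (leaves 1).
Proof. by move/adj_nbrs; rewrite inE => /eqP. Qed.

Lemma adj_b2 c : adj (wrap (leaves 1)) c -> c = leaves 2.
Proof. by move/adj_nbrs; rewrite inE => /eqP. Qed.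

Lemma adj_l3 c : adj (leaves 3) c -> c = wrap (leaves 2).
Proof. by move/adj_nbrs; rewrite inE => /eqP. Qed.

Lemma adj_b3 c : adj (wrap (leaves 2)) c -> c = leaves 3.
Proof. by move/adj_nbrs; rewrite inE => /eqP. Qed.

(** If the polygon of the outer edge lay inside it, the extra edge outside would need a neighbour on
    its own two points. *)
Lemma nb_wM b x V : dyck x -> adj (wM b x) V -> exists2 u, adj x u & V = wN b u.
Proof.
move=> dx /(cutP dx) [[c [u [ac au ->]]]|[c [U [ac]]]]; last by case: b ac; rewrite nadj1.
exists u => //; have -> : c = wrap (leaves 1) by apply: adj_l2; case: b ac.
by case: b {ac}; weq.
Qed.

Lemma adj_w b x u : adj x u -> adj (wM b x) (wN b u).
Proof.
move=> a.
have -> : wM b x = ins (size (lside b)).+1 x (leaves 2).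
  by case: b; weq.
have -> : wN b u = ins (size (lside b)).+1 u (wrap (leaves 1)).
  by case: b; weq.
exact: adj_ins.
Qed.

Lemma nbM t V : adj (cM t) V -> V = cN t.
Proof.
elim: t V => [|b t IH] V; first by case/andP => /eqP; case: V.
by move=> /(nb_wM (dyck_cM t)) [u /IH -> ->].
Qed.

Lemma adjMN t : adj (cM t) (cN t).
Proof. by elim: t => // b t IH; apply: adj_w. Qed.

(** These are isolated matchings with an odd number of edges. A cut along the outer edge of [cN t]
    leaves either a word of the same shape one level deeper or a lone edge. *)
Lemma rigid_side b t V : adj (lside b ++ cN t ++ rside b) V = false.
Proof.
elim: t b V => [|b' t IH] b V; apply/negP.
  by case: b; rewrite /= ?nadj1.
move=> /cutP []; first by move: (dyck_cN t) => ?; dyk.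
  by case=> c [u [_]]; rewrite IH.
by case=> c [U []]; case: b; rewrite nadj1.
Qed.

Lemma nbN t V : adj (cN t) V -> V = cM t.
Proof.
elim: t V => [|b t IH] V; first by case/andP => /eqP; case: V.
case: t IH => [|b' t] IH; first by case: b => /adj_b2 ->.
rewrite cN_cons => H.
have {H} : adj ((true :: lside b) ++ wrap (lside b' ++ cN t ++ rside b') ++ rcons (rside b) false) V.
  by move: H; case: b => H; move: H; congr adj; weq.
case/cutP; first by move: (dyck_cN t) => ?; dyk.
  by case=> c [u [_]]; rewrite rigid_side.
case=> c [U [ac /IH ->]] ->.
have -> : c = leaves 2 by apply: adj_b2; case: b ac.
by case: b {ac}; weq.
Qed.

Lemma cX_cons b t : cX (b :: t) = wrap (lside b ++ cX t ++ rside b).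
Proof. by []. Qed.

(** The cut along the second spine edge leaves outside either a wrapped pair of edges, giving the
    hexagon at this level, or a quadrilateral, and then the recursion goes inside. *)
Lemma nbX t V : adj (cX t) V -> V \in starN t.
Proof.
elim: t V => [|b t IH] V /=; first by rewrite /cX nadj1.
rewrite cX_cons => H.
have {H} : adj ((true :: lside b) ++ wrap (cM t) ++ rcons (rside b) false) V.
  by move: H; case: b => H; move: H; congr adj; weq.
case/(cutP (dyck_cM t)) => [[c [u [ac /nbM -> ->]]]|[c [U [ac /IH hU ->]]]].
  have -> : c = leaves 3 by apply: adj_b3; case: b ac.
  by apply/predU1P; left; case: b {ac}; weq.
have -> : c = leaves 2 by apply: adj_b2; case: b ac.
apply/predU1P; right; apply/mapP; exists U => //.
by case: b {ac}; weq.
Qed.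

Lemma adj_mid b t : adj (cX (b :: t)) (mid b (cN t)).
Proof.
have -> : cX (b :: t) = ins (size (lside b)).+2 (cM t) (wrap (leaves 2)) by case: b; weq.
have -> : mid b (cN t) = ins (size (lside b)).+2 (cN t) (leaves 3) by case: b; weq.
by apply: adj_ins; [exact: adjMN|].
Qed.

Lemma adj_wN b x u : adj x u -> adj (wN b x) (wM b u).
Proof. by rewrite adj_sym => /(adj_w b); rewrite adj_sym. Qed.

Lemma starX t V : V \in starN t -> adj (cX t) V.
Proof.
elim: t V => //= b t IH V; rewrite inE => /orP[/eqP->|/mapP[U /IH a ->]]; first exact: adj_mid.
exact: adj_wN.
Qed.

Lemma nb_mid b t V : adj (mid b (cN t)) V -> V = cX (b :: t).
Proof.
case: t => [|b' t]; first by case: b => /adj_l3 ->.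
rewrite {1}/mid cN_cons {1}/wN => /cutP[]; first by move: (dyck_cN t) => ?; dyk.
  by case=> c [u [_]]; rewrite rigid_side.
case=> c [U [ac /(@nbN (b' :: t)) -> ->]].
have -> : c = wrap (leaves 2) by apply: adj_l3; case: b ac.
by move: (cM (b' :: t)) (cM_cons b (b' :: t)) => m e; rewrite /cX e; case: b {ac e}; weq.
Qed.

Lemma nb_starN t V W : V \in starN t -> adj V W -> W = cX t.
Proof.
elim: t V W => //= b t IH V W; rewrite inE => /orP[/eqP->|/mapP[U hU ->]].
  exact: nb_mid.
by move/(nb_wM (dyck_starN hU)) => [u /(IH _ _ hU) -> ->].
Qed.

Fixpoint PAs (t : seq bool) : seq word :=
  if t is b :: t' then [:: PA1 b t', PA2 b t' & map (wN b) (PAs t')] else [::].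

Lemma PAs_LN t x : x \in PAs t -> x \in LN t.
Proof.
elim: t x => //= b t IH x; rewrite !inE => /or3P[->|->|/mapP[y /IH hy ->]]; rewrite ?orbT //.
by apply/or4P/Or44/map_f.
Qed.

Lemma LN_cases t x : x \in LN t -> (exists2 z, z \in starN t & x = wrap z) \/ x \in PAs t.
Proof.
elim: t x => //= b t IH x; rewrite !inE => /or4P[/eqP->|/eqP->|/eqP->|/mapP[y /IH hy ->]];
  rewrite ?eqxx ?orbT; auto.
  by left; exists (mid b (cN t)); rewrite ?mem_head.
case: hy => [[z hz ->]|hy].
  by left; exists (wM b z) => //; rewrite inE map_f ?orbT.
by right; rewrite map_f ?orbT.
Qed.

Definition rigid (w : word) := forall V, adj w V = false.

Lemma rigid_wrap_side b' z : dyck z -> rigid z -> rigid (lside b' ++ wrap z ++ rside b').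
Proof.
move=> dz rz V; apply/negP=> /(cutP dz)[[c [u [_]]]|[c [U []]]]; first by rewrite rz.
by case: b'; rewrite nadj1.
Qed.

Lemma rigid_wrap2 z : dyck z -> rigid z -> rigid (wrap (wrap z)).
Proof.
move=> dz rz V; apply/negP; rewrite {1}/wrap -cats1 -[true :: _]/([:: true] ++ (wrap z ++ _)).
case/(cutP dz) => [[c [u [_]]]|[c [U []]]]; first by rewrite rz.
by rewrite -[_ ++ _]/(leaves 1) nadj1.
Qed.

Lemma dyck_side b u : dyck u -> dyck (lside b ++ u ++ rside b).
Proof. by move=> du; dyk. Qed.

Lemma rigid_inner b t : rigid (lside b ++ cN t ++ rside b).
Proof. move=> V; exact: rigid_side. Qed.

Lemma dyck_inner b t : dyck (lside b ++ cN t ++ rside b).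
Proof. exact/dyck_side/dyck_cN. Qed.

Lemma PA1E b t : PA1 b t =
  (if b then [::] else wrap (leaves 1)) ++ wrap (lside (~~ b) ++ cN t ++ rside (~~ b)) ++
  (if b then wrap (leaves 1) else [::]).
Proof. by case: b; weq. Qed.

Lemma dyck_PAs t x : x \in PAs t -> dyck x.
Proof. by move/PAs_LN/dyck_LN. Qed.

(** This excludes the hexagon alternative of [wN_cut] when a pendant word is wrapped by further
    levels, so that pendants stay pendant. *)
Lemma rigid_PA t x b : x \in PAs t -> rigid (lside b ++ x ++ rside b).
Proof.
elim: t x b => //= b' t IH x b; rewrite !inE => /or3P[/eqP->|/eqP->|/mapP[y hy ->]].
- move=> V; apply/negP; rewrite PA1E -!catA [X in adj X]catA.
  case/(cutP (dyck_inner _ _)) => [[c [u [_]]]|[c [U [ac _ _]]]]; first by rewrite rigid_side.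
  by move: (adj_nbrs ac); case: b b' {ac} => [] [].
- apply: rigid_wrap_side; first by apply/dyckw/dyck_wN/dyck_cN.
  by apply: rigid_wrap2; [exact: dyck_inner|exact: rigid_inner].
- by apply: rigid_wrap_side; [apply/dyck_side/(dyck_PAs hy)|exact: IH].
Qed.

Lemma wN_cut b z V : dyck z -> adj (wN b (wrap z)) V ->
  (exists2 u, adj z u & V = mid b u) \/ (exists2 U, adj (wrap z) U & V = wM b U).
Proof.
move=> dz H.
have {H} : adj ((true :: lside b) ++ wrap z ++ rcons (rside b) false) V.
  by move: H; case: b => H; move: H; congr adj; weq.
case/(cutP dz) => [[c [u [ac au ->]]]|[c [U [ac aU ->]]]]; [left|right].
  exists u => //; have -> : c = leaves 3 by apply: adj_b3; case: b ac.
  by case: b {ac}; weq.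
exists U => //; have -> : c = leaves 2 by apply: adj_b2; case: b ac.
by case: b {ac}; weq.
Qed.

Lemma nb_wN_rigid b z V : dyck z -> rigid z -> adj (wN b (wrap z)) V ->
  exists2 U, adj (wrap z) U & V = wM b U.
Proof. by move=> dz rz /(wN_cut dz) [[u]|//]; rewrite rz. Qed.

Lemma nb_wN_PA b t x V : x \in PAs t -> adj (wN b x) V ->
  exists2 U, adj x U & V = wM b U.
Proof.
case: t => //= b' t; rewrite !inE => /or3P[/eqP->|/eqP->|/mapP[y hy ->]].
- move=> H.
  have {H} : adj ((true :: lside b ++ (if b' then [::] else wrap (leaves 1))) ++
     wrap (lside (~~ b') ++ cN t ++ rside (~~ b')) ++
     ((if b' then wrap (leaves 1) else [::]) ++ rcons (rside b) false)) V.
    by move: H; rewrite PA1E; case: b b' => [] [] H; move: H; congr adj; weq.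
  case/(cutP (dyck_inner _ _)) => [[c [u [_]]]|[c [U [ac aU ->]]]]; first by rewrite rigid_side.
  exists ((if b' then [::] else leaves 2) ++ U ++ (if b' then leaves 2 else [::])).
    rewrite PA1E; apply: adj_cat; first by case: (b').
    by apply: adj_cat => //; case: (b').
  by move: (adj_nbrs ac); case: b b' {ac aU} => [] []; rewrite inE => /eqP ->; weq.
- apply: nb_wN_rigid; first by apply/dyckw/dyck_wN/dyck_cN.
  by apply: rigid_wrap2; [exact: dyck_inner|exact: rigid_inner].
- by apply: nb_wN_rigid; [apply/dyck_side/(dyck_PAs hy)|exact: (rigid_PA _ hy)].
Qed.

Lemma nb_PA1 b t V : adj (PA1 b t) V -> V = A1 b t.
Proof.
rewrite PA1E; case/(cutP (dyck_inner _ _)) => [[c [u [_]]]|[c [U [ac]]]]; first by rewrite rigid_side.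
move/(@nbN (~~ b :: t)) => -> ->.
have -> : c = leaves 2 by apply: adj_b2; case: b ac.
by case: b {ac}; weq.
Qed.

Lemma nb_PA2 b t V : adj (PA2 b t) V -> V = A1 b t.
Proof.
move=> H; have {H} : adj ([:: true; true] ++ wrap (lside b ++ cN t ++ rside b) ++ [:: false; false]) V.
  by move: H; congr adj; case: b; weq.
case/(cutP (dyck_inner _ _)) => [[c [u [_]]]|[c [U [/adj_b2 ->]]]]; first by rewrite rigid_side.
by move/(@nbN (b :: t)) => -> ->; case: b; weq.
Qed.

(** Once the inner caterpillar has been cut off, four edges of [A1] or [B1] remain; their neighbours
    are read off from this list and from [nbrs_b4]. *)
Lemma nbrs_l4 : nbrs (leaves 4) =
  [:: wrap (wrap (wrap (leaves 1))); wrap (leaves 3); wrap (leaves 1) ++ wrap (leaves 1)].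
Proof. by vm_compute. Qed.

Lemma nbrs_b4 : nbrs (wrap (leaves 3)) =
  [:: wrap (wrap (leaves 1)) ++ leaves 1; leaves 1 ++ wrap (wrap (leaves 1)); leaves 4].
Proof. by vm_compute. Qed.

Lemma nb_B1 b t V : adj (B1 b t) V -> V \in [:: A1 b t; PB1 b t; PB2 b t].
Proof.
case: t => [|b' t].
  by case: b => /adj_nbrs; rewrite nbrs_b4 !inE => /or3P[]/eqP->; rewrite ?eqxx ?orbT.
move=> H; have {H} : adj ((true :: lside b ++ leaves 1) ++ wrap (lside b' ++ cN t ++ rside b') ++
    rcons (leaves 1 ++ rside b) false) V.
  by move: H; rewrite /B1 cN_cons /wN; move: (lside b' ++ _) => m; congr adj; case: b; weq.
case/(cutP (dyck_inner _ _)) => [[c [u [_]]]|[c [U [ac]]]]; first by rewrite rigid_side.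
move/(@nbN (b' :: t)) => -> ->.
have : c \in nbrs (wrap (leaves 3)) by apply: adj_nbrs; case: b ac.
rewrite nbrs_b4 /A1 /PB1 /PB2 /cX; move: (cM (b' :: t)) => m.
rewrite !inE => /or3P[]/eqP->; case: b {ac}; apply/or3P.
- by apply: Or33; apply/eqP; weq.
- by apply: Or32; apply/eqP; weq.
- by apply: Or32; apply/eqP; weq.
- by apply: Or33; apply/eqP; weq.
- by apply: Or31; apply/eqP; weq.
- by apply: Or31; apply/eqP; weq.
Qed.

(** For a word wrapped by [wN] the cut gives a neighbour one level deeper or a hexagon outside. The
    latter occurs only for [wrap z] with [z] in [starN t]; the inner part is then [cX t], and the
    neighbour is [A1]. *)
Lemma LN_closed t x V : x \in LN t -> adj x V -> V \in LM t.
Proof.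
elim: t x V => //= b t IH x V; rewrite [x \in _]inE => /orP[/eqP->|].
  by move/nb_B1; rewrite !inE => /or3P[]->; rewrite ?orbT.
move=> hx; have [/mapP[y hy ->] | hx' ] := boolP (x \in map (wN b) (LN t)).
  have [[z hz ey]|hy'] := LN_cases hy.
    rewrite ey => /(wN_cut (dyck_starN hz)) [[u]|[U]].
      by move/(nb_starN hz) -> => ->; rewrite inE eqxx.
    by rewrite -ey => /(IH _ _ hy) hU ->; apply/or4P/Or44/map_f.
  by move/(nb_wN_PA hy') => [U /(IH _ _ hy) hU ->]; apply/or4P/Or44/map_f.
move: hx; rewrite !inE (negbTE hx') orbF => /orP[]/eqP->.
  by move/nb_PA1->; rewrite eqxx.
by move/nb_PA2->; rewrite eqxx.
Qed.

(** The second alternative is the cut with a neighbour of [cX t] inside. It yields the word [B1] of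
    every deeper level, which is the origin of the half graph. *)
Lemma nb_A1 b t V : adj (A1 b t) V ->
  V \in [:: B1 b t; PA1 b t; PA2 b t] \/ exists2 z, z \in starN t & V = wN b (wrap z).
Proof.
rewrite /A1 /mid; case/(cutP (dyck_cM t)) => [[c [u [ac /nbM -> ->]]]|[c [U [ac /nbX hU ->]]]].
  left; have : c \in nbrs (leaves 4) by apply: adj_nbrs; case: b ac.
  rewrite nbrs_l4 !inE => /or3P[]/eqP->; case: b {ac}; apply/or3P.
  - by apply: Or33; apply/eqP; weq.
  - by apply: Or33; apply/eqP; weq.
  - by apply: Or31; apply/eqP; weq.
  - by apply: Or31; apply/eqP; weq.
  - by apply: Or32; apply/eqP; weq.
  - by apply: Or32; apply/eqP; weq.
right; exists U => //; have -> : c = wrap (leaves 2) by apply: adj_l3; case: b ac.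
by case: b {ac}; weq.
Qed.

Lemma nb_PB1 b t V : adj (PB1 b t) V -> V = B1 b t.
Proof.
have dm := dyck_cM t.
move=> H; have {H} : adj (lside (~~ b) ++ wrap ((if b then [::] else wrap (leaves 1)) ++ cM t ++
   (if b then wrap (leaves 1) else [::])) ++ rside (~~ b)) V.
  by move: H; congr adj; case: b; weq.
case/cutP; first by case: b; dyk.
  case=> c [u [ac + ->]] => H.
  have -> : c = wrap (leaves 1) by apply: adj_l2; clear H; case: b ac.
  suff -> : u = (if b then [::] else leaves 2) ++ cN t ++ (if b then leaves 2 else [::]).
    by clear ac H; case: b; weq.
  case: b H {ac} => /=.
    rewrite -[cM t ++ _]cats0 -catA; case/cutP => // [[c' [u' [_]]]|[c' [U [+ /adj_b2 -> ->]]]].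
      by rewrite nadj1.
    rewrite cats0 => /nbM ->; rewrite size_cM -(size_cN t).
    by have := insE (cN t) [::] (leaves 2); rewrite !cats0 => ->.
  rewrite cats0 -[X in adj X]/([::] ++ wrap (leaves 1) ++ cM t); case/cutP => // [[c' [u' [_]]]|[c' [U [+ /adj_b2 -> ->]]]].
    by rewrite nadj1.
  by move=> /= /nbM ->; weq.
by case=> c [U [+ _ _]]; case: b; rewrite nadj1.
Qed.

Lemma nb_PB2 b t V : adj (PB2 b t) V -> V = B1 b t.
Proof.
have dm := dyck_cM t.
case/cutP; [by dyk|case=> c [u [ac + ->]] => H | by case=> c [U [+ _ _]]; case: b; rewrite nadj1].
have -> : c = wrap (leaves 1) by apply: adj_l2; case: b ac.
suff -> : u = leaves 1 ++ cN t ++ leaves 1 by clear ac H; case: b; weq.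
move: H; rewrite {1}/wrap -cats1 -[true :: _]/([:: true] ++ (wrap (cM t) ++ _)).
case/(cutP dm) => [[c' [u' [/adj_b2 -> /nbM -> ->]]]|[c' [U []]]]; first by weq.
by rewrite -[_ ++ _]/(leaves 1) nadj1.
Qed.

Lemma LM_closed t x V : x \in LM t -> adj x V -> V \in LN t.
Proof.
elim: t x V => //= b t IH x V; rewrite inE => /orP[/eqP->|].
  case/nb_A1 => [|[z hz ->]]; first by rewrite !inE => /or3P[]->; rewrite ?orbT.
  apply/or4P/Or44/map_f.
  elim: t z hz {IH} => //= b' t IH z; rewrite !inE => /orP[/eqP->|/mapP[y /IH hy ->]].
    by rewrite eqxx.
  by apply/or4P/Or44/mapP; exists (wrap y).
rewrite !inE => /or3P[/eqP->|/eqP->|/mapP[y hy ->]].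
- by move/nb_PB1->; rewrite eqxx.
- by move/nb_PB2->; rewrite eqxx.
- by move/(nb_wM (dyck_LM hy)) => [u /(IH _ _ hy) hu ->]; apply/or4P/Or44/map_f.
Qed.

Arguments A1 : simpl never.
Arguments B1 : simpl never.
Arguments PB1 : simpl never.
Arguments PB2 : simpl never.
Arguments PA1 : simpl never.
Arguments PA2 : simpl never.

(** * Distinctness and adjacency of the words of the middle component *)

Lemma wrap_inj : injective wrap.
Proof. by move=> x y [/rcons_inj []]. Qed.

Lemma wM_inj b : injective (wM b).
Proof.
move=> x y e; have /eqP := congr1 size e; rewrite !size_wM !eqSS => /eqP s.
have [_ /cat_inj_size] := cat_inj_size (erefl (size (lside b))) e.
by rewrite !size_wrap s => /(_ (erefl _)) [/wrap_inj].
Qed.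

Lemma wN_inj b : injective (wN b).
Proof.
move=> x y e; have /eqP := congr1 size e; rewrite !size_wN !eqSS => /eqP s.
have [_ /cat_inj_size] := cat_inj_size (erefl (size (lside b))) (wrap_inj e).
by rewrite s => /(_ (erefl _)) [].
Qed.

(** A short edge at the beginning or the end of the word. It distinguishes the two colour classes:
    all words of [LM t] have one, none of [LN t] has. *)
Definition tip (w : word) := (take 2 w == leaves 1) || (take 2 (rev w) == rev (leaves 1)).

Lemma tip_l x : tip (leaves 1 ++ x). Proof. by rewrite /tip /= take0. Qed.
Lemma tip_r x : tip (x ++ leaves 1). Proof. by rewrite /tip rev_cat /= take0 eqxx orbT. Qed.
Lemma ntip_wrap2 x : tip (wrap (wrap x)) = false.
Proof. by rewrite /tip /wrap !(rev_cons, rev_rcons) /=. Qed.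

Lemma dyck_head x : dyck x -> x != [::] -> exists x', x = true :: x'.
Proof. by case: x => [|[] x] //; exists x. Qed.

Lemma dyck_rcons_true h x : dy h (rcons x true) = false.
Proof. by elim: x h => [|[] x IH] [|h] /=. Qed.

Lemma dyck_last x : dyck x -> x != [::] -> exists x', x = rcons x' false.
Proof.
by case/lastP: x => // x [] dx _; [rewrite dyck_rcons_true in dx|exists x].
Qed.

Lemma ntip_wrap_cat x y : dyck x -> x != [::] -> dyck y -> y != [::] ->
  tip (wrap x ++ wrap y) = false.
Proof.
move=> dx nx dy0 ny; have [x' ->] := dyck_head dx nx; have [y' ->] := dyck_last dy0 ny.
by rewrite /tip /wrap rev_cat !(rev_cons, rev_rcons) /=.
Qed.

Lemma ntip_wrap x : dyck x -> tip (wrap (x)) = (x == [::]).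
Proof.
case: eqP => [->//|/eqP nx] dx.
have [x' ex] := dyck_head dx nx; have [y' ey] := dyck_last dx nx.
by rewrite /tip {1}ex /= ey !(rev_cons, rev_rcons) /=.
Qed.

Lemma LM_ne t x : x \in LM t -> x != [::].
Proof.
case: t => //= b t; rewrite !inE => /or4P[/eqP->|/eqP->|/eqP->|/mapP[y _ ->]];
  by rewrite -size_eq0 /A1 /PB1 /PB2 ?size_mid ?size_wM //; case: b.
Qed.

Lemma LN_ne t x : x \in LN t -> x != [::].
Proof.
by case: t => //= b t; rewrite !inE => /or4P[/eqP->|/eqP->|/eqP->|/mapP[y _ ->]] //; case: b.
Qed.

Lemma tip_LM t x : x \in LM t -> tip x.
Proof.
case: t => //= b t; rewrite !inE => /or4P[/eqP->|/eqP->|/eqP->|/mapP[y _ ->]].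
- by rewrite /A1 /mid; case: b; exact: tip_l.
- by rewrite /PB1; case: b; [exact: tip_l|exact: tip_r].
- by rewrite /PB2; case: b; [rewrite catA; exact: tip_r|exact: tip_l].
- by rewrite /wM; case: b; [rewrite catA; exact: tip_r|exact: tip_l].
Qed.

Lemma tip_LN t x : x \in LN t -> tip x = false.
Proof.
case: t => //= b t; rewrite !inE => /or4P[/eqP->|/eqP->|/eqP->|/mapP[y hy ->]].
- rewrite ntip_wrap; last exact/dyck_mid/dyck_cN.
  by rewrite -size_eq0 size_mid.
- have d := dyck_cN t; rewrite /PA1; case: b; apply: ntip_wrap_cat => //; dyk.
  by rewrite -size_eq0 size_cat addnC.
- exact: ntip_wrap2.
- rewrite ntip_wrap; last exact/dyck_side/(dyck_LN hy).
  by rewrite -size_eq0 !size_cat; case: b; rewrite /= ?addn0 ?addn2.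
Qed.

Lemma notin_wM b t : [/\ A1 b t \notin map (wM b) (LM t), PB1 b t \notin map (wM b) (LM t)
  & PB2 b t \notin map (wM b) (LM t)].
Proof.
split; apply/mapP => -[y hy]; have [y' ey] := dyck_head (dyck_LM hy) (LM_ne hy).
- by rewrite ey; case: b.
- by rewrite ey; case: b.
- by move/wM_inj => e; have := tip_LM hy; rewrite -e ntip_wrap2.
Qed.

Lemma notin_wN b t : [/\ B1 b t \notin map (wN b) (LN t), PA1 b t \notin map (wN b) (LN t)
  & PA2 b t \notin map (wN b) (LN t)].
Proof.
split; apply/mapP => -[y hy]; have [y' ey] := dyck_head (dyck_LN hy) (LN_ne hy).
- have -> : B1 b t = wN b (leaves 1 ++ cN t ++ leaves 1) by case: b; weq.
  by move/wN_inj => e; have := tip_LN hy; rewrite -e tip_l.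
- case: b; last by rewrite ey.
  have -> : PA1 true t = true :: (true :: false :: cN t ++ [:: false; true]) ++ [:: true; false; false].
    by weq.
  have -> : wN true y = true :: y ++ [:: true; false; false] by weq.
  case=> e; have := congr1 rev e; rewrite -2!cat_cons !rev_cat => /(@cat_inj_size _ _ _ _ _ (erefl _)) [_].
  move/(congr1 rev); rewrite !revK => e'.
  have := dyck_LN hy; rewrite -e' -!cat_cons -[[:: false; true]]/([:: false] ++ [:: true]).
  by rewrite catA cats1 dyck_rcons_true.
- case: b; last by rewrite ey.
  have -> : PA2 true t = (true :: true :: true :: cN t ++ [:: true; false]) ++ [:: false; false; false].
    by rewrite /PA2; weq.
  have -> : wN true y = (true :: y) ++ [:: true; false; false] by weq.
  by move/(congr1 (fun s => nth true (rev s) 2)); rewrite !rev_cat.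
Qed.

Lemma uniq_LM t : uniq (LM t).
Proof.
elim: t => //= b t IH; have [n1 n2 n3] := notin_wM b t.
rewrite (map_inj_uniq (@wM_inj b)) IH !inE !negb_or n1 n2 n3 !andbT.
apply/andP; split; last by case: (b).
apply/andP; split; last by case: (b).
case: (b) => //; apply/eqP.
have -> : A1 true t = [:: true; false; true] ++ cM t ++ [:: false; true; false; true; false] by weq.
have -> : PB1 true t = [:: true; false; true] ++ cM t ++ [:: true; true; false; false; false] by weq.
by case=> /(cat_inj_size (erefl (size (cM t)))) [].
Qed.

Lemma uniq_LN t : uniq (LN t).
Proof.
elim: t => //= b t IH; have [n1 n2 n3] := notin_wN b t.
rewrite (map_inj_uniq (@wN_inj b)) IH !inE !negb_or n1 n2 n3 !andbT.
apply/andP; split; last by case: (b).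
apply/andP; split; last by case: (b).
case: (b) => //; apply/eqP.
have -> : B1 true t = [:: true; true; false] ++ cN t ++ [:: true; false; true; false; false] by weq.
have -> : PA1 true t = [:: true; true; false] ++ cN t ++ [:: false; true; true; false; false] by weq.
by case=> /(cat_inj_size (erefl (size (cN t)))) [].
Qed.

Lemma size_LM t : size (LM t) = 3 * size t.
Proof. by elim: t => //= b t IH; rewrite size_map IH; lia. Qed.
Lemma size_LN t : size (LN t) = 3 * size t.
Proof. by elim: t => //= b t IH; rewrite size_map IH; lia. Qed.

Lemma uniq_med t : uniq (LM t ++ LN t).
Proof.
rewrite cat_uniq uniq_LM uniq_LN andbT /=.
by apply/hasPn => x /tip_LN h; apply/negP => /tip_LM; rewrite h.
Qed.

Lemma adj_A1B1 b t : adj (A1 b t) (B1 b t).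
Proof.
have -> : A1 b t = ins (size (lside b)).+3 (cM t) (leaves 4) by case: b; weq.
have -> : B1 b t = ins (size (lside b)).+3 (cN t) (wrap (leaves 3)) by case: b; weq.
by apply: adj_ins; [exact: adjMN|].
Qed.

Lemma adj_A1PA1 b t : adj (A1 b t) (PA1 b t).
Proof.
have -> : A1 b t = ins (size (lside b)).+3 (cM t) (leaves 4) by case: b; weq.
have -> : PA1 b t = ins (size (lside b)).+3 (cN t) (wrap (leaves 1) ++ wrap (leaves 1)) by case: b; weq.
by apply: adj_ins; [exact: adjMN|].
Qed.

Lemma adj_A1PA2 b t : adj (A1 b t) (PA2 b t).
Proof.
have -> : A1 b t = ins (size (lside b)).+3 (cM t) (leaves 4) by case: b; weq.
have -> : PA2 b t = ins (size (lside b)).+3 (cN t) (wrap (wrap (wrap (leaves 1)))).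
  by rewrite /PA2; case: b; weq.
by apply: adj_ins; [exact: adjMN|].
Qed.

Lemma adj_PB1B1 b t : adj (PB1 b t) (B1 b t).
Proof.
case: b.
  have -> : PB1 true t = ins 3 (cM t) (leaves 1 ++ wrap (wrap (leaves 1))) by weq.
  have -> : B1 true t = ins 3 (cN t) (wrap (leaves 3)) by weq.
  by apply: adj_ins; [exact: adjMN|].
have -> : PB1 false t = ins 5 (cM t) (wrap (wrap (leaves 1)) ++ leaves 1) by weq.
have -> : B1 false t = ins 5 (cN t) (wrap (leaves 3)) by weq.
by apply: adj_ins; [exact: adjMN|].
Qed.

Lemma adj_PB2B1 b t : adj (PB2 b t) (B1 b t).
Proof.
case: b.
  have -> : PB2 true t = ins 3 (cM t) (wrap (wrap (leaves 1)) ++ leaves 1) by weq.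
  have -> : B1 true t = ins 3 (cN t) (wrap (leaves 3)) by weq.
  by apply: adj_ins; [exact: adjMN|].
have -> : PB2 false t = ins 5 (cM t) (leaves 1 ++ wrap (wrap (leaves 1))) by weq.
have -> : B1 false t = ins 5 (cN t) (wrap (leaves 3)) by weq.
by apply: adj_ins; [exact: adjMN|].
Qed.

Lemma adj_A1_star b t z : z \in starN t -> adj (A1 b t) (wN b (wrap z)).
Proof.
move=> hz.
have -> : A1 b t = ins (size (lside b)).+2 (cX t) (leaves 3) by case: b; weq.
have -> : wN b (wrap z) = ins (size (lside b)).+2 z (wrap (leaves 2)) by case: b; weq.
by apply: adj_ins; [exact: starX|].
Qed.

Definition Bs t := map wrap (starN t).

Lemma Bs_cons b t : Bs (b :: t) = B1 b t :: map (wN b) (Bs t).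
Proof. by rewrite /Bs /= -map_comp; congr cons; rewrite -map_comp. Qed.

Lemma Bs_LN t x : x \in Bs t -> x \in LN t.
Proof.
elim: t x => // b t IH x; rewrite Bs_cons !inE => /orP[->//|/mapP[y /IH hy ->]].
by apply/or4P/Or44/map_f.
Qed.

Lemma mem_Bs t j : j < 3 * size t -> (nth [::] (LN t) j \in Bs t) = (j %% 3 == 0).
Proof.
elim: t j => // b t IH j h; rewrite Bs_cons inE.
have := uniq_LN (b :: t); rewrite [LN _]/= /= !inE => /and4P[n1 n2 n3 _].
have sub x : x \notin map (wN b) (LN t) -> x \notin map (wN b) (Bs t).
  by apply: contra => /mapP[y /Bs_LN hy ->]; apply: map_f.
case: j h => [|[|[|j]]] h.
- by rewrite /= eqxx.
- rewrite /= eq_sym; move: n1; rewrite !negb_or => /andP[/negbTE -> _] /=.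
  by apply/negbTE/sub; move: n2; rewrite negb_or => /andP[].
- rewrite /= eq_sym; move: n1; rewrite !negb_or => /and3P[_ /negbTE -> _] /=.
  exact/negbTE/sub.
have h' : j < 3 * size t by move: h => /=; lia.
rewrite [LN _]/= [nth _ _ _]/= (nth_map [::]) ?size_LN // (mem_map (@wN_inj b)) IH //.
have -> : (wN b (nth [::] (LN t) j) == B1 b t) = false.
  apply/negbTE; apply: contraNneq n1 => <-.
  by rewrite !orbA map_f ?orbT // mem_nth ?size_LN.
by rewrite /= -[j.+3]addn3 modnDr.
Qed.

(** Both lists come in blocks of three per level: a core word [A1] or [B1], then the two pendants of
    the opposite core word. Core words are joined when the level of [A1] is at most that of [B1],
    pendants only within their level. *)
Definition rel_med i j :=
  if (i %% 3 == 0) && (j %% 3 == 0) then i %/ 3 <= j %/ 3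
  else ((i %% 3 == 0) || (j %% 3 == 0)) && (i %/ 3 == j %/ 3).

Lemma modn3S n : n.+3 %% 3 = n %% 3.
Proof. by rewrite -addn3 modnDr. Qed.
Lemma divn3S n : n.+3 %/ 3 = (n %/ 3).+1.
Proof. by rewrite -addn3 divnDr // addn1. Qed.

Lemma rel_medS i j : rel_med i.+3 j.+3 = rel_med i j.
Proof. by rewrite /rel_med !modn3S !divn3S eqSS ltnS. Qed.

(** Removing the outer level lowers both indices by 3. A deeper word of [LM] has only neighbours
    wrapped by [wN b], so the mixed cases are decided by the neighbours of the three outer words. *)
Lemma adj_med t i j : i < 3 * size t -> j < 3 * size t ->
  adj (nth [::] (LM t) i) (nth [::] (LN t) j) = rel_med i j.
Proof.
elim: t i j => // b t IH i j hi hj.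
have := uniq_LN (b :: t); rewrite [LN _]/= /= !inE => /and4P[+ + n3 _].
rewrite !negb_or => /and3P[n12 n13 n1] /andP[n23 n2].
have big i' : i' < 3 * size t -> forall V,
   adj (nth [::] (LM (b :: t)) i'.+3) V -> V \in map (wN b) (LN t).
  move=> hi' V; rewrite /= (nth_map [::]) ?size_LM //.
  have hm : nth [::] (LM t) i' \in LM t by rewrite mem_nth ?size_LM.
  by move/(nb_wM (dyck_LM hm)) => [u /(LM_closed hm) hu ->]; apply: map_f.
case: i hi => [|[|[|i]]] hi; last first.
- have hi' : i < 3 * size t by move: hi => /=; lia.
  case: j hj => [|[|[|j]]] hj.
  + have -> : rel_med i.+3 0 = false by rewrite /rel_med modn3S divn3S; case: (i %% 3 == 0).
    by apply/negP => /(big _ hi'); rewrite (negbTE n1).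
  + have -> : rel_med i.+3 1 = false by rewrite /rel_med modn3S divn3S; case: (i %% 3 == 0).
    by apply/negP => /(big _ hi'); rewrite (negbTE n2).
  + have -> : rel_med i.+3 2 = false by rewrite /rel_med modn3S divn3S; case: (i %% 3 == 0).
    by apply/negP => /(big _ hi'); rewrite (negbTE n3).
  have hj' : j < 3 * size t by move: hj => /=; lia.
  rewrite rel_medS -IH //= !(nth_map [::]) ?size_LM ?size_LN //.
  have hm : nth [::] (LM t) i \in LM t by rewrite mem_nth ?size_LM.
  apply/idP/idP => [|]; last exact: adj_w.
  by move/(nb_wM (dyck_LM hm)) => [u hu /wN_inj ->].
- have H V : adj (PB2 b t) V = (V == B1 b t).
    by apply/idP/eqP => [/nb_PB2|->]; last exact: adj_PB2B1.
  rewrite /= H; case: j hj => [|[|[|j]]] hj /=.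
  + by rewrite eqxx.
  + by rewrite eq_sym (negbTE n12).
  + by rewrite eq_sym (negbTE n13).
  have hj' : j < 3 * size t by move: hj => /=; lia.
  rewrite (nth_map [::]) ?size_LN //.
  have -> : rel_med 2 j.+3 = false by rewrite /rel_med modn3S divn3S; case: (j %% 3 == 0).
  by apply/negbTE; apply: contraNneq n1 => <-; rewrite map_f // mem_nth ?size_LN.
- have H V : adj (PB1 b t) V = (V == B1 b t).
    by apply/idP/eqP => [/nb_PB1|->]; last exact: adj_PB1B1.
  rewrite /= H; case: j hj => [|[|[|j]]] hj /=.
  + by rewrite eqxx.
  + by rewrite eq_sym (negbTE n12).
  + by rewrite eq_sym (negbTE n13).
  have hj' : j < 3 * size t by move: hj => /=; lia.
  rewrite (nth_map [::]) ?size_LN //.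
  have -> : rel_med 1 j.+3 = false by rewrite /rel_med modn3S divn3S; case: (j %% 3 == 0).
  by apply/negbTE; apply: contraNneq n1 => <-; rewrite map_f // mem_nth ?size_LN.
- case: j hj => [|[|[|j]]] hj /=.
   + by rewrite adj_A1B1.
  + by rewrite adj_A1PA1.
  + by rewrite adj_A1PA2.
  have hj' : j < 3 * size t by move: hj => /=; lia.
  rewrite (nth_map [::]) ?size_LN //.
  have -> : rel_med 0 j.+3 = (j %% 3 == 0).
  by rewrite /rel_med modn3S divn3S; case: (j %% 3 == 0).
  rewrite -(mem_Bs hj'); set y := nth _ _ _.
  have hy : y \in LN t by rewrite mem_nth ?size_LN.
  apply/idP/idP; last by move=> /mapP[z hz ->]; exact: adj_A1_star.
  case/nb_A1 => [|[z hz /wN_inj ->]]; last exact: map_f.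
  rewrite !inE => /or3P[]/eqP e; [move: n1|move: n2|move: n3]; by rewrite -e map_f.
Qed.

(** * Invertibility of rotations *)

Lemma dyck_ins i p w : dyck p -> dyck w -> dyck (ins i p w).
Proof.
move=> dp dw; rewrite /ins.
have H h x y : dy h (x ++ y) -> dy h (x ++ p ++ y).
  elim: x h => [|a x IH] [|h] /=; first exact: dyck_cat.
  - exact: (@dy_cat 0 h.+1).
  - by case: a => //; exact: IH.
  - by case: a => //; exact: IH.
by apply: H; rewrite cat_take_drop.
Qed.

Lemma dyck_turn w : dyck w -> dyck (turn w).
Proof.
case: w => [//|[] w] //= dw; have [u [v [-> du dv]]] := dy_split dw.
by rewrite reopen_dyck //= rcons_cat; apply/dyck_cat/dyck_wrap.
Qed.

Lemma dyck_iter_turn r w : dyck w -> dyck (iter r turn w).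
Proof. by move=> dw; elim: r => //= r; apply: dyck_turn. Qed.

Lemma turn_wrap u v : dyck u -> turn (wrap u ++ v) = u ++ wrap v.
Proof. by move=> du; rewrite /wrap /= cat_rcons reopen_dyck //= rcons_cat. Qed.

Lemma iter_turn_mul m w : dyck w -> iter (m * size w) turn w = w.
Proof. by move=> dw; elim: m => // m IH; rewrite mulSn iterD IH iter_turn_size. Qed.

(** Together the turns make [r] full revolutions. *)
Lemma iter_turnK r w : dyck w -> iter (r * size w - r) turn (iter r turn w) = w.
Proof.
move=> dw; case: (posnP (size w)) => [/size0nil ->|pw].
  have N n : iter n turn [::] = [::] by elim: n => //= n ->.
  by rewrite !N.
by rewrite -iterD subnK ?leq_pmulr // iter_turn_mul.
Qed.

Lemma iter_turnKV r w : dyck w -> iter r turn (iter (r * size w - r) turn w) = w.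
Proof.
move=> dw; case: (posnP (size w)) => [/size0nil ->|pw].
  have N n : iter n turn [::] = [::] by elim: n => //= n ->.
  by rewrite !N.
by rewrite -iterD subnKC ?leq_pmulr // iter_turn_mul.
Qed.

Lemma adj_dyckr w v : adj w v -> dyck v.
Proof. by rewrite adj_sym => /adj_dyck. Qed.

Lemma adj_iter_turn_inv r w V : dyck w -> adj (iter r turn w) V ->
  exists2 v, adj w v & V = iter r turn v.
Proof.
move=> dw a; exists (iter (r * size w - r) turn V).
  by rewrite -{1}(iter_turnK r dw); apply: adj_iter_turn.
have -> : size w = size V by rewrite -(adj_size a) size_iter_turn.
by rewrite iter_turnKV // (adj_dyckr a).
Qed.

Lemma iter_turn_inj r w v : dyck w -> dyck v -> size w = size v ->
  iter r turn w = iter r turn v -> w = v.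
Proof. by move=> dw dv s e; rewrite -(iter_turnK r dw) e s iter_turnK. Qed.

(** * Certificates of connectedness *)

Definition reach (roots : seq word) (w : word) :=
  exists2 y, y \in roots & exists r, conn w (iter r turn y).

Lemma reach_root roots y : y \in roots -> reach roots y.
Proof. by move=> h; exists y => //; exists 0; apply: conn_refl. Qed.

Lemma reach_conn roots w v : conn w v -> reach roots v -> reach roots w.
Proof. by move=> c [y hy [r cr]]; exists y => //; exists r; apply: conn_trans cr. Qed.

Lemma reach_turn roots r w : reach roots w -> reach roots (iter r turn w).
Proof.
by case=> y hy [r' c]; exists y => //; exists (r + r'); rewrite iterD; apply: conn_iter_turn.
Qed.

Lemma reach_unturn roots r w : dyck w -> reach roots (iter r turn w) -> reach roots w.
Proof. by move=> dw h; rewrite -(iter_turnK r dw); apply: reach_turn. Qed.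

Lemma reach_rot roots x y : dyck x -> dyck y -> reach roots (x ++ y) -> reach roots (y ++ x).
Proof. by move=> dx dy0 /(reach_turn (size x)); rewrite iter_turn_cat. Qed.

Lemma reach_sub (roots roots' : seq word) w :
  {subset roots <= roots'} -> reach roots w -> reach roots' w.
Proof. by move=> sub [y hy c]; exists y => //; apply: sub. Qed.

(* lexicographic comparison; any total choice of a representative rotation would do *)
Fixpoint lexb (w v : word) : bool :=
  match w, v with
  | a :: w', b :: v' => if a == b then lexb w' v' else b
  | _, _ => true
  end.

Definition canon (w : word) : word :=
  foldr (fun u v => if lexb u v then v else u) w (traject turn w (size w)).

Lemma canonP w : exists r, canon w = iter r turn w.
Proof.
rewrite /canon; have H m : exists r, foldr (fun u v => if lexb u v then v else u) w
    (traject turn (iter m turn w) (size w)) = iter r turn w.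
  elim: (size w) m => [|n IH] m /=; first by exists 0.
  by case: ifP => _; [exact: (IH m.+1)|exists m].
exact: (H 0).
Qed.

Lemma reach_canon roots w : dyck w -> reach roots (canon w) -> reach roots w.
Proof. by move=> dw; have [r ->] := canonP w; apply: reach_unturn. Qed.

(* The entry [(j, v)] of a certificate claims that [v] is adjacent to the [j]-th known
   word; the canonical rotation of [v] is then appended to the known words. *)
Fixpoint grow (known : seq word) (cert : seq (nat * word)) : seq word :=
  if cert is (j, v) :: cert' then
    grow (if (j < size known) && adj (nth [::] known j) v then rcons known (canon v) else known) cert'
  else known.

Lemma grow_sound roots known cert :
  {in known, forall w, reach roots w} -> {in grow known cert, forall w, reach roots w}.
Proof.
elim: cert known => // -[j v] cert IH known h /=; apply: IH.
case: ifP => // /andP[hj a] w; rewrite mem_rcons inE => /orP[/eqP->|/h //].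
have [r ->] := canonP v; apply: reach_turn.
apply: reach_conn (h _ (mem_nth [::] hj)).
by apply: conn1; rewrite adj_sym.
Qed.

Definition J (y : word) : seq word := [seq ins i p y | p <- quad, i <- iota 0 (size y).+1].

Lemma memJ p i y : p \in quad -> i <= size y -> ins i p y \in J y.
Proof. by move=> hp hi; apply/allpairsP; exists (p, i); rewrite mem_iota. Qed.

Lemma JP w y : w \in J y -> exists p i, [/\ p \in quad, i <= size y & w = ins i p y].
Proof. by case/allpairsP => [[p i] [hp + ->]]; rewrite mem_iota => hi; exists p, i. Qed.

Lemma dyck_J w y : dyck y -> w \in J y -> dyck w.
Proof. by move=> dy0 /JP [p [i [hp _ ->]]]; apply: dyck_ins => //; apply: quad_dyck. Qed.

Lemma size_J w y : w \in J y -> size w = 4 + size y.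
Proof. by move=> /JP [p [i [hp _ ->]]]; rewrite size_ins quad_size. Qed.

Lemma ins_turn i p y : dyck p -> dyck y -> i <= size y ->
  exists r j, j <= size y /\ ins i p (turn y) = iter r turn (ins j p y).
Proof.
move=> dp dy0; rewrite leq_eqVlt => /orP[/eqP->|hi]; last first.
  by exists 1, i.+1; rewrite /= turn_ins.
case: (posnP (size y)) => [s0|py].
  by exists 0, 0; rewrite (size0nil s0).
(* At the very end the insertion wraps around: [size p] turns bring the block from the front to the
   back, and the front of [turn y] is position 1 of [y]. *)
exists (size p).+1, 1; split=> //; rewrite iterSr turn_ins // /ins.
rewrite take0 drop0 cat0s iter_turn_cat //; last exact: dyck_turn.
by rewrite -(size_turn y) take_size drop_size cats0.
Qed.

Lemma ins_iter_turn r i p y : dyck p -> dyck y -> i <= size y ->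
  exists r' j, j <= size y /\ ins i p (iter r turn y) = iter r' turn (ins j p y).
Proof.
move=> dp dy0; elim: r i => [|r IH] i hi; first by exists 0, i.
have [r1 [j [hj /= ->]]] := @ins_turn i p (iter r turn y) dp (dyck_iter_turn r dy0)
  (eq_ind_r (leq i) hi (size_iter_turn r y)).
rewrite size_iter_turn in hj; have [r2 [j' [hj' ->]]] := IH _ hj.
by exists (r1 + r2), j'; rewrite iterD.
Qed.

(** The walk from [w] to a rotated root may exchange [p] for the other quadrilateral and the
    rotation moves the position, so the hypothesis ranges over all of [J y]. *)
Lemma reach_ins roots roots' w i p :
  {in roots, forall y, dyck y /\ {in J y, forall v, reach roots' v}} ->
  reach roots w -> p \in quad -> i <= size w -> reach roots' (ins i p w).
Proof.
move=> H [y hy [r c]] hp hi; have [dy0 Hy] := H y hy.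
have [q hq cq] := conn_ins i (isT : adj (leaves 2) (wrap (leaves 1))) c hp.
apply: reach_conn cq _.
have dq := quad_dyck hq.
rewrite (conn_size c) size_iter_turn in hi.
have [r' [j [hj ->]]] := ins_iter_turn r dq dy0 hi.
by apply: reach_turn; apply: Hy; apply: memJ.
Qed.

(** The suffix must change at every step, so after an even walk it is back to [s]. *)
Lemma conn_walk w ws s s' : adj s s' -> path adj w ws ->
  conn (w ++ s) (last w ws ++ (if odd (size ws) then s' else s)).
Proof.
move=> a; elim: ws w s s' a => [|v ws IH] w s s' a /=; first by move=> _; apply: conn_refl.
case/andP=> av pw; have a' : adj s' s by rewrite adj_sym.
have := IH v s' s a' pw; rewrite -if_neg; apply: conn_trans.
exact/conn1/adj_cat.
Qed.

Fixpoint decode (s : string) : word :=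
  if s is String c s' then Ascii.eqb c "("%char :: decode s' else [::].

(* For [k = 7] and [k = 8] there is one additional component up to rotation. *)
Definition spore7 := decode "((((()()()))))".
Definition spore8 := decode "((((((()()))))))".

Definition cert4 : seq (nat * string) := [::
  (4, "((()))()")]%string.

Definition cert6 : seq (nat * string) := [::
  (8, "(()()()())()"); (8, "(()((())))()"); (8, "(((()))())()"); (12, "((()()()))()");
  (12, "((()()))()()"); (13, "()(())(())()"); (13, "()(((())))()"); (17, "(()(())())()")]%string.

Definition cert8 : seq (nat * string) := [::
  (16, "()((())())()()()"); (16, "()((())())((()))"); (16, "(()(())()())()()");
  (16, "((((())())()))()"); (18, "(()(()())()())()"); (18, "((()()()())())()");
  (18, "((()((())))())()"); (18, "((((()))())())()"); (24, "((()()()()()))()");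
  (24, "((()())(()()))()"); (25, "()()()(())()()()"); (26, "((()())())((()))");
  (26, "((()())()(()))()"); (28, "(()(()()(())))()"); (30, "()(()(()))(())()");
  (31, "()((())(())())()"); (31, "()((((())))())()"); (35, "()((())()(()))()");
  (36, "()(())(()()())()"); (36, "()(()())(()())()"); (36, "()(()()())(())()");
  (36, "()(()()()()())()"); (36, "()(()()((())))()"); (36, "()(()((()))())()");
  (36, "()(()((()())))()"); (36, "()(((()))()())()"); (36, "()(((()()))())()");
  (47, "()(())(()())()()"); (47, "()(()())(())()()"); (47, "()(()()()())()()");
  (47, "()(()((())))()()"); (47, "()(((()))())()()"); (50, "(()((())())())()");
  (52, "((()(())())())()"); (53, "()((())())(())()"); (53, "()((())((())))()");
  (54, "((()())((())))()"); (54, "((()()(()))())()"); (24, "((()()()()))()()");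
  (64, "(()(()()())())()"); (65, "()(()(()())())()")]%string.

Definition cert5 : seq (nat * string) := [::
  (0, "(()()())()"); (4, "((()()))()")]%string.

Definition cert7 : seq (nat * string) := [::
  (8, "((()()()()))()"); (9, "()()(()())()()"); (11, "(()()()()())()"); (12, "()(())(()())()");
  (12, "()(()())(())()"); (12, "()(()((())))()"); (12, "()(((()))())()"); (8, "((()()()))()()");
  (17, "(()(()())())()")]%string.

Definition cert9 : seq (nat * string) := [::
  (0, "((((()()()))))()()"); (0, "((()())(()()))()()"); (0, "((()()()()))()()()");
  (3, "(()(((())))())()()"); (0, "((()()())(()))()()"); (5, "(()(()())(()()))()");
  (0, "((()()())(()()))()"); (7, "()((()())()(()))()"); (6, "((()()()()())())()");
  (9, "()((())(()())())()"); (9, "()((()()()())())()"); (9, "()((()((())))())()");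
  (9, "()((((()))())())()"); (11, "(()(((())))()())()"); (8, "()()()()((())())()");
  (15, "((()())())()()()()"); (15, "((()())())()((()))"); (15, "((()())())((()))()");
  (16, "(()(())()())((()))"); (11, "()((()()())())()()"); (20, "(()(()())()())()()");
  (21, "()((((())())))()()"); (21, "((((()()())))())()"); (11, "(()(()()())()())()");
  (24, "()(()(()()))(())()"); (16, "(()(())()())()()()"); (26, "(()(()()(())))()()");
  (10, "()((())()()(()))()"); (28, "()()()()()()(())()"); (29, "()(()())(((())))()");
  (29, "()(((())))(()())()"); (29, "()(()()()()()())()"); (32, "()(())(((())))()()");
  (32, "()(()())(()())()()"); (32, "()(()()((())))()()"); (32, "()(((())))(())()()");
  (32, "()(((()))()())()()"); (32, "()(((())(())))()()"); (32, "()(((()()())))()()");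
  (32, "()(((((())))))()()"); (32, "(()()((()()())))()"); (32, "(((()()()))()())()");
  (34, "()((())((())))()()"); (34, "((()()())((())))()"); (29, "()(((()()()())))()");
  (45, "()()(((())))()()()"); (32, "()(())(()()())()()"); (47, "()((()())())(())()");
  (47, "()((()())((())))()"); (32, "()(()()())(())()()"); (50, "((()()(()))())()()");
  (32, "()(()((()())))()()"); (52, "(()((()())())())()"); (32, "()(((()()))())()()");
  (54, "((()(())())())()()"); (35, "()(()()()())()()()"); (56, "(()((()))())((()))");
  (56, "(((()))()())((()))"); (56, "(((((())))()()))()")]%string.

Definition cert10 : seq (nat * string) := [::
  (0, "((()()())(()()))()()"); (0, "((((((()()))))))()()"); (1, "()((()())()(()))()()");
  (1, "(()(()())(()()()))()"); (0, "((()()()()()()))()()"); (5, "(()(((((())))))())()");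
  (0, "((()()()())(()))()()"); (7, "(()(()()())(()()))()"); (8, "((()()()()())())()()");
  (9, "()((())(()())())()()"); (9, "()((()()()())())()()"); (9, "()((()((())))())()()");
  (9, "()((((()))())())()()"); (11, "()((()()())())()()()"); (11, "()((()()())())((()))");
  (11, "(()(()()())()())()()"); (11, "((()()((())))())()()"); (11, "((()((()))())())()()");
  (11, "((()((()())))())()()"); (11, "((((()))()())())()()"); (11, "((((()()))())())()()");
  (11, "((((()()())())()))()"); (14, "()((()())())()()()()"); (14, "()((()())())()((()))");
  (14, "()((()())())((()))()"); (14, "()((()())())((()()))"); (14, "(()(()())()())()()()");
  (14, "((((()())())()))()()"); (14, "((((()())())()()))()"); (16, "()(()(()()))(())()()");
  (19, "(()((()(()))())())()"); (21, "(((()(())())())())()"); (23, "((()()())()(()))()()");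
  (23, "((()()())()(()()))()"); (26, "((()(())())())(())()"); (27, "(()(()()()(())))()()");
  (28, "(()(((())())())())()"); (30, "(((()())()()())())()"); (30, "(((()())((())))())()");
  (30, "(((()()(()))())())()"); (36, "()(((())())())(())()"); (36, "()(((())())()()())()");
  (36, "()(((())())((())))()"); (38, "()(((())())(())())()"); (38, "()(((())((())))())()");
  (42, "(((()())())((())))()"); (42, "(((()())()(()))())()"); (3, "()()()()()((())())()");
  (48, "((()())())((((()))))"); (4, "((()()()()()())())()"); (50, "()((((((())))))())()");
  (9, "(()(()()()())()())()"); (52, "()(()(()()()))(())()"); (53, "(((()())()())())()()");
  (10, "()((())()()(()()))()"); (55, "()()()()()()(())()()"); (56, "()(())(((((())))))()");
  (56, "()(()()((((())))))()"); (56, "()(()((())(()())))()"); (56, "()(()((()())(())))()");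
  (56, "()(((((())))))(())()"); (56, "()(((((()))))()())()"); (56, "()(((())(()()))())()");
  (56, "()(((()())(()))())()"); (56, "()(((())(((())))))()"); (56, "()(((()()((())))))()");
  (56, "()(((((())))(())))()"); (56, "()(((((()))()())))()"); (56, "()(((((())(())))))()");
  (56, "()(((((()()())))))()"); (56, "()(((((((())))))))()"); (59, "(()((())())(()()))()");
  (60, "()(((())())()(()))()"); (63, "(((()())(())())())()"); (64, "((()(())(()()))())()");
  (16, "(()()(()())()()())()"); (76, "()((((((())())))))()"); (23, "(()(())()())()()()()");
  (78, "(()(()()(())))()()()"); (79, "()(((()())())()())()"); (27, "(()()(())()()())()()");
  (81, "((((((()())))))())()"); (54, "(()()()()(())()())()"); (83, "()((((()()))))(())()");
  (83, "()((((()()(())))))()"); (56, "()(()()()()()()())()"); (86, "()(()())(()()())()()");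
  (86, "()(()()())(()())()()"); (86, "(()((()())(()())))()"); (86, "(((()())(()()))())()");
  (87, "()((()())())(())()()"); (87, "()((()())((())))()()"); (88, "((()()())((())))()()");
  (88, "((()()()(()))())()()"); (89, "(((()())())(())())()"); (90, "()(((())()(()))())()");
  (91, "()((())())(()())()()"); (91, "()((())())(()()(()))"); (91, "((((())())(()())))()");
  (94, "()((()(()))())(())()"); (94, "()((()(()))()()())()"); (94, "()((()(()))((())))()");
  (97, "()((())())(())(()())"); (97, "()((())((())))(()())"); (101, "((()(()()))((())))()");
  (101, "((()(()())(()))())()"); (56, "()(()()((()()))())()"); (107, "(()((()()())())())()");
  (108, "()((()())())()(()())"); (56, "()(()((()()))()())()"); (110, "(()(()(()()()))())()");
  (111, "((()(()())())())()()"); (58, "()()(()()())()()()()"); (113, "()(((((())))))()()()");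
  (113, "()(((((())))))((()))"); (113, "(((((((())))))()))()"); (66, "()(()()()()())()()()");
  (117, "(()()((()())))((()))"); (117, "(((()()))()())((()))"); (86, "()(())(()()()())()()");
  (120, "()((()()())())(())()"); (121, "()((()())())(()())()"); (86, "()(()()()())(())()()");
  (123, "((()()(()))())()()()"); (124, "()((()(()()))()())()"); (87, "(()(()())()()()())()");
  (126, "()((((())((())))))()"); (88, "(()(())()()()())()()"); (128, "((((()())))((())))()");
  (117, "()(())(()())()()()()"); (130, "()((())((((())))))()"); (117, "()(()())(())()()()()");
  (132, "((()())((((())))))()")]%string.

(* The walk is even, so a ring block appended to all its words can alternate between its
   two matchings and come back. *)
Definition walk9 := map decode [::
  "()()(())(()())(())"; "(()(()())(()))()()"; "()(()()()()())(())"; "(()(())(()()))()()";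
  "(((()())(()))()())"; "()()()()()()()()()"]%string.

Definition cA (s : seq bool) : word := if s is b :: t then A1 b t else [::].

(** Every non-isolated matching will be connected to a rotation of one of these: a caterpillar, one
    word of a middle component, the ring, or the extra word at 7 and 8. For [k = 2] the ring is
    itself a [cM], hence the test [3 < k]. *)
Definition roots k : seq word :=
  if odd k then map cX (words k./2) ++ leaves k :: (if k == 7 then [:: spore7] else [::])
  else map cM (words k./2) ++
    (if 3 < k then map cA (words k./2.-1) ++ leaves k :: (if k == 8 then [:: spore8] else [::])
     else [::]).

Definition known start cert := grow (map canon start) [seq (e.1, decode e.2) | e <- cert].

Lemma known_reach start cert w :
  dyck w -> canon w \in known start cert -> reach start w.
Proof.
move=> dw /grow_sound h; apply: reach_canon => //; apply: h => _ /mapP[y hy ->].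
by have [r ->] := canonP y; apply: reach_turn; apply: reach_root.
Qed.

Definition covers start cert start' :=
  all (fun y => dyck y && all (fun w => canon w \in known start' cert) (J y)) start.

Lemma coversP start cert start' : covers start cert start' ->
  {in start, forall y, dyck y /\ {in J y, forall v, reach start' v}}.
Proof.
move=> /allP h y /h /andP[dy0 /allP hJ]; split=> // w hw.
exact: (known_reach (dyck_J dy0 hw) (hJ _ hw)).
Qed.

Lemma covers2 : covers (roots 0) [::] (roots 2). Proof. by vm_compute. Qed.
Lemma covers4 : covers (roots 2) cert4 (roots 4). Proof. by vm_compute. Qed.
Lemma covers6 : covers (roots 4) cert6 (roots 6). Proof. by vm_compute. Qed.
Lemma covers8 : covers (roots 6) cert8 (roots 8). Proof. by vm_compute. Qed.
Lemma covers5 : covers (roots 3) cert5 (roots 5). Proof. by vm_compute. Qed.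
Lemma covers7 : covers (roots 5) cert7 (roots 7). Proof. by vm_compute. Qed.
(** The extra component does not propagate: all insertions into it lead to the ring, here and in
    [covers10]. *)
Lemma covers9 : covers [:: spore7] cert9 [:: leaves 9]. Proof. by vm_compute. Qed.
Lemma covers10 : covers [:: spore8] cert10 [:: leaves 10]. Proof. by vm_compute. Qed.

(** * Insertions into the ring matching *)

Lemma J_cat x y w : w \in J (x ++ y) ->
  (exists2 z, z \in J x & w = z ++ y) \/ (exists2 z, z \in J y & w = x ++ z).
Proof.
case/JP=> p [i [hp hi ->]]; case: (leqP i (size x)) => h; [left|right].
  exists (ins i p x); first exact: memJ.
  rewrite /ins -!catA takel_cat // drop_cat; case: ltnP => // h'.
  have -> : i = size x by lia.
  by rewrite subnn drop0 drop_size.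
exists (ins (i - size x) p y); first by apply: memJ => //; move: hi; rewrite size_cat; lia.
rewrite /ins take_cat drop_cat ltnNge (ltnW h) /= -!catA //.
Qed.

Ltac wsolve := rewrite /ins /wrap ?take0 ?drop0 ?take_size ?drop_size /= ?cats0 -?cats1
  -?catA /= ?cats0 -?catA; reflexivity.

Lemma J_one a w : w \in J [:: a] -> exists2 p, p \in quad & w = p ++ [:: a] \/ w = a :: p.
Proof.
case/JP=> p [i [hp hi ->]]; case: i hi => [|[|//]] _; exists p => //; first by left; wsolve.
by right; wsolve.
Qed.

Lemma J_wrap u w : w \in J (wrap u) ->
  (exists2 p, p \in quad & w = p ++ wrap u \/ w = wrap u ++ p) \/
  (exists2 z, z \in J u & w = wrap z).
Proof.
have -> : wrap u = [:: true] ++ (u ++ [:: false]) by wsolve.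
case/J_cat=> [[z /J_one[p hp [->|->]] ->]|[z /J_cat[[z' hz ->]|[z' /J_one[p hp [->|->]] ->]] ->]].
- by left; exists p => //; left; wsolve.
- by right; exists (ins 0 p u); [exact: memJ|wsolve].
- by right; exists z'; [|wsolve].
- by right; exists (ins (size u) p u); [exact: memJ|wsolve].
- by left; exists p => //; right; wsolve.
Qed.

Lemma J_leaf w : w \in J (leaves 1) ->
  exists2 p, p \in quad & [\/ w = p ++ leaves 1, w = wrap p | w = leaves 1 ++ p].
Proof.
case/JP=> p [i [hp hi ->]]; case: i hi => [|[|[|//]]] _; exists p => //.
- exact: Or31.
- by apply: Or32; wsolve.
- by apply: Or33; wsolve.
Qed.

Definition big (w : word) := reach [:: leaves (size w)./2] w.

Lemma big_rot x y : dyck x -> dyck y -> big (x ++ y) -> big (y ++ x).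
Proof. by rewrite /big !size_cat addnC; apply: reach_rot. Qed.

Lemma big_adj w v : adj w v -> big v -> big w.
Proof. by move=> a; rewrite /big (adj_size a); apply/reach_conn/conn1. Qed.

Lemma half_leaves k : (size (leaves k))./2 = k.
Proof. by rewrite size_leaves mul2n doubleK. Qed.

Lemma big_leaves k : big (leaves k).
Proof. by rewrite /big half_leaves; apply: reach_root; rewrite inE. Qed.

Lemma big_unturn r w : dyck w -> big (iter r turn w) -> big w.
Proof. by rewrite /big size_iter_turn; apply: reach_unturn. Qed.

Lemma walk9_path : path adj (wrap (leaves 1) ++ leaves 7) walk9.
Proof. by vm_compute. Qed.

Lemma block_leaves k : 7 <= k -> big (wrap (leaves 1) ++ leaves k).
Proof.
rewrite leq_eqVlt => /orP[/eqP<-|].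
  by apply: (@known_reach _ cert9); vm_compute.
(* Beyond nine points pairs the walk [walk9] is used with an appended ring block. Such a block needs
   two edges to have a neighbour, so one extra edge is settled by a separate certificate. *)
rewrite leq_eqVlt => /orP[/eqP<-|h].
  by apply: (@known_reach _ cert10); vm_compute.
have e : k = 7 + (k - 9).+2 by lia.
have := conn_walk (adj_leaves (k - 9)) walk9_path.
rewrite -[last _ _]/(leaves 9) [odd _]/= -catA -!leavesD -e => c.
rewrite /big size_cat size_leaves.
have -> : (size (wrap (leaves 1)) + 2 * k)./2 = 9 + (k - 9).+2 by rewrite /=; lia.
by apply: reach_conn c _; apply: reach_root; rewrite inE.
Qed.

Lemma J_leaves k w : w \in J (leaves k) -> exists a b p, p \in quad /\
  ((a + b = k /\ w = leaves a ++ p ++ leaves b) \/ ((a + b).+1 = k /\ w = leaves a ++ wrap p ++ leaves b)).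
Proof.
elim: k w => [|k IH] w.
  case/JP=> p [i [hp hi ->]]; by case: i hi => [|//] _; exists 0, 0, p; split=> //; left.
rewrite -[k.+1]add1n leavesD => /J_cat[[z /J_leaf[p hp H] ->]|[z /IH [a [b [p [hp H]]]] ->]].
  case: H => ->.
  - by exists 0, k.+1, p; split=> //; left; rewrite -catA.
  - by exists 0, k, p; split=> //; right; rewrite add0n.
  - by exists 1, k, p; split=> //; left; rewrite -catA.
exists a.+1, b, p; split=> //.
by case: H => [[e ->]|[e ->]]; [left|right]; split; rewrite ?addSn ?e.
Qed.

(** A block between two short edges can be rotated to the front, where [block_leaves] applies. A
    block inside a short edge becomes, after rotation and one turn, a block beside a wrapped ring,
    and flipping both parts gives the former case. *)
Lemma big_J_leaves k w : 7 <= k -> w \in J (leaves k) -> big w.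
Proof.
move=> k7 /J_leaves [a [b [p [hp H]]]]; have dp := quad_dyck hp.
have da := dyck_leaves a; have db := dyck_leaves b.
case: H => [[e ->]|[e ->]]; apply: big_rot => //; try by repeat first [apply: dyck_cat|apply: dyckw|assumption].
  rewrite -catA -leavesD addnC e; move: hp; rewrite !inE => /orP[/eqP->|/eqP->].
    by rewrite -leavesD; apply: big_leaves.
  exact: block_leaves.
rewrite -catA -leavesD; have dba := dyck_leaves (b + a).
apply: (@big_unturn 1); first by repeat first [apply: dyck_cat|apply: dyckw|assumption].
rewrite -[iter 1 turn _]/(turn _) turn_wrap //.
have ek : b + a = (k - 3).+2 by lia.
have ek' : (b + a).+1 = k by lia.
have aw : adj (wrap (leaves (b + a))) (leaves k).
  by rewrite adj_sym -ek' ek; apply: adj_leaves.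
move: hp; rewrite !inE => /orP[/eqP->|/eqP->].
  by apply: big_adj (block_leaves k7); apply: adj_cat.
by apply: (@big_adj _ (leaves 2 ++ leaves k)); [exact: adj_cat|exact: (big_leaves k.+2)].
Qed.

(** Fourteen points are seven edges, the least size covered by [big_J_leaves]. *)
Lemma big_ins i p w : 14 <= size w -> ~~ odd (size w) -> p \in quad -> i <= size w ->
  big w -> big (ins i p w).
Proof.
move=> h ev hp hi bw; rewrite /big size_ins quad_size //.
have -> : (4 + size w)./2 = (size w)./2.+2 by lia.
apply: reach_ins bw hp hi => y; rewrite inE => /eqP ->; split; first exact: dyck_leaves.
move=> v hv; have := big_J_leaves _ hv; rewrite /big (size_J hv) size_leaves.
have -> : (4 + 2 * (size w)./2)./2 = (size w)./2.+2 by lia.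
by apply; lia.
Qed.

Lemma conn_iter_leaves r k : 1 < k -> conn (iter r turn (leaves k)) (leaves k).
Proof.
case: k => [//|[//|k]] _; elim: r => [|r IH]; first exact: conn_refl.
rewrite iterS; apply: conn_trans (conn_turn IH) _.
have -> : turn (leaves k.+2) = wrap (leaves k.+1) by [].
by apply: conn1; rewrite adj_sym; apply: adj_leaves.
Qed.

Lemma big_conn w : 3 < size w -> big w -> conn w (leaves (size w)./2).
Proof.
move=> h [y]; rewrite inE => /eqP -> [r c]; apply: conn_trans c _.
by apply: conn_iter_leaves; lia.
Qed.

Lemma big_of_conn w v : conn w v -> big v -> big w.
Proof. by move=> c; rewrite /big (conn_size c); apply: reach_conn. Qed.

(** The hexagon travels along the walk from [z] to the ring. If it arrives flipped,
    [wrap (leaves 2)] behind a ring is the insertion of [leaves 2] into the last edge of a ring with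
    one more edge. *)
Lemma big_hex z : 14 <= size z -> ~~ odd (size z) -> big z -> big (z ++ leaves 3).
Proof.
move=> h ev bz; have c := big_conn (leq_trans (isT : 3 < 14) h) bz.
have [q hq cq] := conn_ins (size z) (isT : adj (leaves 3) (wrap (leaves 2))) c (mem_head _ _).
have insr v u : size v = size z -> ins (size z) u v = v ++ u.
  by move=> <-; rewrite /ins take_size drop_size cats0.
have sl : size (leaves (size z)./2) = size z by rewrite size_leaves; lia.
rewrite !insr // in cq; apply: big_of_conn cq _.
move: hq; rewrite !inE => /orP[/eqP->|/eqP->]; first by rewrite -leavesD; apply: big_leaves.
have -> : leaves (size z)./2 ++ wrap (leaves 2) = ins (size z).+1 (leaves 2) (leaves ((size z)./2 + 1)).
  have -> : (size z).+1 = size (rcons (leaves (size z)./2) true) by rewrite size_rcons sl.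
  have -> : leaves ((size z)./2 + 1) = rcons (leaves (size z)./2) true ++ [:: false].
    by rewrite leavesD cat_rcons.
  by rewrite insE cat_rcons.
by apply: (@big_J_leaves ((size z)./2 + 1)); [lia|apply: memJ; rewrite // size_leaves; lia].
Qed.

(** The position inside the innermost spine edge. Inserting [leaves 2] there lengthens the
    caterpillar at its inner end, which [cM_rcons] makes precise. *)
Fixpoint tipM (s : seq bool) : nat :=
  if s is b :: s' then size (lside b) + (tipM s').+1 else 0.

Lemma tipM_le s : tipM s <= size (cM s).
Proof.
elim: s => // b s IH; rewrite cM_cons /wM !size_cat size_wrap /=; move: IH; case: b => /=; lia.
Qed.

Lemma ins_mid i p x l r : i <= size x -> ins (size l + i) p (l ++ x ++ r) = l ++ ins i p x ++ r.
Proof.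
move=> h; rewrite /ins take_cat drop_cat ltnNge leq_addr /= addKn takel_cat // drop_cat.
case: ltnP => h'; first by rewrite -!catA.
have -> : i = size x by lia.
by rewrite subnn drop0 drop_size cats0 -!catA.
Qed.

Lemma cM_rcons s c : cM (rcons s c) = ins (tipM s) (leaves 2) (cM s).
Proof.
elim: s => [|b s IH]; first by case: c.
rewrite rcons_cons !cM_cons IH /=.
have E u : wM b u = (lside b ++ [:: true]) ++ u ++ (false :: rside b) by case: b {IH}; weq.
rewrite !E -ins_mid ?tipM_le //; congr ins.
by rewrite size_cat /=; lia.
Qed.

(** * Contexts *)

Definition ctx := (word * word)%type.
Definition fill (c : ctx) (x : word) : word := c.1 ++ x ++ c.2.
Definition hole : ctx := ([::], [::]).
Definition cl y (c : ctx) : ctx := (y ++ c.1, c.2).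
Definition cr y (c : ctx) : ctx := (c.1, c.2 ++ y).
Definition cw (c : ctx) : ctx := (true :: c.1, rcons c.2 false).
Definition cwM b c := cl (lside b) (cr (rside b) (cw c)).
Definition cwN b c := cw (cl (lside b) (cr (rside b) c)).

Lemma fill_hole x : fill hole x = x. Proof. by rewrite /fill cats0. Qed.
Lemma fill_cl y c x : fill (cl y c) x = y ++ fill c x. Proof. by rewrite /fill -catA. Qed.
Lemma fill_cr y c x : fill (cr y c) x = fill c x ++ y. Proof. by rewrite /fill -!catA. Qed.
Lemma fill_cw c x : fill (cw c) x = wrap (fill c x).
Proof. by rewrite /fill /wrap -!rcons_cat. Qed.
Lemma fill_cwM b c x : fill (cwM b c) x = wM b (fill c x).
Proof. by rewrite fill_cl fill_cr fill_cw. Qed.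
Lemma fill_cwN b c x : fill (cwN b c) x = wN b (fill c x).
Proof. by rewrite fill_cw fill_cl fill_cr. Qed.
Definition fillE := (fill_cwM, fill_cwN, fill_cl, fill_cr, fill_cw, fill_hole).

(* The end of the caterpillar inside the hole can be shortened down to length [n]. *)
Lemma big_fill n c : 14 <= size c.1 + size c.2 + 4 * n -> ~~ odd (size c.1 + size c.2) ->
  (forall s, size s = n -> big (fill c (cM s))) -> forall s, n <= size s -> big (fill c (cM s)).
Proof.
move=> h ev base s; elim/last_ind: s => [|s b IH]; first by rewrite leqn0 => /eqP n0; apply: base.
rewrite size_rcons leq_eqVlt => /orP[/eqP e|hs]; first by apply: base; rewrite size_rcons.
rewrite /fill cM_rcons -ins_mid ?tipM_le //.
have sz : size (c.1 ++ cM s ++ c.2) = size c.1 + size c.2 + 4 * size s.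
  by rewrite !size_cat size_cM; lia.
apply: big_ins; rewrite ?sz ?inE ?eqxx //.
- by lia.
- by rewrite oddD oddM addbF.
- by have := tipM_le s; rewrite size_cM; lia.
- exact: IH.
Qed.

(** * Inserting a quadrilateral into an odd caterpillar *)

Definition tipX b (x : word) : word := if b then wrap (x ++ wrap (leaves 2)) else wrap (wrap (leaves 2) ++ x).

(** Insertions into an odd caterpillar that give a longer one only after a rotation, as [reach_TX]
    shows. *)
Definition TX (t : seq bool) : seq word :=
  if t is b :: t' then [:: leaves 2 ++ cX t; cX t ++ leaves 2; tipX b (cX t')] else [::].

(** The remaining insertions near the outer end, the rest of the spine being the hole. The last
    three arise from the words [TX] of the inner caterpillar once it is wrapped by the outer
    level. *)
Definition ctxX b b2 : seq ctx :=
  let X1 := cwN b2 (cw hole) in let X0 := cwN b X1 in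
  let far p := if b then cw (cr (leaves 1 ++ p) X1) else cw (cl (p ++ leaves 1) X1) in
  let tp b p c := if b then cw (cr (wrap p) c) else cw (cl (wrap p) c) in
  [:: cl (wrap (leaves 1)) X0; cr (wrap (leaves 1)) X0; far (leaves 2); far (wrap (leaves 1));
      tp b (wrap (leaves 1)) X1;
      cwN b (cl (leaves 2) X1); cwN b (cr (leaves 2) X1); cwN b (tp b2 (leaves 2) (cw hole))].

Definition known9 := known [:: leaves 9] cert9.
Definition known10 := known [:: leaves 10] cert10.

Lemma known9_big w : size w = 18 -> dyck w -> canon w \in known9 -> big w.
Proof. by rewrite /big /known9 => -> dw h; exact: (known_reach dw h). Qed.

Lemma known10_big w : size w = 20 -> dyck w -> canon w \in known10 -> big w.
Proof. by rewrite /big /known10 => -> dw h; exact: (known_reach dw h). Qed.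

Definition bits := [:: true; false].

Lemma mem_bits b : b \in bits. Proof. by case: b. Qed.

Lemma ctxX_base : all (fun b => all (fun b2 => all (fun c : ctx =>
    [&& size c.1 + size c.2 == 14 & all (fun s => let w := fill c (cM s) in
      [&& size w == 18, dyck w & canon w \in known9]) (words 1)]) (ctxX b b2)) bits) bits.
Proof. by vm_compute. Qed.

Lemma ctxX_big b b2 c s : c \in ctxX b b2 -> 1 <= size s -> big (fill c (cM s)).
Proof.
move=> hc; have /allP/(_ _ (mem_bits b))/allP/(_ _ (mem_bits b2))/allP/(_ _ hc) := ctxX_base.
case/andP=> /eqP sc /allP base; apply: big_fill; rewrite ?sc // => s' hs.
have /and3P[/eqP h1 h2 h3] := base s' (eq_ind _ (fun n => s' \in words n) (mem_words s') _ hs).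
exact: known9_big.
Qed.

Lemma X_base : all (fun t => all (fun w =>
  [|| w \in map cX (words 4), w \in TX t | canon w \in known9]) (J (cX t))) (words 3).
Proof. by vm_compute. Qed.

Opaque known9 known10.

Lemma cX_wN b t : cX (b :: t) = wN b (cX t). Proof. by []. Qed.

Lemma dyck_cX t : dyck (cX t). Proof. exact/dyckw/dyck_cM. Qed.

Lemma size_cX t : size (cX t) = 4 * size t + 2.
Proof. by rewrite size_wrap size_cM; lia. Qed.

Lemma quad_cases p : p \in quad -> p = leaves 2 \/ p = wrap (leaves 1).
Proof. by rewrite !inE => /orP[]/eqP; auto. Qed.

Lemma wN_if b z : wN b z = if b then wrap (z ++ leaves 1) else wrap (leaves 1 ++ z).
Proof. by case: b; weq. Qed.

(** Induction removes the outer level. An insertion that touches it is a caterpillar, a rotated one,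
    or one of the contexts; any other lies in the inner caterpillar, and its outcome is wrapped
    again. *)
Lemma insX t w : 3 <= size t -> w \in J (cX t) ->
  [\/ exists2 s, size s = (size t).+1 & w = cX s, w \in TX t | big w].
Proof.
elim: t w => [//|b t IH] w; rewrite leq_eqVlt => /orP[/eqP e|ht].
  move=> hw; have ht : b :: t \in words 3 by rewrite e mem_words.
  have /allP/(_ _ ht)/allP/(_ _ hw)/or3P[/mapP[s hs es]|h|h] := X_base.
  - apply: Or31; exists s => //; rewrite -e; move: hs.
    suff H : all (fun s => size s == 4) (words 4) by move/(allP H)/eqP.
    by vm_compute.
  - exact: Or32.
  apply: Or33; apply: known9_big; [|exact: dyck_J (dyck_cX _) hw|exact: h].
  by rewrite (size_J hw) size_cX -e.
case: t IH ht => [//|b2 t] IH ht.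
have shallow c : c \in ctxX b b2 -> w = fill c (cM t) -> big w.
  by move=> hc ->; apply: ctxX_big hc _; move: ht => /=; lia.
have top n : w = nth [::] (map (fill^~ (cM t)) (ctxX b b2)) n -> n < 8 -> big w.
  by move=> e hn; apply: (shallow (nth hole (ctxX b b2) n)); [exact: mem_nth|rewrite e (nth_map hole)].
rewrite {1}cX_wN => /J_wrap[[p hp H]|[z hz ez]].
  move: hp H; rewrite !inE => /orP[]/eqP-> [] ew.
  - by apply: Or32; rewrite ew; apply/or3P; apply: Or31; apply/eqP.
  - by apply: Or32; rewrite ew; apply/or3P; apply: Or32; apply/eqP.
  - by apply: Or33; apply: (top 0) => //; rewrite ew /= !fillE.
  - by apply: Or33; apply: (top 1) => //; rewrite ew /= !fillE.
have inner z' : z' \in J (cX (b2 :: t)) -> w = wN b z' ->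
  [\/ exists2 s, size s = (size [:: b, b2 & t]).+1 & w = cX s, w \in TX [:: b, b2 & t] | big w].
  move=> hz' ew; case: (IH z' ht hz') => [[s hs es]|hT|bz].
  - by apply: Or31; exists (b :: s); rewrite /= ?hs // ew es.
  - apply: Or33; move: hT; rewrite !inE => /or3P[]/eqP ez'.
    + by apply: (top 5) => //; rewrite ew ez' /= !fillE.
    + by apply: (top 6) => //; rewrite ew ez' /= !fillE.
    + by apply: (top 7) => //; rewrite ew ez' /= !fillE; case: (b2); rewrite !fillE.
  - apply: Or33; rewrite ew.
    have dz := dyck_J (dyck_cX _) hz'.
    have sz := size_J hz'; rewrite size_cX in sz.
    (* Up to rotation, [wN b z'] is [z'] with [leaves 2] appended, so wrapping preserves the
       connection to the ring. *)
    have H : big (ins (size z') (leaves 2) z').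
      by apply: big_ins; rewrite ?mem_head // sz; move: ht => /=; lia.
    rewrite /ins take_size drop_size cats0 in H.
    apply: (@big_unturn 1); first exact: dyck_wN.
    rewrite wN_if; case: (b); rewrite -[iter 1 turn _]/(turn _) -[wrap (_ ++ _)]cats0 turn_wrap; try by dyk.
      by rewrite -catA.
    rewrite -catA; apply: big_rot; [by apply: dyck_cat|by []|by rewrite -catA].
clear IH ht; case: b ez shallow top inner hz => ez shallow top inner.
- rewrite -[lside true ++ _]/(cX (b2 :: t) ++ leaves 1).
  case/J_cat=> [[z' hz' ez']|[z' /J_leaf[p hp H] ez']].
    by apply: (inner z') => //; rewrite ez ez'; weq.
  case: (quad_cases hp) => ep; rewrite {p hp}ep in H.
    case: H => e; rewrite e in ez'.
    + have h : ins (size (cX (b2 :: t))) (leaves 2) (cX (b2 :: t)) \in J (cX (b2 :: t)) by apply: memJ; rewrite ?inE.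
      by apply: (inner _ h); rewrite ez ez' /ins take_size drop_size; weq.
    + by apply: Or32; rewrite ez ez' !inE !eqxx !orbT.
    + by apply: Or33; apply: (top 2) => //; rewrite ez ez' /= !fillE.
  case: H => e; rewrite e in ez'.
  + have h : ins (size (cX (b2 :: t))) (wrap (leaves 1)) (cX (b2 :: t)) \in J (cX (b2 :: t)) by apply: memJ; rewrite ?inE.
      by apply: (inner _ h); rewrite ez ez' /ins take_size drop_size; weq.
  + by apply: Or33; apply: (top 4) => //; rewrite ez ez' /= !fillE.
  + by apply: Or33; apply: (top 3) => //; rewrite ez ez' /= !fillE.
rewrite -[rside false]/[::] cats0; case/J_cat=> [[z' /J_leaf[p hp H] ez']|[z' hz' ez']]; last first.
  by apply: (inner z') => //; rewrite ez ez'; weq.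
case: (quad_cases hp) => ep; rewrite {p hp}ep in H.
  case: H => e; rewrite e in ez'.
  + by apply: Or33; apply: (top 2) => //; rewrite ez ez' /= !fillE.
  + by apply: Or32; rewrite ez ez' !inE !eqxx !orbT.
  + have h : ins 0 (leaves 2) (cX (b2 :: t)) \in J (cX (b2 :: t)) by apply: memJ; rewrite ?inE.
      by apply: (inner _ h); rewrite ez ez'; weq.
case: H => e; rewrite e in ez'.
+ by apply: Or33; apply: (top 3) => //; rewrite ez ez' /= !fillE.
+ by apply: Or33; apply: (top 4) => //; rewrite ez ez' /= !fillE.
+ have h : ins 0 (wrap (leaves 1)) (cX (b2 :: t)) \in J (cX (b2 :: t)) by apply: memJ; rewrite ?inE.
      by apply: (inner _ h); rewrite ez ez'; weq.
Qed.

(** * Inserting a quadrilateral into even caterpillars and into the middle component *)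

Definition gapM b (y x : word) : word := if b then x ++ y else y ++ x.

Definition sym2 b (y z : word) : word := if b then y ++ z else z ++ y.

(** Exceptional insertions into [cM t]: up to rotation each is a longer [cM] or a word of a middle
    component, see [reach_TM]. *)
Definition TM (t : seq bool) : seq word :=
  if t is b :: t' then
    [:: wrap (leaves 1) ++ cM t; cM t ++ wrap (leaves 1);
        gapM b (sym2 b (wrap (leaves 1)) (leaves 1)) (cX t');
        gapM b (leaves 3) (cX t'); gapM b (wrap (wrap (leaves 1))) (cX t');
        wM b (gapM b (wrap (leaves 1)) (cM t'))]
  else [::].

Definition gapC b y c : ctx := if b then cr y c else cl y c.

Lemma fill_gapC b y c x : fill (gapC b y c) x = gapM b y (fill c x).
Proof. by case: b; rewrite /gapC fillE. Qed.

Definition ctxM b b2 : seq ctx :=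
  let x := cw hole in
  [:: gapC b (wrap (leaves 2)) (cw (cwM b2 hole));
      cwM b (gapC b2 (sym2 b2 (wrap (leaves 1)) (leaves 1)) x);
      cwM b (gapC b2 (leaves 3) x); cwM b (gapC b2 (wrap (wrap (leaves 1))) x);
      cwM b (cwM b2 (gapC b2 (wrap (leaves 1)) hole))].

Transparent known9 known10.

Lemma ctxM_base : all (fun b => all (fun b2 => all (fun c : ctx =>
    [&& size c.1 + size c.2 == 12 & all (fun s => let w := fill c (cM s) in
      [&& size w == 20, dyck w & canon w \in known10]) (words 2)]) (ctxM b b2)) bits) bits.
Proof. by vm_compute. Qed.

Lemma M_base : all (fun t => all (fun w =>
  [|| w \in map cM (words 5), has (fun s => w \in LM s) (words 4), w \in TM t | canon w \in known10])
    (J (cM t))) (words 4).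
Proof. by vm_compute. Qed.

(** These become words of a longer middle component after rotation, see [reach_TA]. *)
Definition TA (t : seq bool) : seq word :=
  if t is b :: t' then
    [:: wrap (leaves 1) ++ cA t; cA t ++ wrap (leaves 1);
        sym2 b (leaves 1 ++ cX t' ++ leaves 1) (sym2 b (wrap (leaves 1)) (leaves 1))]
  else [::].

Definition goodA b : seq (word * word) :=
  let P := lside b ++ leaves 1 in let S := leaves 1 ++ rside b in
  [:: (wrap (leaves 1) ++ P, S); (P, S ++ wrap (leaves 1));
      if b then (P, leaves 1 ++ wrap (leaves 1) ++ leaves 1)
      else (leaves 1 ++ wrap (leaves 1) ++ leaves 1, S)].

(* Insertions next to the spine edge are already insertions into the odd caterpillar. *)
Definition sidesA b : seq (word * word) :=
  let P := lside b ++ leaves 1 in let S := leaves 1 ++ rside b in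
  [seq (z, S) | z <- J P] ++ [seq (P, z) | z <- J S].

Definition midC b c : ctx := cl (lside b ++ leaves 1) (cr (leaves 1 ++ rside b) c).

Lemma fill_midC b c x : fill (midC b c) x = mid b (fill c x).
Proof. by rewrite /midC fillE fillE. Qed.

Definition ctxA b b2 : seq ctx :=
  let X1 := cwN b2 (cw hole) in
  [seq cl e.1 (cr e.2 X1) | e <- sidesA b & e \notin goodA b] ++
  [:: midC b (cl (leaves 2) X1); midC b (cr (leaves 2) X1);
      midC b (if b2 then cw (cr (wrap (leaves 2)) (cw hole)) else cw (cl (wrap (leaves 2)) (cw hole)))].

Lemma ctxA_base : all (fun b => all (fun b2 => all (fun c : ctx =>
    [&& size c.1 + size c.2 == 16 & all (fun s => let w := fill c (cM s) in
      [&& size w == 20, dyck w & canon w \in known10]) (words 1)]) (ctxA b b2)) bits) bits.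
Proof. by vm_compute. Qed.

Lemma A_base : all (fun t => all (fun w =>
  [|| w \in map cA (words 4), w \in TA t | canon w \in known10]) (J (cA t))) (words 3).
Proof. by vm_compute. Qed.

Opaque known9 known10.

Lemma ctxM_big b b2 c s : c \in ctxM b b2 -> 2 <= size s -> big (fill c (cM s)).
Proof.
move=> hc; have /allP/(_ _ (mem_bits b))/allP/(_ _ (mem_bits b2))/allP/(_ _ hc) := ctxM_base.
case/andP=> /eqP sc /allP base; apply: big_fill; rewrite ?sc // => s' hs.
have /and3P[/eqP h1 h2 h3] := base s' (eq_ind _ (fun n => s' \in words n) (mem_words s') _ hs).
exact: known10_big.
Qed.

Lemma ctxA_big b b2 c s : c \in ctxA b b2 -> 1 <= size s -> big (fill c (cM s)).
Proof.
move=> hc; have /allP/(_ _ (mem_bits b))/allP/(_ _ (mem_bits b2))/allP/(_ _ hc) := ctxA_base.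
case/andP=> /eqP sc /allP base; apply: big_fill; rewrite ?sc // => s' hs.
have /and3P[/eqP h1 h2 h3] := base s' (eq_ind _ (fun n => s' \in words n) (mem_words s') _ hs).
exact: known10_big.
Qed.

Lemma size_words n s : s \in words n -> size s = n.
Proof.
elim: n s => [|n IH] s; first by rewrite inE => /eqP->.
by case/allpairsP=> [[b s'] [_ /IH h ->]] /=; rewrite h.
Qed.

Lemma wM_if b z : wM b z = if b then wrap z ++ leaves 1 else leaves 1 ++ wrap z.
Proof. by case: b; weq. Qed.

Lemma big_wM b z : 14 <= size z -> dyck z -> big z -> big (wM b z).
Proof.
move=> h dz bz.
have H : big (wrap z ++ leaves 1).
  apply: (@big_unturn 1); first by apply: dyck_cat => //; apply: dyckw.
  rewrite -[iter 1 turn _]/(turn _) turn_wrap //.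
  have := @big_ins (size z) (wrap (leaves 1)) z h (dyck_even dz) isT (leqnn _) bz.
  by rewrite /ins take_size drop_size cats0.
by rewrite wM_if; case: b => //; apply: big_rot => //; apply: dyckw.
Qed.

Lemma insM t w : 4 <= size t -> w \in J (cM t) ->
  [\/ exists2 s, size s = (size t).+1 & w = cM s,
      exists2 s, size s = size t & w \in LM s,
      w \in TM t | big w].
Proof.
elim: t w => [//|b t IH] w; rewrite leq_eqVlt => /orP[/eqP e|ht].
  move=> hw; have ht : b :: t \in words 4 by rewrite e mem_words.
  have /allP/(_ _ ht)/allP/(_ _ hw)/or4P[/mapP[s hs es]|/hasP[s hs es]|h|h] := M_base.
  - by apply: Or41; exists s => //; rewrite (size_words hs) -e.
  - by apply: Or42; exists s => //; rewrite (size_words hs) -e.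
  - exact: Or43.
  apply: Or44; apply: known10_big; [|exact: dyck_J (dyck_cM _) hw|exact: h].
  by rewrite (size_J hw) size_cM -e.
case: t IH ht => [//|b2 t] IH ht.
have shallow c : c \in ctxM b b2 -> w = fill c (cM t) -> big w.
  by move=> hc ->; apply: ctxM_big hc _; move: ht => /=; lia.
have top n : w = nth [::] (map (fill^~ (cM t)) (ctxM b b2)) n -> n < 5 -> big w.
  by move=> e hn; apply: (shallow (nth hole (ctxM b b2) n)); [exact: mem_nth|rewrite e (nth_map hole)].
have inner z : z \in J (cM (b2 :: t)) -> w = wM b z ->
  [\/ exists2 s, size s = (size [:: b, b2 & t]).+1 & w = cM s,
      exists2 s, size s = size [:: b, b2 & t] & w \in LM s,
      w \in TM [:: b, b2 & t] | big w].
  move=> hz ew; case: (IH z ht hz) => [[s hs es]|[s hs es]|hT|bz].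
  - by apply: Or41; exists (b :: s); rewrite /= ?hs // ew es.
  - by apply: Or42; exists (b :: s); rewrite /= ?hs // ew !inE map_f ?orbT.
  - have tm5 : z = gapM b (wrap (leaves 1)) (cM (b2 :: t)) -> w \in TM [:: b, b2 & t].
      by move=> ez; rewrite ew ez /TM !inE eqxx !orbT.
    (* A wrapped pair on the side away from the extra edge makes [w] a pendant word of the middle
       component with the opposite turn. *)
    have pb1 : z = gapM (~~ b) (wrap (leaves 1)) (cM (b2 :: t)) ->
        exists2 s, size s = size [:: b, b2 & t] & w \in LM s.
      move=> ez; exists (~~ b :: b2 :: t) => //.
      suff -> : w = PB1 (~~ b) (b2 :: t) by rewrite !inE eqxx orbT.
      by rewrite ew ez wM_if /PB1; case: (b).
    rewrite !inE in hT; case/orP: hT => [|/orP[|/or4P[]]] /eqP ez.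
    + have [hb|hb] : b \/ ~~ b by case: (b); auto.
        by apply: Or42; apply: pb1; rewrite ez /gapM hb.
      by apply: Or43; apply: tm5; rewrite ez /gapM (negbTE hb).
    + have [hb|hb] : b \/ ~~ b by case: (b); auto.
        by apply: Or43; apply: tm5; rewrite ez /gapM hb.
      by apply: Or42; apply: pb1; rewrite ez /gapM (negbTE hb).
    + by apply: Or44; apply: (top 1) => //; rewrite ew ez /= !(fill_gapC, fillE).
    + by apply: Or44; apply: (top 2) => //; rewrite ew ez /= !(fill_gapC, fillE).
    + by apply: Or44; apply: (top 3) => //; rewrite ew ez /= !(fill_gapC, fillE).
    + by apply: Or44; apply: (top 4) => //; rewrite ew ez /= !(fill_gapC, fillE).
  - apply: Or44; rewrite ew; apply: big_wM => //; last exact: dyck_J (dyck_cM _) hz.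
    by rewrite (size_J hz) size_cM; move: ht => /=; lia.
rewrite cM_cons wM_if; set x := cX (b2 :: t).
have outer : w \in [:: wrap (leaves 1) ++ cM [:: b, b2 & t]; cM [:: b, b2 & t] ++ wrap (leaves 1)] ->
    w \in TM [:: b, b2 & t].
  by rewrite !inE => /orP[]->; rewrite ?orbT.
have gap3 : w = gapM b (leaves 3) x -> w \in TM [:: b, b2 & t].
  by move=> ->; rewrite !inE eqxx !orbT.
have gap2 : w = gapM b (sym2 b (wrap (leaves 1)) (leaves 1)) x -> w \in TM [:: b, b2 & t].
  by move=> ->; rewrite !inE eqxx !orbT.
have gap4 : w = gapM b (wrap (wrap (leaves 1))) x -> w \in TM [:: b, b2 & t].
  by move=> ->; rewrite !inE eqxx !orbT.
have tip2 : w = gapM b (wrap (leaves 2)) x -> big w.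
  by move=> ew; apply: (top 0) => //; rewrite ew /= !(fill_gapC, fillE).
have a1 : w = A1 (~~ b) (b2 :: t) -> exists2 s, size s = size [:: b, b2 & t] & w \in LM s.
  by move=> ->; exists (~~ b :: b2 :: t) => //; rewrite inE eqxx.
case: b ht shallow top inner outer gap3 gap2 gap4 tip2 a1 =>
  ht shallow top inner outer gap3 gap2 gap4 tip2 a1 hw.
  case/J_cat: hw => [[z /J_wrap[[p hp H]|[z' hz ez']] ez]|[z /J_leaf[p hp H] ez]].
  - case: (quad_cases hp) => ep; rewrite {p hp}ep in H; case: H => H; rewrite H in ez.
    + by apply: Or42; apply: a1; rewrite ez /x; weq.
    + by apply: Or43; apply: gap3; rewrite ez /x; weq.
    + apply: Or43; apply: outer; rewrite ez -catA inE; apply/orP; left; apply/eqP.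
      by rewrite [cM (_ :: _ :: _)]cM_cons wM_if.
    + by apply: Or43; apply: gap2; rewrite ez /x; weq.
  - by apply: (inner z') => //; rewrite ez ez' wM_if.
  - case: (quad_cases hp) => ep; rewrite {p hp}ep in H; case: H => H; rewrite H in ez.
    + by apply: Or43; apply: gap3; rewrite ez.
    + by apply: Or44; apply: tip2; rewrite ez.
    + by apply: Or43; apply: gap3; rewrite ez.
    + by apply: Or43; apply: gap2; rewrite ez.
    + by apply: Or43; apply: gap4; rewrite ez.
    + apply: Or43; apply: outer; rewrite ez !inE; apply/orP; right; apply/eqP.
      by rewrite [cM (_ :: _ :: _)]cM_cons wM_if -catA.
case/J_cat: hw => [[z /J_leaf[p hp H] ez]|[z /J_wrap[[p hp H]|[z' hz ez']] ez]].
- case: (quad_cases hp) => ep; rewrite {p hp}ep in H; case: H => H; rewrite H in ez.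
  + by apply: Or43; apply: gap3; rewrite ez.
  + by apply: Or44; apply: tip2; rewrite ez.
  + by apply: Or43; apply: gap3; rewrite ez.
  + apply: Or43; apply: outer; rewrite ez !inE; apply/orP; left; apply/eqP.
    by rewrite [cM (_ :: _ :: _)]cM_cons wM_if -catA.
  + by apply: Or43; apply: gap4; rewrite ez.
  + by apply: Or43; apply: gap2; rewrite ez.
- case: (quad_cases hp) => ep; rewrite {p hp}ep in H; case: H => H; rewrite H in ez.
  + by apply: Or43; apply: gap3; rewrite ez /x; weq.
  + by apply: Or42; apply: a1; rewrite ez /x; weq.
  + by apply: Or43; apply: gap2; rewrite ez /x; weq.
  + apply: Or43; apply: outer; rewrite ez catA !inE; apply/orP; right; apply/eqP.
    by rewrite [cM (_ :: _ :: _)]cM_cons wM_if.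
- by apply: (inner z') => //; rewrite ez ez' wM_if.
Qed.

Lemma insA t w : 3 <= size t -> w \in J (cA t) ->
  [\/ exists2 s, size s = (size t).+1 & w = cA s, w \in TA t | big w].
Proof.
case: t => [//|b t]; rewrite leq_eqVlt => /orP[/eqP e|ht].
  move=> hw; have ht : b :: t \in words 3 by rewrite e mem_words.
  have /allP/(_ _ ht)/allP/(_ _ hw)/or3P[/mapP[s hs es]|h|h] := A_base.
  - by apply: Or31; exists s => //; rewrite (size_words hs) -e.
  - exact: Or32.
  apply: Or33; apply: known10_big; [| |exact: h].
    by rewrite (size_J hw) /= /A1 size_mid size_cX; move: e => /=; lia.
  by apply: dyck_J hw; apply/dyck_mid/dyck_cX.
case: t ht => [//|b2 t] ht.
have shallow c : c \in ctxA b b2 -> w = fill c (cM t) -> big w.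
  by move=> hc ->; apply: ctxA_big hc _; move: ht => /=; lia.
have sides e : e \in sidesA b -> w = e.1 ++ cX (b2 :: t) ++ e.2 ->
    w \in TA [:: b, b2 & t] \/ big w.
  move=> he ew; have [hg|hg] := boolP (e \in goodA b); [left|right].
    move: hg ew; rewrite !inE => /or3P[]/eqP-> ->.
    + by apply/orP; left; rewrite /= /A1 /mid -!catA.
    + by apply/orP; right; apply/orP; left; rewrite /= /A1 /mid -!catA.
    + by apply/orP; right; apply/orP; right; rewrite /sym2; case: (b); rewrite /= -?catA.
  apply: (shallow (cl e.1 (cr e.2 (cwN b2 (cw hole))))); last by rewrite ew !fillE.
  by rewrite mem_cat; apply/orP; left; apply/mapP; exists e; rewrite // mem_filter hg.
case/J_cat=> [[z hz ez]|[z /J_cat[[z' hz ez']|[z' hz ez']] ez]].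
- case: (sides (z, leaves 1 ++ rside b)); [|by rewrite ez|exact: Or32|exact: Or33].
  by rewrite mem_cat; apply/orP; left; apply/mapP; exists z.
- have ew : w = mid b z' by rewrite ez ez'.
  case: (insX _ hz) => [|[s hs es]|hT|bz]; first by move: ht => /=; lia.
  + by apply: Or31; exists (b :: s); rewrite /= ?hs // ew es.
  + apply: Or33; move: hT; rewrite !inE => /or3P[]/eqP e2; rewrite e2 in ew.
    * by apply: (shallow (midC b (cl (leaves 2) (cwN b2 (cw hole)))));
        [rewrite mem_cat !inE eqxx ?orbT|rewrite ew fill_midC !fillE].
    * by apply: (shallow (midC b (cr (leaves 2) (cwN b2 (cw hole)))));
        [rewrite mem_cat !inE eqxx ?orbT|rewrite ew fill_midC !fillE].
    * apply: (shallow (midC b (if b2 then cw (cr (wrap (leaves 2)) (cw hole))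
        else cw (cl (wrap (leaves 2)) (cw hole))))).
        by rewrite mem_cat !inE eqxx ?orbT.
      by rewrite ew fill_midC; case: (b2); rewrite !fillE.
  + apply: Or33; rewrite ew.
    have dz := dyck_J (dyck_cX _) hz.
    have sz := size_J hz; rewrite size_cX in sz.
    (* Up to rotation, [mid b z'] is [z'] followed by three short edges. *)
    have H : big (z' ++ leaves 3).
      by apply: big_hex => //; rewrite sz; move: ht => /=; lia.
    rewrite /mid; case: (b) => /=.
      rewrite -[[:: true, _ & _]]/(leaves 1 ++ (z' ++ leaves 2)); apply: big_rot => //.
        by dyk.
      by rewrite -catA.
    rewrite -[[:: true, _ & _]]/(leaves 2 ++ (z' ++ leaves 1)); apply: big_rot => //.
      by dyk.
    by rewrite -catA.
- case: (sides (lside b ++ leaves 1, z')); [|by rewrite ez ez'|exact: Or32|exact: Or33].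
  by rewrite mem_cat; apply/orP; right; apply/mapP; exists z'.
Qed.

Ltac dyk2 := by repeat first [assumption | exact: dyck_leaves | exact: dyck_cM | exact: dyck_cX | done
  | apply: dyckw | apply: dyck_cat].

Lemma rel_med0 j : rel_med 0 (3 * j).
Proof. by rewrite /rel_med /=; have -> : 3 * j %% 3 = 0 by lia. Qed.

Lemma rel_medA i j : i %% 3 = 0 -> i %/ 3 <= j -> rel_med i (3 * j).
Proof.
move=> hi hj; rewrite /rel_med hi; have -> : 3 * j %% 3 = 0 by lia.
by have -> : 3 * j %/ 3 = j by lia.
Qed.

Lemma rel_medP i : i %% 3 != 0 -> rel_med i (3 * (i %/ 3)).
Proof.
move=> hi; rewrite /rel_med (negbTE hi); have -> : 3 * (i %/ 3) %% 3 = 0 by lia.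
have -> : 3 * (i %/ 3) %/ 3 = i %/ 3 by lia.
by rewrite !eqxx.
Qed.

(** Two steps suffice: a core word goes through the deepest [B1], which is joined to all core words
    of [LM], and a pendant through its only neighbour; each [B1] is joined to the outermost [A1],
    which is [cA s]. *)
Lemma LM_conn s x : x \in LM s -> conn x (cA s).
Proof.
move=> hx; set i := index x (LM s); set m := size s.
have hi : i < 3 * m by rewrite -size_LM index_mem.
have ex : x = nth [::] (LM s) i by rewrite nth_index.
have eA : cA s = nth [::] (LM s) 0 by case: (s).
have go j : j < m -> rel_med i (3 * j) -> conn x (cA s).
  move=> hj r; have hj' : 3 * j < 3 * size s by rewrite -/m; lia.
  apply: (@conn_step _ (nth [::] (LN s) (3 * j))).
    by apply: conn1; rewrite ex adj_med.
  by rewrite adj_sym eA adj_med //; [exact: rel_med0|rewrite -/m; lia].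
have [h|h] := eqVneq (i %% 3) 0.
  by apply: (go m.-1); [lia|apply: rel_medA => //; lia].
by apply: (go (i %/ 3)); [lia|exact: rel_medP].
Qed.

Lemma LN_conn s x : x \in LN s -> conn x (cA s).
Proof.
move=> hx; have hj : index x (LN s) < 3 * size s by rewrite -size_LN index_mem.
have ex : x = nth [::] (LN s) (index x (LN s)) by rewrite nth_index.
move: (index x (LN s)) hj ex => j hj ex.
suff [i [hi a]] : exists i, i < 3 * size s /\ rel_med i j.
  apply: (conn_trans (conn1 _) (@LM_conn s (nth [::] (LM s) i) _)).
    by rewrite adj_sym ex adj_med.
  by rewrite mem_nth ?size_LM.
exists (3 * (j %/ 3)); split; first lia.
rewrite /rel_med; have -> : 3 * (j %/ 3) %% 3 = 0 by lia.
have -> : 3 * (j %/ 3) %/ 3 = j %/ 3 by lia.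
by rewrite leqnn !eqxx; case: (j %% 3 == 0).
Qed.

(** * From the outcomes of an insertion back to the representatives *)

Section Roots.
Variable k : nat.
Hypothesis k9 : 9 <= k.

Lemma roots_leaves : leaves k \in roots k.
Proof.
rewrite /roots; case: ifP => _; first by rewrite mem_cat inE eqxx orbT.
by rewrite !mem_cat ifT ?mem_cat ?inE ?eqxx ?orbT //; lia.
Qed.

Lemma reach_big w : size w = 2 * k -> big w -> reach (roots k) w.
Proof.
move=> s; rewrite /big s; have -> : (2 * k)./2 = k by lia.
by apply: reach_sub => y; rewrite inE => /eqP ->; apply: roots_leaves.
Qed.

Lemma reach_X s : odd k -> size s = k./2 -> reach (roots k) (cX s).
Proof.
move=> ok hs; apply: reach_root; rewrite /roots ok mem_cat map_f //.
by rewrite -hs mem_words.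
Qed.

Lemma reach_M s : ~~ odd k -> size s = k./2 -> reach (roots k) (cM s).
Proof.
move=> /negbTE ok hs; apply: reach_root; rewrite /roots ok mem_cat map_f //.
by rewrite -hs mem_words.
Qed.

Lemma reach_A s : ~~ odd k -> size s = k./2.-1 -> reach (roots k) (cA s).
Proof.
move=> /negbTE ok hs; apply: reach_root; rewrite /roots ok mem_cat ifT; last lia.
by rewrite mem_cat map_f ?orbT // -hs mem_words.
Qed.

Lemma reach_LM s x : ~~ odd k -> size s = k./2.-1 -> x \in LM s -> reach (roots k) x.
Proof. by move=> ok hs /LM_conn c; apply: reach_conn c _; apply: reach_A. Qed.

(** One turn opens the outer edge of [cX [:: true, b & t]] and leaves [cX (b :: t) ++ leaves 2]. The
    word [tipX] is brought to this form by opening first its outer edge and then the edge around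
    [leaves 2]. *)
Lemma reach_TX t w : odd k -> (size t).+1 = k./2 -> w \in TX t -> reach (roots k) w.
Proof.
move=> ok; case: t => [//|b t] ht.
have dx := dyck_cX t; have dX := dyck_cX (b :: t); have dw := dyckw (dyck_leaves 2).
have hX : reach (roots k) (cX (b :: t) ++ leaves 2).
  have -> : cX (b :: t) ++ leaves 2 = turn (cX [:: true, b & t]).
    rewrite [cX [:: true, b & t]]cX_wN wN_if -[wrap _ in RHS]cats0 turn_wrap ?dyck_cat //.
    by rewrite -catA.
  exact: (@reach_turn (roots k) 1 _ (@reach_X [:: true, b & t] ok ht)).
rewrite !inE => /or3P[]/eqP->; first by apply: reach_rot; [dyk2|dyk2|].
  exact: hX.
have H c : reach (roots k) (wrap (leaves 2) ++ if c then cX t ++ leaves 1 else leaves 1 ++ cX t).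
  have dc : dyck (if c then cX t ++ leaves 1 else leaves 1 ++ cX t) by case: c; apply: dyck_cat.
  apply: (@reach_unturn _ 1); first exact: dyck_cat.
  rewrite -[iter 1 turn _]/(turn _) turn_wrap //.
  have -> : wrap (if c then cX t ++ leaves 1 else leaves 1 ++ cX t) = cX (c :: t).
    by rewrite cX_wN wN_if; case: c {dc}.
  apply: reach_rot; [dyk2|dyk2|].
  have -> : cX (c :: t) ++ leaves 2 = turn (cX [:: true, c & t]).
    rewrite [cX [:: true, c & t]]cX_wN wN_if -[wrap _ in RHS]cats0 turn_wrap ?dyck_cat ?dyck_cX //.
    by rewrite -catA.
  exact: (@reach_turn (roots k) 1 _ (@reach_X [:: true, c & t] ok ht)).
rewrite /tipX; case: (b).
  apply: (@reach_unturn _ 1); first by apply: dyckw; apply: dyck_cat.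
  rewrite -[iter 1 turn _]/(turn _) -[wrap (_ ++ _)]cats0 turn_wrap ?dyck_cat //.
  rewrite -catA; apply: reach_rot; [dyk2|dyk2|].
  by rewrite -catA; apply: (H false).
apply: (@reach_unturn _ 1); first by apply: dyckw; apply: dyck_cat.
rewrite -[iter 1 turn _]/(turn _) -[wrap (_ ++ _)]cats0 turn_wrap ?dyck_cat //.
by rewrite -catA; apply: (H true).
Qed.

Lemma reach_TM t w : ~~ odd k -> (size t).+1 = k./2 -> w \in TM t -> reach (roots k) w.
Proof.
move=> ok; case: t => [//|b t] ht.
have dm := dyck_cM t; have dM := dyck_cM (b :: t); have dx := dyck_cX t.
have H0 c : reach (roots k) (cM (c :: t) ++ wrap (leaves 1)).
  have -> : cM (c :: t) ++ wrap (leaves 1) = turn (cM [:: true, c & t]).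
    by rewrite [cM [:: true, c & t]]cM_cons wM_if turn_wrap // dyck_cM.
  exact: (@reach_turn (roots k) 1 _ (@reach_M [:: true, c & t] ok ht)).
have ht' : size (true :: t) = k./2.-1 by rewrite -ht.
have mem c x : x \in LM (c :: t) -> reach (roots k) x by apply: reach_LM.
have d3 : dyck (wrap (wrap (cM t))) by do 2!apply: dyckw.
have H4 : reach (roots k) (cX t ++ wrap (wrap (leaves 1))).
  have -> : cX t ++ wrap (wrap (leaves 1)) = iter 2 turn (PB2 true t).
    have -> : PB2 true t = wrap (wrap (wrap (cM t))) ++ leaves 1 by [].
    by rewrite -[iter 2 turn _]/(turn (turn _)) !turn_wrap // dyckw.
  by apply: reach_turn; apply: (mem true); rewrite !inE eqxx ?orbT.
have H3 : reach (roots k) (cX t ++ leaves 3).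
  have -> : cX t ++ leaves 3 = (cX t ++ leaves 2) ++ leaves 1 by rewrite -catA.
  apply: reach_rot; [dyk2|dyk2|].
  by apply: (mem true); rewrite inE; apply/orP; left; apply/eqP; rewrite /A1; weq.
rewrite !inE => /orP[|/orP[|/or4P[]]] /eqP->.
- by apply: reach_rot; [dyk2|dyk2|].
- exact: H0.
- case: (b); rewrite /gapM /sym2.
    apply: reach_rot; [dyk2|dyk2|rewrite -catA].
    apply: reach_rot; [dyk2|dyk2|].
    by have := H0 false; rewrite cM_cons wM_if.
  apply: reach_rot; [dyk2|dyk2|].
  by have := H0 true; rewrite cM_cons wM_if -catA.
- case: (b); rewrite /gapM; first exact: H3.
  by apply: reach_rot; [dyk2|dyk2|exact: H3].
- case: (b); rewrite /gapM; first exact: H4.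
  by apply: reach_rot; [dyk2|dyk2|exact: H4].
rewrite wM_if; case: (b); rewrite /gapM.
  apply: reach_rot; [dyk2|dyk2|].
  by apply: (mem true); rewrite !inE eqxx ?orbT.
apply: reach_rot; [dyk2|dyk2|].
by apply: (mem false); rewrite !inE eqxx ?orbT.
Qed.

Lemma reach_TA t w : ~~ odd k -> (size t).+1 = k./2.-1 -> w \in TA t -> reach (roots k) w.
Proof.
move=> ok; case: t => [//|b t] ht.
have dx := dyck_cX t.
have dA c : dyck (cA (c :: t)) by apply: dyck_mid.
have H1 c : reach (roots k) (cA (c :: t) ++ wrap (leaves 1)).
  have -> : cA (c :: t) ++ wrap (leaves 1) = turn (wM true (cA (c :: t))).
    by rewrite wM_if turn_wrap.
  have h : wM true (cA (c :: t)) \in LM [:: true, c & t].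
    by rewrite /= !in_cons eqxx ?orbT.
  exact: (@reach_turn (roots k) 1 _ (@reach_LM [:: true, c & t] _ ok ht h)).
have H0 c : reach (roots k) (wrap (leaves 1) ++ cA (c :: t)) by apply: reach_rot; [dyk2|dyk2|].
rewrite !inE => /or3P[]/eqP->; [exact: H0|exact: H1|].
case: (b); rewrite /sym2.
  apply: reach_rot; [dyk2|dyk2|].
  have -> : (wrap (leaves 1) ++ leaves 1) ++ leaves 1 ++ cX t ++ leaves 1 =
    wrap (leaves 1) ++ cA (false :: t) by rewrite /= /A1; weq.
  exact: H0.
rewrite -catA; apply: reach_rot; [dyk2|dyk2|].
have -> : (wrap (leaves 1) ++ leaves 1 ++ cX t ++ leaves 1) ++ leaves 1 =
  wrap (leaves 1) ++ cA (true :: t) by rewrite /= /A1; weq.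
exact: H0.
Qed.

End Roots.

Lemma size_cA s : s <> [::] -> size (cA s) = 4 * size s + 4.
Proof. by case: s => //= b t _; rewrite /A1 size_mid size_cX; lia. Qed.

Lemma dyck_cA s : dyck (cA s).
Proof. by case: s => //= b t; apply/dyck_mid/dyck_cX. Qed.

(** From seven edges on the caterpillars have the lengths required by [insX], [insM] and [insA], and
    the ring is covered by [big_J_leaves]. The extra words at 7 and 8 are covered by
    certificates. *)
Lemma roots_step k : 7 <= k -> {in roots k, forall y, dyck y /\ {in J y, forall v, reach (roots k.+2) v}}.
Proof.
move=> k7 y; have k9 : 9 <= k.+2 by [].
have ring v : v \in J (leaves k) -> reach (roots k.+2) v.
  move=> hv; apply: reach_big => //; last exact: big_J_leaves hv.
  by rewrite (size_J hv) size_leaves; lia.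
rewrite {1}/roots; case: (boolP (odd k)) => ok; rewrite mem_cat; case/orP.
- case/mapP=> t /size_words ht ->; split; first exact: dyck_cX.
  move=> v hv; case: (insX _ hv) => [|[s hs ->]|hT|bv].
  + by rewrite ht; lia.
  + by apply: reach_X => //=; rewrite ?negbK // hs ht.
  + by apply: (reach_TX _ _ hT) => //=; rewrite ?negbK // ht.
  + by apply: reach_big => //; rewrite (size_J hv) size_cX ht; lia.
- rewrite inE => /orP[/eqP->|]; first by split; [exact: dyck_leaves|exact: ring].
  case: eqP => // ek; rewrite inE => /eqP->; split=> // v hv.
  have [_ H] := coversP covers9 (mem_head _ _).
  apply: reach_sub (H v hv) => z; rewrite inE => /eqP->; rewrite ek; exact: roots_leaves.
- case/mapP=> t /size_words ht ->; split; first exact: dyck_cM.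
  move=> v hv; case: (insM _ hv) => [|[s hs ->]|[s hs hL]|hT|bv].
  + by rewrite ht; lia.
  + by apply: reach_M => //=; rewrite ?negbK // hs ht.
  + by apply: (reach_LM _ _ _ hL) => //=; rewrite ?negbK // hs ht.
  + by apply: (reach_TM _ _ _ hT) => //=; rewrite ?negbK // ht.
  + by apply: reach_big => //; rewrite (size_J hv) size_cM ht; lia.
rewrite ifT; last lia.
rewrite mem_cat; case/orP.
- case/mapP=> t /size_words ht ->; split; first exact: dyck_cA.
  move=> v hv; case: (insA _ hv) => [|[s hs ->]|hT|bv].
  + by rewrite ht; lia.
  + by apply: reach_A => //=; rewrite ?negbK // hs ht; lia.
  + by apply: (reach_TA _ _ _ hT) => //=; rewrite ?negbK // ht; lia.
  + apply: reach_big => //; rewrite (size_J hv) size_cA ?ht; first lia.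
    by case: t ht {hv} => //=; lia.
- rewrite inE => /orP[/eqP->|]; first by split; [exact: dyck_leaves|exact: ring].
  case: eqP => // ek; rewrite inE => /eqP->; split=> // v hv.
  have [_ H] := coversP covers10 (mem_head _ _).
  apply: reach_sub (H v hv) => z; rewrite inE => /eqP->; rewrite ek; exact: roots_leaves.
Qed.

Lemma flex_reach w : flex w -> reach (roots (size w)./2) w.
Proof.
elim: {w}(size w) {-2}w (leqnn (size w)) => [|n IH] w sz fw.
  by case: w sz {fw} => // _; apply: reach_root.
have [->|/eqP nw] := eqVneq w [::]; first by apply: reach_root.
have [v av] := fw; have dw := adj_dyck av.
case: (flex_quad_ear fw nw) => [|[r [i [p [w0 [hp hi fw0 c]]]]]].
  by rewrite !inE => /orP[]/eqP->; apply: reach_root.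
have sw := conn_size c; rewrite size_iter_turn size_ins (quad_size hp) in sw.
have IH0 : reach (roots (size w0)./2) w0 by apply: IH => //; lia.
have [v0 av0] := fw0; have dw0 := adj_dyck av0; have ew0 := dyck_even dw0.
apply: (@reach_unturn _ r) => //; apply: reach_conn c _.
have -> : (size w)./2 = (size w0)./2.+2 by lia.
suff H : {in roots (size w0)./2, forall y, dyck y /\ {in J y, forall v, reach (roots (size w0)./2.+2) v}}.
  exact: reach_ins H IH0 hp hi.
have [h7|h7] := leqP 7 (size w0)./2; first exact: roots_step.
(* A single edge has no neighbour, so no list of insertions into [roots 1] is needed. *)
have n1 : (size w0)./2 <> 1.
  move=> h1; have s2 : size w0 = 2 by lia.
  by move: s2 av0 dw0; case: (w0) => [|[] [|[] []]] //= _; rewrite nadj1.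
move: (size w0)./2 h7 n1 => m.
case: m => [|[|[|[|[|[|[|]]]]]]] // _ _.
- exact: coversP covers2.
- exact: coversP covers4.
- exact: coversP covers5.
- exact: coversP covers6.
- exact: coversP covers7.
- exact: coversP covers8.
Qed.

(** * Words of matchings *)

Record nc (f : nat -> nat) (n : nat) : Prop := NC {
  nc_lt : forall i, i < n -> f i < n;
  nc_neq : forall i, i < n -> f i <> i;
  nc_inv : forall i, i < n -> f (f i) = i;
  nc_cross : forall i j, j < n -> i < j -> j < f i -> f i < f j -> False }.

Definition wd (f : nat -> nat) n : word := mkseq (fun i => i < f i) n.

(** The bracket stack before reading point [i], most recent opening first. Non-crossing means that a
    closing point is matched with the head of this stack. *)
Definition opens (f : nat -> nat) i := [seq j <- rev (iota 0 i) | i <= f j].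

Lemma mem_opens f i j : (j \in opens f i) = (j < i <= f j).
Proof. by rewrite mem_filter mem_rev mem_iota add0n /= andbC. Qed.

Lemma rev_iotaS i : rev (iota 0 i.+1) = i :: rev (iota 0 i).
Proof. by rewrite -addn1 iotaD rev_cat /= add0n. Qed.

Lemma opens_open f n i : nc f n -> i < n -> i < f i -> opens f i.+1 = i :: opens f i.
Proof.
move=> ncf hi op; rewrite /opens rev_iotaS /= op; congr cons.
apply: eq_in_filter => j; rewrite mem_rev mem_iota add0n /= => hj.
rewrite ltn_neqAle; case: eqP => // e; move: op; rewrite e.
by rewrite (nc_inv ncf) //; lia.
Qed.

Lemma opens_close f n i : nc f n -> i < n -> f i < i -> opens f i = f i :: opens f i.+1.
Proof.
move=> ncf hi cl; set q := f i.
have fq : f q = i by apply: (nc_inv ncf).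
have split_iota : rev (iota 0 i) = rev (iota q.+1 (i - q.+1)) ++ q :: rev (iota 0 q).
  have {1}-> : i = q + (1 + (i - q.+1)) by lia.
  by rewrite iotaD rev_cat iotaD rev_cat -catA /= add0n addn1.
have part1 h : i <= h -> [seq j <- rev (iota q.+1 (i - q.+1)) | h <= f j] = [::].
  move=> hh; rewrite (eq_in_filter (a2 := pred0)) ?filter_pred0 // => j.
  rewrite mem_rev mem_iota => hj; apply/negbTE/negP => hf.
  have ne : f j <> i by move=> e; have := nc_inv ncf (i := j); rewrite e -/q; lia.
  by apply: (@nc_cross _ _ ncf q j); rewrite ?fq; lia.
rewrite /opens rev_iotaS /= -/q ltnNge (ltnW cl) /= split_iota !filter_cat !part1 //= fq leqnn ltnn; congr cons.
apply: eq_in_filter => j; rewrite mem_rev mem_iota add0n /= => hj.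
rewrite leq_eqVlt; case: eqP => // e; have := nc_inv ncf (i := j).
by rewrite -e -/q; lia.
Qed.

Lemma drop_wd f n i : i < n -> drop i (wd f n) = (i < f i) :: drop i.+1 (wd f n).
Proof.
by move=> hi; rewrite (drop_nth false) ?size_mkseq // nth_mkseq.
Qed.

Lemma opens_end f n : nc f n -> opens f n = [::].
Proof.
move=> ncf; rewrite /opens (eq_in_filter (a2 := pred0)) ?filter_pred0 // => j.
by rewrite mem_rev mem_iota add0n => hj; rewrite leqNgt (nc_lt ncf).
Qed.

Lemma dyck_wd f n : nc f n -> dyck (wd f n).
Proof.
move=> ncf; suff H d i : n - i = d -> i <= n -> dy (size (opens f i)) (drop i (wd f n)).
  by have := H _ 0 (erefl _) (leq0n n); rewrite drop0.
elim: d i => [|d IH] i e hi.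
  have -> : i = n by lia.
  by rewrite (opens_end ncf) drop_oversize // size_mkseq.
have hin : i < n by lia.
rewrite drop_wd //; have := IH i.+1; case: (ltngtP i (f i)) => c H /=.
- by have := H _ _; rewrite (opens_open ncf) //; apply; lia.
- by rewrite (opens_close ncf) //=; apply: H; lia.
- by case: (nc_neq ncf hin).
Qed.

Lemma nth_wd f g n i : wd f n = wd g n -> i < n -> (i < f i) = (i < g i).
Proof. by move=> e hi; have := congr1 (nth false ^~ i) e; rewrite !nth_mkseq. Qed.

Lemma wd_opens f g n i : nc f n -> nc g n -> wd f n = wd g n -> i <= n -> opens f i = opens g i.
Proof.
move=> ncf ncg e; elim: i => [//|i IH] hi; have {}IH := IH (ltnW hi).
have l := nth_wd e hi.
have [op|cl] := boolP (i < f i).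
  by rewrite (opens_open ncf) // (opens_open ncg) -?l // IH.
have clf : f i < i by have := nc_neq ncf hi; lia.
have clg : g i < i by have := nc_neq ncg hi; rewrite l in cl; lia.
by move: IH; rewrite (opens_close ncf) // (opens_close ncg) // => -[].
Qed.

(** Equal words have equal bracket stacks, whose heads are the partners of the closing points;
    opening points follow by involutivity. *)
Lemma wd_inj f g n : nc f n -> nc g n -> wd f n = wd g n -> forall i, i < n -> f i = g i.
Proof.
move=> ncf ncg e.
have close i : i < n -> f i < i -> f i = g i.
  move=> hi clf; have := wd_opens ncf ncg e (ltnW hi); have l := nth_wd e hi.
  have clg : g i < i by have := nc_neq ncg hi; lia.
  by rewrite (opens_close ncf) // (opens_close ncg) // => -[].
move=> i hi; case: (ltngtP (f i) i) => c; [exact: close| |by case: (nc_neq ncf hi)].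
have := close (f i) (nc_lt ncf hi); rewrite (nc_inv ncf) // => /(_ c) e2.
by rewrite {2}e2 (nc_inv ncg) // (nc_lt ncf).
Qed.

Lemma wd_ex w : dyck w -> exists f, nc f (size w) /\ wd f (size w) = w.
Proof.
move: w; apply: dyck_ind => [|u v du dv [fu [ncu eu]] [fv [ncv ev]]].
  by exists id.
set n := size u; set m := size v.
(* The outer edge joins 0 and [n.+1]; [u] is shifted by 1 and [v] by [n.+2]. *)
pose f i := if i == 0 then n.+1 else if i <= n then (fu i.-1).+1 else
  if i == n.+1 then 0 else fv (i - n.+2) + n.+2.
have hu i : i < n -> [/\ fu i < n, fu i <> i & fu (fu i) = i].
  by move=> h; split; [exact: nc_lt ncu _ h|exact: nc_neq ncu _ h|exact: nc_inv ncu _ h].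
have hv i : i < m -> [/\ fv i < m, fv i <> i & fv (fv i) = i].
  by move=> h; split; [exact: nc_lt ncv _ h|exact: nc_neq ncv _ h|exact: nc_inv ncv _ h].
have sz : size (true :: u ++ false :: v) = n + m + 2 by rewrite /= size_cat /= -/n -/m; lia.
have f0 : f 0 = n.+1 by [].
have fin i : i < n -> f i.+1 = (fu i).+1 by move=> h; rewrite /f /= h.
have fn : f n.+1 = 0 by rewrite /f /= ltnn eqxx.
have fout i : f (i + n.+2) = fv i + n.+2.
  rewrite /f addnK; have -> : (i + n.+2 == 0) = false by lia.
  have -> : (i + n.+2 <= n) = false by lia.
  by have -> : (i + n.+2 == n.+1) = false by lia.
have cases i : i < n + m + 2 -> [\/ i = 0, (exists2 j, j < n & i = j.+1), i = n.+1 |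
    (exists2 j, j < m & i = j + n.+2)].
  move=> hi; case: (posnP i) => [->|i0]; first exact: Or41.
  case: (leqP i n) => h1; first by apply: Or42; exists i.-1; lia.
  case: (eqVneq i n.+1) => h2; first exact: Or43.
  by apply: Or44; exists (i - n.+2); lia.
exists f; rewrite sz; split; first split.
- move=> i /cases [->|[j h ->]|->|[j h ->]]; rewrite ?f0 ?fn ?fin ?fout //; try lia.
  + by have [] := hu j h; lia.
  + by have [] := hv j h; lia.
- move=> i /cases [->|[j h ->]|->|[j h ->]]; rewrite ?f0 ?fn ?fin ?fout //; try lia.
  + by have [] := hu j h; lia.
  + by have [] := hv j h; lia.
- move=> i /cases [->|[j h ->]|->|[j h ->]]; rewrite ?f0 ?fn ?fout //.
  + by have [h1 _ h2] := hu j h; rewrite !fin // h2.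
  + by have [h1 _ h2] := hv j h; rewrite h2.
- move=> i j hj hij; have hi : i < n + m + 2 by lia.
  move: hi hj hij => /cases [->|[i' h ->]|->|[i' h ->]] /cases [->|[j' h' ->]|->|[j' h' ->]];
   rewrite ?f0 ?fn ?fin ?fout //; try lia.
  + by have [] := hu j' h'; lia.
  + by move=> a b c; apply: (nc_cross ncu h' (i := i')); lia.
  + by have [] := hu i' h; lia.
  + by move=> a b c; apply: (nc_cross ncv h' (i := i')); lia.
apply: (@eq_from_nth _ false); rewrite size_mkseq ?sz // => i hi.
rewrite nth_mkseq //; move: hi => /cases [->|[j h ->]|->|[j h ->]].
- by rewrite f0.
- by rewrite fin // /= nth_cat h -eu nth_mkseq.
- by rewrite fn /= nth_cat ltnn subnn.
rewrite fout [nth _ _ _]/= -[j + n.+2]/(j + (n.+1).+1) addnS /= nth_cat ifF; last lia.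
have -> : j + n.+1 - n = j.+1 by lia.
by rewrite /= -ev nth_mkseq //; lia.
Qed.

(** * The automaton recognises exactly the compatible pairs *)

Definition compat (f g : nat -> nat) n :=
  [/\ forall i, i < n -> f i <> g i,
      forall i j, i < n -> j < n -> i < j -> j < f i -> f i < g j -> False &
      forall i j, i < n -> j < n -> i < j -> j < g i -> g i < f j -> False].

(* A state annotated with the first and the last vertex of its polygon read so far. *)
Notation astate := (state * (nat * nat))%type.

(** The last vertex precedes the first one, so that concatenation over the stack gives the points of
    [opens f i] in the same order. *)
Definition mop (a : astate) : seq nat :=
  let: (q, (p, l)) := a in
  if q is Some (c, d) then (if d then [:: l] else [::]) ++ (if c then [:: p] else [::]) else [:: p].
Definition nop (a : astate) : seq nat :=
  let: (q, (p, l)) := a in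
  if q is Some (c, d) then (if d then [::] else [:: l]) ++ (if c then [::] else [:: p]) else [:: p].
Definition mops (s : seq astate) := flatten (map mop s).
Definition nops (s : seq astate) := flatten (map nop s).

(** The polygon below must have its last vertex before the first vertex of the one above; only in
    state [None] may first and last vertex coincide. *)
Fixpoint wfa (ub : nat) (s : seq astate) : bool :=
  if s is (q, (p, l)) :: s' then [&& p <= l, l < ub, (q == None) || (p < l) & wfa p s'] else true.

Lemma wfaW ub ub' s : ub <= ub' -> wfa ub s -> wfa ub' s.
Proof. by case: s => //= -[q [p l]] s h /and4P[-> hl -> ->]; rewrite (leq_trans hl). Qed.

Lemma wfa_all ub s : wfa ub s -> all (fun j => j < ub) (mops s) && all (fun j => j < ub) (nops s).
Proof.
elim: s ub => //= -[q [p l]] s IH ub /and4P[h1 h2 _ /IH /andP[hm hn]].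
have W z : all (fun j => j < p) z -> all (fun j => j < ub) z.
  by apply: sub_all => j hj; apply: leq_trans hj _; lia.
rewrite /mops /nops /= !all_cat -!/(mops _) -!/(nops _) (W _ hm) (W _ hn) !andbT.
by case: q => [[[] []]|] /=; rewrite ?andbT; lia.
Qed.

Lemma wfa_mop ub s j : wfa ub s -> j \in mops s -> j < ub.
Proof. by move=> /wfa_all /andP[/allP h _] /h. Qed.
Lemma wfa_nop ub s j : wfa ub s -> j \in nops s -> j < ub.
Proof. by move=> /wfa_all /andP[_ /allP h] /h. Qed.

Definition states (s : seq astate) : stack := map fst s.

Definition inv f g i (s : seq astate) := [/\ mops s = opens f i, nops s = opens g i & wfa i s].

(* What the automaton certifies when it reads point [i]. *)
Definition safe f g i :=
  [/\ f i < i -> f i <> g i,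
     f i < i -> forall j, f i < j -> j < i -> i < g j -> False &
     g i < i -> forall j, g i < j -> j < i -> i < f j -> False].

Definition aneg (a : astate) : astate := (neg_state a.1, a.2).

Lemma mops_neg s : mops (map aneg s) = nops s.
Proof. by elim: s => // -[[[[] []]|] [p l]] s; rewrite /mops /nops /= => ->. Qed.

Lemma nops_neg s : nops (map aneg s) = mops s.
Proof. by elim: s => // -[[[[] []]|] [p l]] s; rewrite /mops /nops /= => ->. Qed.

Lemma wfa_neg i s : wfa i (map aneg s) = wfa i s.
Proof. by elim: s i => // -[[[[] []]|] [p l]] s IH i /=; rewrite IH. Qed.

Lemma states_neg s : states (map aneg s) = map neg_state (states s).
Proof. by elim: s => //= a s ->. Qed.

Lemma inv_neg f g i s : inv f g i s -> inv g f i (map aneg s).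
Proof. by case=> em en wf; split; rewrite ?mops_neg ?nops_neg ?wfa_neg. Qed.

Lemma safe_sym f g i : safe f g i -> safe g f i.
Proof. by case=> h1 h2 h3; split=> // hg e; case: (ltnP (f i) i) => c; [exact: h1 c (esym e)|lia]. Qed.

Lemma compat_sym f g n : compat f g n -> compat g f n.
Proof. by case=> h1 h2 h3; split=> // i hi e; exact: (h1 i hi (esym e)). Qed.

Definition step_ok f g n i s :=
  (compat f g n -> step (i < f i, i < g i) (states s) <> None) /\
  (forall s', step (i < f i, i < g i) (states s) = Some s' ->
     safe f g i /\ exists2 a, states a = s' & inv f g i.+1 a).

Lemma step_ok_neg f g n i s : step_ok g f n i (map aneg s) -> step_ok f g n i s.
Proof.
have e := step_swap (i < f i, i < g i) (states s).
rewrite /swap /= -states_neg in e.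
case=> h1 h2; split.
  move=> /compat_sym/h1; rewrite e; by case: (step _ (states s)).
move=> s' es; rewrite es /= in e; have [/safe_sym sf [a ea ia]] := h2 _ e.
split=> //; exists (map aneg a); last exact: inv_neg.
by rewrite states_neg ea -map_comp -[RHS]map_id; apply: eq_map => -[[[] []]|].
Qed.

(** The closing right edge has to end at the last vertex [l] of the top polygon. If a left edge is
    pending at [l], the right edge comes from further back, and the left edge of [l], which ends
    after [i], crosses it. *)
Lemma step_open_close f g n i s : nc f n -> nc g n -> i < n -> inv f g i s ->
  i < f i -> g i < i -> step_ok f g n i s.
Proof.
move=> ncf ncg hi [em en wf] f1 g1.
have of_ := opens_open ncf hi f1; have cg := opens_close ncg hi g1.
have gg : g (g i) = i by apply: nc_inv ncg _ hi.
have memM j : j \in mops s -> j < i /\ i <= f j by rewrite em mem_opens => /andP.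
have inM j : j < i -> i < f j -> j \in mops s.
  by move=> h1 h2; rewrite em mem_opens h1 ltnW.
have g0 : (i < g i) = false by lia.
rewrite /step_ok f1 g0; case: s em en wf memM inM => [|[[[c d]|] [p l]] s] em en wf memM inM.
- by move: en; rewrite cg.
- case/and4P: wf => h1 h2 h3; rewrite -/(wfa p s) => h4; rewrite /= in h3.
  case: d em en h3 memM inM => em en h3 memM inM; rewrite /step /=.
    split=> // -[_ _ H]; exfalso.
    have [|hl hfl] := memM l; first by rewrite /mops /= inE eqxx.
    have hq : g i \in (if c then [::] else [:: p]) ++ nops s.
      by have : g i \in nops ((Some (c, true), (p, l)) :: s) by rewrite en cg mem_head.
    have hqp : g i <= p.
      move: hq; rewrite mem_cat => /orP[|/(wfa_nop h4)/ltnW //].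
      by case: (c); rewrite ?inE // => /eqP->.
    have nfl : f l <> i.
      by move=> e; have := nc_inv ncf (i := l); rewrite e; lia.
    by apply: (H (g i) l); rewrite ?gg; lia.
  split=> // _ [<-]; move: en; rewrite cg /nops /= => -[el en]; split.
    split; [lia|lia|] => _ j hj1 hj2 hj3.
    have := inM j hj2 hj3; rewrite /mops /= mem_cat => /orP[|/(wfa_mop h4)]; last lia.
    by case: (c); rewrite ?inE // => /eqP; lia.
  exists ((Some (c, true), (p, i)) :: s) => //; split.
  + by rewrite of_ -em.
  + by rewrite -en /nops /=; case: (c).
  + by rewrite /= h4; lia.
case/and4P: wf => h1 h2 _; rewrite -/(wfa p s) => h4; rewrite /step /=; split=> // _ [<-].
move: en; rewrite cg /nops /= => -[el en]; split.
  split; [lia|lia|] => _ j hj1 hj2 hj3.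
  by have := inM j hj2 hj3; rewrite /mops /= inE => /orP[/eqP|/(wfa_mop h4)]; lia.
exists ((Some (true, true), (p, i)) :: s) => //; split.
- by rewrite of_ -em.
- by rewrite -en /nops.
- by rewrite /= h4; lia.
Qed.

(** If both pending edges of the top polygon belong to one matching, the other matching closes an
    edge from below the polygon, and this crosses the pending edge of its first vertex. In state
    [None] both matchings would close the same edge. *)
Lemma step_close f g n i s : nc f n -> nc g n -> i < n -> inv f g i s ->
  f i < i -> g i < i -> step_ok f g n i s.
Proof.
move=> ncf ncg hi [em en wf] f1 g1.
have cf := opens_close ncf hi f1; have cg := opens_close ncg hi g1.
have ff : f (f i) = i by apply: nc_inv ncf _ hi.
have gg : g (g i) = i by apply: nc_inv ncg _ hi.
have f0 : (i < f i) = false by lia.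
have g0 : (i < g i) = false by lia.
have memM j : j \in mops s -> j < i /\ i <= f j by rewrite em mem_opens => /andP.
have memN j : j \in nops s -> j < i /\ i <= g j by rewrite en mem_opens => /andP.
have inM j : j < i -> i < f j -> j \in mops s.
  by move=> h1 h2; rewrite em mem_opens h1 ltnW.
have inN j : j < i -> i < g j -> j \in nops s.
  by move=> h1 h2; rewrite en mem_opens h1 ltnW.
have nf j : j < i -> f j = i -> f i = j.
  by move=> h <-; apply: nc_inv ncf _ _; lia.
have ng j : j < i -> g j = i -> g i = j.
  by move=> h <-; apply: nc_inv ncg _ _; lia.
rewrite /step_ok f0 g0; case: s em en wf memM memN inM inN => [|[[[c d]|] [p l]] s] em en wf memM memN inM inN.
- by move: en; rewrite cg.
- case/and4P: wf => h1 h2 h3; rewrite -/(wfa p s) => h4; rewrite /= in h3; rewrite /step /=.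
  case: c d em en memM memN inM inN => [] [] em en memM memN inM inN /=.
  + split=> // -[_ _ H]; exfalso.
    move: em; rewrite cf /mops /= => -[el _].
    have [|hp hfp] := memM p; first by rewrite /mops /= !inE eqxx orbT.
    have hq : g i < p by apply: (wfa_nop h4); have : g i \in nops ((Some (true, true), (p, l)) :: s) by rewrite en cg mem_head.
    have nfp : f p <> i by move/(nf _ hp); lia.
    by apply: (H (g i) p); rewrite ?gg; lia.
  + split=> // _ [<-].
    move: em en; rewrite cf cg /mops /nops /= => -[ep em] [el en]; split.
      split=> _; first lia.
        move=> j hj1 hj2 hj3; have := inN j hj2 hj3; rewrite /nops /= inE => /orP[/eqP ej|/(wfa_nop h4)]; last lia.
        by move: hj3; rewrite ej el gg; lia.
      move=> j hj1 hj2 hj3; have := inM j hj2 hj3; rewrite /mops /= inE => /orP[/eqP ej|/(wfa_mop h4)]; lia.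
    by exists s => //; split=> //; apply: wfaW h4; lia.
  + split=> // _ [<-].
    move: em en; rewrite cf cg /mops /nops /= => -[ep em] [el en]; split.
      split=> _; first lia.
        move=> j hj1 hj2 hj3; have := inN j hj2 hj3; rewrite /nops /= inE => /orP[/eqP ej|/(wfa_nop h4)]; lia.
      move=> j hj1 hj2 hj3; have := inM j hj2 hj3; rewrite /mops /= inE => /orP[/eqP ej|/(wfa_mop h4)]; last lia.
      by move: hj3; rewrite ej ep ff; lia.
    by exists s => //; split=> //; apply: wfaW h4; lia.
  + split=> // -[_ H _]; exfalso.
    move: en; rewrite cg /nops /= => -[el _].
    have [|hp hfp] := memN p; first by rewrite /nops /= !inE eqxx orbT.
    have hq : f i < p by apply: (wfa_mop h4); have : f i \in mops ((Some (false, false), (p, l)) :: s) by rewrite em cf mem_head.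
    have nfp : g p <> i by move/(ng _ hp); lia.
    by apply: (H (f i) p); rewrite ?ff; lia.
rewrite /step /=; split=> // -[H _ _]; exfalso.
by move: em en; rewrite cf cg /mops /nops /= => -[ep _] [el _]; apply: (H i) => //; rewrite -ep.
Qed.

Lemma step_inv f g n i s : nc f n -> nc g n -> i < n -> inv f g i s -> step_ok f g n i s.
Proof.
move=> ncf ncg hi v.
case: (ltngtP i (f i)) => [f1|f1|e]; last by case: (nc_neq ncf hi).
  case: (ltngtP i (g i)) => [g1|g1|e]; last by case: (nc_neq ncg hi).
    case: v => em en wf; rewrite /step_ok f1 g1; split=> // _ [<-].
    split; first by split; lia.
    exists ((None, (i, i)) :: s) => //; split.
    + by rewrite (opens_open ncf) // -em.
    + by rewrite (opens_open ncg) // -en.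
    + by rewrite /= leqnn ltnSn.
  exact: step_open_close.
case: (ltngtP i (g i)) => [g1|g1|e]; last by case: (nc_neq ncg hi).
  by apply: step_ok_neg; apply: step_open_close => //; apply: inv_neg.
exact: step_close.
Qed.

Lemma wd_iota f n : wd f n = [seq i < f i | i <- iota 0 n]. Proof. by []. Qed.

(** Every forbidden configuration is noticed at a closing point: a common edge at its later
    endpoint, a crossing when the first of the two edges closes. Hence safety at all points is
    compatibility. *)
Lemma run_wd f g n : nc f n -> nc g n ->
  run (zip (wd f n) (wd g n)) [::] = Some [::] <-> compat f g n.
Proof.
move=> ncf ncg.
have zipE m d : zip [seq i < f i | i <- iota m d] [seq i < g i | i <- iota m d] =
    [seq (i < f i, i < g i) | i <- iota m d].
  by elim: d m => //= d IH m; rewrite IH.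
rewrite !wd_iota zipE; split.
  have H d : forall m s, m + d = n -> inv f g m s ->
     run [seq (i < f i, i < g i) | i <- iota m d] (states s) = Some [::] ->
     forall i, m <= i -> i < n -> safe f g i.
    elim: d => [|d IH] m s e v /=; first by move=> _ i; lia.
    have hm : m < n by lia.
    have [_ ok] := step_inv ncf ncg hm v.
    case E: (step _ _) => [s'|] //= R; have [sf [a ea ia]] := ok _ E.
    move=> i; rewrite leq_eqVlt => /orP[/eqP<- //|him] hin.
    by apply: (IH m.+1 a) => //; [lia|rewrite ea].
  have v0 : inv f g 0 [::] by [].
  move=> R; have S i : i < n -> safe f g i by move=> hi; apply: (H n 0 [::]).
  split.
  - move=> i hi e; have [c|c] := ltnP (f i) i.
      by have [h _ _] := S i hi; exact: h c e.
    have hf := nc_lt ncf hi; have [h _ _] := S _ hf.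
    apply: h; first by rewrite (nc_inv ncf) //; have := nc_neq ncf hi; lia.
    by rewrite (nc_inv ncf) // e (nc_inv ncg).
  - move=> i j hi hj h1 h2 h3; have hf := nc_lt ncf hi.
    have [_ h _] := S _ hf; apply: (h _ j) => //; rewrite (nc_inv ncf) //; lia.
  - move=> i j hi hj h1 h2 h3; have hf := nc_lt ncg hi.
    have [_ _ h] := S _ hf; apply: (h _ j) => //; rewrite (nc_inv ncg) //; lia.
move=> cp.
have H d : forall m s, m + d = n -> inv f g m s ->
     run [seq (i < f i, i < g i) | i <- iota m d] (states s) = Some [::].
  elim: d => [|d IH] m s e v /=.
    move: v; rewrite addn0 in e; rewrite e => -[em en _].
    rewrite (opens_end ncf) in em; rewrite (opens_end ncg) in en.
    by case: s em en => // -[[[[] []]|] [p l]] s.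
  have hm : m < n by lia.
  have [h ok] := step_inv ncf ncg hm v.
  case E: (step _ _) => [s'|] /=; last by case: (h cp).
  by have [_ [a <- ia]] := ok _ E; apply: IH => //; lia.
exact: (H n 0 [::]).
Qed.

Lemma adj_wd f g n : nc f n -> nc g n -> adj (wd f n) (wd g n) <-> compat f g n.
Proof.
move=> ncf ncg; rewrite -run_wd // /adj !size_mkseq eqxx /=.
by split=> [/eqP|->].
Qed.

(** * Translation between sets of edges and words *)

Lemma card_set2_if (T : finType) (P : pred T) (c d : T) : c != d ->
  #|[set z in [set c; d] | P z]| = P c + P d.
Proof.
move=> ne; have -> : [set z in [set c; d] | P z] = [set z | (z == c) && P c || (z == d) && P d].
  apply/setP => z; rewrite !inE; case: eqP => [->|_]; last by case: eqP => [->|].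
  by rewrite (negbTE ne) /= orbF.
case: (boolP (P c)) => pc; case: (boolP (P d)) => pd.
- have -> : [set z | (z == c) && true || (z == d) && true] = [set c; d].
    by apply/setP => z; rewrite !inE !andbT.
  by rewrite cards2 ne.
- have -> : [set z | (z == c) && true || (z == d) && false] = [set c].
    by apply/setP => z; rewrite !inE andbT andbF orbF.
  by rewrite cards1.
- have -> : [set z | (z == c) && false || (z == d) && true] = [set d].
    by apply/setP => z; rewrite !inE andbT andbF.
  by rewrite cards1.
- have -> : [set z | (z == c) && false || (z == d) && false] = set0.
    by apply/setP => z; rewrite !inE !andbF.
  by rewrite cards0.
Qed.

Lemma crossing2 k (a b c d : point k) : a < b -> c < d ->
  crossing [set a; b] [set c; d] = (a < c) && (c < b) && (b < d) || (c < a) && (a < d) && (d < b).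
Proof.
move=> ab cd; have ncd : c != d by rewrite -val_eqE /=; lia.
have nab : a != b by rewrite -val_eqE /=; lia.
rewrite /crossing; have -> : [exists x in [set a; b], exists y in [set a; b],
    (x < y) && (#|[set z in [set c; d] | (x < z) && (z < y)]| == 1)] =
   (((a < c) && (c < b)) + ((a < d) && (d < b)) == 1).
  apply/existsP/idP => [[x /andP[hx /existsP[y /and3P[hy xy]]]]|h].
    rewrite card_set2_if //; move: hx hy xy; rewrite !inE => /orP[]/eqP-> /orP[]/eqP-> //; lia.
  exists a; rewrite !inE eqxx; apply/existsP; exists b.
  by rewrite !inE eqxx orbT ab card_set2_if.
have -> : [disjoint [set a; b] & [set c; d]] = [&& a != c, a != d, b != c & b != d].
  rewrite disjoints_subset subUset !sub1set !inE !negb_or.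
  by rewrite -!andbA.
rewrite -!val_eqE /=; move: (val a) (val b) (val c) (val d) ab cd {ncd nab} => x y z t; lia.
Qed.

Section Partner.
Variables (k : nat) (M : {set {set point k}}).
Hypothesis hM : is_matching M.

Let h2 e : e \in M -> #|e| = 2.
Proof. by case/andP: hM => /andP[/forall_inP h _ _] /h /eqP. Qed.

Let h1 x : #|[set e in M | x \in e]| = 1.
Proof. by case/andP: hM => /andP[_ /forallP h] _; apply/eqP. Qed.

Lemma edge_eq e e' x : e \in M -> e' \in M -> x \in e -> x \in e' -> e = e'.
Proof.
move=> he he' hx hx'; have /eqP/cards1P[e0 h] := h1 x.
have : e \in [set e0] by rewrite -h inE he.
have : e' \in [set e0] by rewrite -h inE he'.
by rewrite !inE => /eqP-> /eqP->.
Qed.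

Definition partner x : point k := odflt x [pick y | (y != x) && ([set x; y] \in M)].

Lemma partnerP x : partner x != x /\ [set x; partner x] \in M.
Proof.
rewrite /partner; case: pickP => [y /andP[]//|no].
have /eqP/cards1P[e h] := h1 x.
have /setP/(_ e) := h; rewrite !inE eqxx => /andP[he hx]; have /eqP/cards2P[a [b [nab eab]]] := h2 he.
move: he hx; rewrite eab !inE => he /orP[]/eqP ex.
  by have := no b; rewrite ex he eq_sym nab.
by have := no a; rewrite ex setUC he nab.
Qed.

Lemma edge_partner x e : e \in M -> x \in e -> e = [set x; partner x].
Proof.
move=> he hx; have [_ hp] := partnerP x.
by apply: edge_eq he hp hx _; rewrite !inE eqxx.
Qed.

Lemma partnerK x : partner (partner x) = x.
Proof.
have [n1 m1] := partnerP x; have [n2 m2] := partnerP (partner x).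
have e : [set partner x; partner (partner x)] = [set x; partner x].
  by apply: (edge_eq (x := partner x) m2 m1); rewrite !inE eqxx ?orbT.
have : partner (partner x) \in [set x; partner x] by rewrite -e !inE eqxx orbT.
by rewrite !inE (negbTE n2) orbF => /eqP.
Qed.

Lemma mem_edges x y : x != y -> ([set x; y] \in M) = (partner x == y).
Proof.
move=> nxy; apply/idP/eqP => [h|<-]; last by case: (partnerP x).
have e := edge_partner h (setU11 x [set y]).
have : y \in [set x; partner x] by rewrite -e !inE eqxx orbT.
by rewrite !inE eq_sym (negbTE nxy) => /eqP.
Qed.

Definition mate i : nat := oapp (fun x => val (partner x)) i (insub i).

Lemma mateE (x : point k) : mate x = partner x.
Proof. by rewrite /mate valK. Qed.

Lemma mate_nc : nc mate (2 * k).
Proof.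
split.
- by move=> i hi; have := mateE (Ordinal hi) => /= ->.
- move=> i hi; have := mateE (Ordinal hi) => /= -> e.
  by have [/eqP] := partnerP (Ordinal hi); case; apply: val_inj.
- by move=> i hi; have := mateE (Ordinal hi) => /= ->; rewrite mateE partnerK.
move=> i j hj hij; have hi := ltn_trans hij hj.
have := mateE (Ordinal hi) => /= ->; have := mateE (Ordinal hj) => /= ->.
set x := Ordinal hi; set y := Ordinal hj => h3 h4.
case/andP: hM => _ /forall_inP /(_ _ (partnerP x).2) /forall_inP /(_ _ (partnerP y).2).
by rewrite crossing2 /= ?hij ?h3 ?h4 //; lia.
Qed.
End Partner.

Lemma compat_dcm k (M N : matching k) :
  compat (mate (val M)) (mate (val N)) (2 * k) <-> dcm M N.
Proof.
have hM := valP M; have hN := valP N; set P := val M; set Q := val N.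
have cM := mate_nc hM; have cN := mate_nc hN; rewrite -/P -/Q in hM hN cM cN.
have edges (R : {set {set point k}}) (hR : is_matching R) e : e \in R ->
    exists x : point k, e = [set x; partner R x] /\ x < partner R x.
  move=> he; have /eqP/cards2P[a [b [nab eab]]] : #|e| = 2.
    by case/andP: hR => /andP[/forall_inP /(_ _ he) /eqP].
  have ea : partner R a = b by apply/eqP; rewrite -(mem_edges hR) // -eab.
  have eb : partner R b = a by rewrite -ea partnerK.
  case: (ltngtP a b) => h; [by exists a; rewrite ea|by exists b; rewrite eb setUC|].
  by case/eqP: nab; apply: val_inj.
split=> [[d1 d2 d3]|/andP[dis /forall_inP hnc]].
  apply/andP; split.
    rewrite disjoints_subset; apply/subsetP => e he; rewrite inE; apply/negP => he'.
    have [x [ex hx]] := edges _ hM _ he.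
    apply: (d1 x (ltn_ord x)); rewrite !mateE; congr val; apply/eqP.
    rewrite eq_sym -(mem_edges hN) -?ex //.
    by have [+ _] := partnerP hM x; rewrite eq_sym.
  apply/forall_inP => e he; apply/forall_inP => f hf.
  have [x [-> hx]] := edges _ hM _ he; have [y [-> hy]] := edges _ hN _ hf.
  rewrite crossing2 //; apply/negP => /orP[/andP[/andP[a1 a2] a3]|/andP[/andP[a1 a2] a3]].
    by apply: (d2 x y) => //; rewrite !mateE.
  by apply: (d3 y x) => //; rewrite !mateE.
have cr (x y : point k) : x < partner P x -> y < partner Q y ->
    ~~ crossing [set x; partner P x] [set y; partner Q y].
  move=> _ _; have [_ h1] := partnerP hM x; have [_ h2] := partnerP hN y.
  by have /forall_inP   := hnc _ h1; apply.
split.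
- move=> i hi; have := mateE P (Ordinal hi) => /= ->; have := mateE Q (Ordinal hi) => /= -> e.
  have e' : partner P (Ordinal hi) = partner Q (Ordinal hi) by apply: val_inj.
  have [_ h1] := partnerP hM (Ordinal hi); have [_ h2] := partnerP hN (Ordinal hi).
  by rewrite e' in h1; have /disjointFr /(_ h1) := dis; rewrite h2.
- move=> i j hi hj; have := mateE P (Ordinal hi) => /= ->; have := mateE Q (Ordinal hj) => /= -> a b c.
  by have := cr (Ordinal hi) (Ordinal hj); rewrite !crossing2 /= ?a ?b ?c //; lia.
- move=> i j hi hj; have := mateE P (Ordinal hj) => /= ->; have := mateE Q (Ordinal hi) => /= -> a b c.
  by have := cr (Ordinal hj) (Ordinal hi); rewrite !crossing2 /= ?a ?b ?c //; lia.
Qed.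

Definition word_of k (M : matching k) : word := wd (mate (val M)) (2 * k).

Lemma size_word_of k (M : matching k) : size (word_of M) = 2 * k.
Proof. by rewrite size_mkseq. Qed.

Lemma dyck_word_of k (M : matching k) : dyck (word_of M).
Proof. exact/dyck_wd/mate_nc/(valP M). Qed.

Lemma adj_word_of k (M N : matching k) : adj (word_of M) (word_of N) = dcm M N.
Proof.
apply/idP/idP => [/adj_wd|h]; first by move/(_ (mate_nc (valP M)) (mate_nc (valP N)))/compat_dcm.
by apply/(adj_wd (mate_nc (valP M)) (mate_nc (valP N)))/compat_dcm.
Qed.

Lemma word_of_inj k : injective (@word_of k).
Proof.
move=> M N e; apply: val_inj; have hM := valP M; have hN := valP N.
have ep (x : point k) : partner (val M) x = partner (val N) x.
  apply: val_inj; rewrite /= -!mateE.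
  exact: (wd_inj (mate_nc hM) (mate_nc hN) e (ltn_ord x)).
have sub (P Q : matching k) : (forall x, partner (val P) x = partner (val Q) x) -> val P \subset val Q.
  move=> eP; apply/subsetP => e0 he; have hP := valP P.
  have /eqP/cards2P[a [b [nab eab]]] : #|e0| = 2.
    by case/andP: hP => /andP[/forall_inP /(_ _ he) /eqP].
  rewrite eab (mem_edges (valP Q)) // -eP -(mem_edges hP) // -eab //.
by apply/eqP; rewrite eqEsubset !sub // => x; rewrite ep.
Qed.

Lemma nc_matching k f : nc f (2 * k) -> exists M : matching k, forall x : point k, mate (val M) x = f x.
Proof.
move=> ncf; pose fo (x : point k) : point k := Ordinal (nc_lt ncf (ltn_ord x)).
have fx x : fo x != x by rewrite -val_eqE; apply/eqP/(nc_neq ncf).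
have ff x : fo (fo x) = x by apply: val_inj; exact: (nc_inv ncf (ltn_ord x)).
pose S := [set [set x; fo x] | x : point k].
have inS x : [set x; fo x] \in S by apply: imset_f.
have Sx x e : e \in S -> x \in e -> e = [set x; fo x].
  case/imsetP=> y _ ->; rewrite !inE => /orP[]/eqP-> //.
  by rewrite ff setUC.
have hS : is_matching S.
  apply/andP; split; first (apply/andP; split).
  - by apply/forall_inP => e /imsetP[x _ ->]; rewrite cards2 [x == _]eq_sym fx.
  - apply/forallP => x; apply/cards1P; exists [set x; fo x]; apply/setP => e; rewrite !inE.
    apply/andP/eqP => [[he hx]|->]; first exact: Sx.
    by rewrite inS !inE eqxx.
  have lt e : e \in S -> exists x, e = [set x; fo x] /\ x < fo x.
    case/imsetP=> x _ ->; case: (ltngtP x (fo x)) => h; first by exists x.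
      by exists (fo x); rewrite ff setUC.
    by case/eqP: (fx x); apply/esym/val_inj.
  apply/forall_inP => e /lt [x [-> hx]]; apply/forall_inP => e' /lt [y [-> hy]].
  rewrite crossing2 //; apply/negP => /orP[/andP[/andP[a b] c]|/andP[/andP[a b] c]].
    exact: (nc_cross ncf (ltn_ord y) a b c).
  exact: (nc_cross ncf (ltn_ord x) a b c).
exists (exist _ S hS) => x; rewrite mateE /=.
have [n1 h1] := partnerP hS x.
have := Sx x _ h1 (setU11 _ _) => e.
have : partner S x \in [set x; fo x] by rewrite -e !inE eqxx orbT.
by rewrite !inE (negbTE n1) => /eqP ->.
Qed.

Lemma word_of_surj k w : dyck w -> size w = 2 * k -> exists M : matching k, word_of M = w.
Proof.
move=> dw sz; have [f [ncf ef]] := wd_ex dw; rewrite sz in ncf ef.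
have [M hM] := nc_matching ncf; exists M; rewrite -ef.
apply: (@eq_from_nth _ false); rewrite !size_mkseq // => i hi.
by rewrite !nth_mkseq //; have := hM (Ordinal hi) => /= ->.
Qed.

(** * Components as lists of words *)

(** On two equal words every state on the stack is [None], and in this state a common closing
    bracket is rejected. *)
Lemma adj_irr w : adj w w -> w = [::].
Proof.
move=> a; have dw := adj_dyck a; case/andP: a => _ /eqP R.
have H s r : all (pred1 None) s -> run (zip w w) s = Some r -> all id w.
  elim: w s {dw R} => //= -[] w IH s hs /=; rewrite /step /=.
    by apply: IH.
  by case: s hs => //= q s /andP[/eqP->].
have {H} := H [::] _ isT R; case: w dw {R} => //= -[] // w.
suff H h : dy h.+1 w -> all id w = false by move=> /H ->.
by elim: w h => //= -[] w IH h //= /IH.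
Qed.

Lemma connect_conn k (M N : matching k) :
  connect (@dcm k) M N <-> conn (word_of M) (word_of N).
Proof.
split=> [/connectP[p]|].
  elim: p M => [|P p IH] M /=; first by move=> _ ->; apply: conn_refl.
  case/andP=> h hp e; apply: conn_trans (IH _ hp e).
  by apply: conn1; rewrite adj_word_of.
move: (erefl (word_of N)); move: {2 3}(word_of N) => v e c.
elim: c N e => [|x y c IH a] N e; first by rewrite (word_of_inj e).
have dx : dyck x by apply: adj_dyck a.
have sx : size x = 2 * k by rewrite -(conn_size c) size_word_of.
have [P eP] := word_of_surj dx sx.
apply: connect_trans (IH P eP) _; apply: connect1.
by rewrite -adj_word_of eP e.
Qed.

(** The last two conditions say that the words of a nonempty list form exactly one component. *)
Definition closed_list k (L : seq word) :=
  [/\ uniq L, {in L, forall x, dyck x /\ size x = 2 * k},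
      {in L, forall x V, adj x V -> V \in L} & {in L &, forall x y, conn x y}].

Lemma component_list k L (M : matching k) x : closed_list k L -> x \in L -> conn (word_of M) x ->
  component M = [set N | word_of N \in L].
Proof.
case=> _ _ cl co hx c; have hc y z : conn y z -> y \in L -> z \in L.
  by elim=> // u v _ IH a hy; apply: cl (IH hy) _ a.
apply/setP => N; rewrite !inE; apply/idP/idP => [/connect_conn cN|hN].
  by apply: hc (hc _ _ (conn_sym c) hx); exact: cN.
by apply/connect_conn/(conn_trans c)/co.
Qed.

Lemma card_list k L : uniq L -> {in L, forall x, dyck x /\ size x = 2 * k} ->
  #|[set N : matching k | word_of N \in L]| = size L.
Proof.
move=> uL dL; rewrite cardE -(size_map (@word_of k)); apply/perm_size/uniq_perm => //.
  by rewrite (map_inj_uniq (@word_of_inj k)) enum_uniq.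
move=> x; apply/mapP/idP => [[N + ->]|hx]; first by rewrite mem_enum inE.
have [dx sx] := dL x hx; have [N eN] := word_of_surj dx sx.
by exists N; rewrite // mem_enum inE eN.
Qed.

(** Adjacency in terms of positions: lists of equal length with the same [R] are isomorphic by
    matching positions. *)
Definition graph_of (L : seq word) (R : nat -> nat -> bool) :=
  forall i j, i < size L -> j < size L -> adj (nth [::] L i) (nth [::] L j) = R i j.

Lemma iso_lists k L1 L2 R : closed_list k L1 -> closed_list k L2 -> size L1 = size L2 ->
  graph_of L1 R -> graph_of L2 R ->
  iso_sub [set N : matching k | word_of N \in L1] [set N | word_of N \in L2].
Proof.
move=> [u1 d1 _ _] [u2 d2 _ _] sz g1 g2.
(* The value outside [L1] is immaterial, since [iso_sub] constrains the map only on the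
   component. *)
pose f (M : matching k) := odflt M [pick N | word_of N == nth [::] L2 (index (word_of M) L1)].
have fE M : word_of M \in L1 -> word_of (f M) = nth [::] L2 (index (word_of M) L1).
  move=> hM; rewrite /f; case: pickP => [N /eqP //|no].
  have hi : nth [::] L2 (index (word_of M) L1) \in L2 by rewrite mem_nth // -sz index_mem.
  have [dx sx] := d2 _ hi; have [N eN] := word_of_surj dx sx.
  by have := no N; rewrite eN eqxx.
have lt M : word_of M \in L1 -> index (word_of M) L1 < size L2 by rewrite -sz index_mem.
have inj : {in [set N | word_of N \in L1] &, injective f}.
  move=> M N; rewrite !inE => hM hN e; have := congr1 (@word_of k) e.
  rewrite !fE // => /eqP; rewrite nth_uniq ?lt // => /eqP e'.
  by apply: word_of_inj; rewrite -(nth_index [::] hM) e' nth_index.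
have sub : f @: [set N | word_of N \in L1] \subset [set N | word_of N \in L2].
  by apply/subsetP => _ /imsetP[M hM ->]; rewrite inE in hM; rewrite inE fE // mem_nth ?lt.
exists f; split=> //.
  by apply/eqP; rewrite eqEcard sub card_in_imset // !card_list // sz leqnn.
move=> M N; rewrite !inE => hM hN.
by rewrite -!adj_word_of !fE // g2 ?lt // -g1 ?index_mem // !nth_index.
Qed.

Lemma adj_turn_eq r x y : dyck x -> dyck y -> size x = size y ->
  adj (iter r turn x) (iter r turn y) = adj x y.
Proof.
move=> dx dy0 sz; apply/idP/idP => [/(adj_iter_turn_inv dx)[v a e]|]; last exact: adj_iter_turn.
have -> // : y = v; apply: (iter_turn_inj dy0 (adj_dyckr a)) e.
by rewrite -sz (adj_size a).
Qed.

Lemma closed_turn r k L : closed_list k L -> closed_list k (map (iter r turn) L).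
Proof.
case=> u d c co; split.
- rewrite map_inj_in_uniq // => x y /d [dx sx] /d [dy0 sy] e.
  by apply: (iter_turn_inj dx dy0 _ e); rewrite sx.
- by move=> _ /mapP[x /d [dx sx] ->]; rewrite size_iter_turn; split=> //; apply: dyck_iter_turn.
- move=> _ /mapP[x hx ->] V a; have [dx _] := d x hx.
  have [v av ->] := adj_iter_turn_inv dx a.
  by apply: map_f; apply: c hx _ av.
- by move=> _ _ /mapP[x hx ->] /mapP[y hy ->]; apply/conn_iter_turn/co.
Qed.

Lemma graph_turn r k L R : closed_list k L -> graph_of L R -> graph_of (map (iter r turn) L) R.
Proof.
case=> _ d _ _ g i j; rewrite size_map => hi hj; rewrite !(nth_map [::]) // -g //.
have [di si] := d _ (mem_nth [::] hi); have [dj sj] := d _ (mem_nth [::] hj).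
by apply: adj_turn_eq; rewrite // si.
Qed.

Definition pairL t := [:: cM t; cN t].
Definition starL t := cX t :: starN t.
Definition medL t := LM t ++ LN t.

Lemma conn_star (L : seq word) x0 : {in L, forall x, conn x x0} -> {in L &, forall x y, conn x y}.
Proof. by move=> h x y hx hy; apply: conn_trans (h x hx) (conn_sym (h y hy)). Qed.

Lemma closed_pair (t : seq bool) : t != [::] -> closed_list (2 * size t) (pairL t).
Proof.
move=> t0; have dM := dyck_cM t; have dN := dyck_cN t; have a := adjMN t; split.
- rewrite /= inE andbT; apply/eqP => e; rewrite -e in a.
  by have := congr1 size (adj_irr a); rewrite size_cM; case: (t) t0.
- have sM : size (cM t) = 2 * (2 * size t) by rewrite size_cM; lia.
  by move=> x; rewrite !inE => /orP[]/eqP->; split=> //; rewrite -(adj_size a).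
- move=> x; rewrite !inE => /orP[]/eqP-> V.
    by move/nbM->; rewrite !inE eqxx orbT.
  by move/nbN->; rewrite !inE eqxx.
apply: (@conn_star _ (cM t)) => x; rewrite !inE => /orP[]/eqP->; first exact: conn_refl.
exact/conn_sym/conn1.
Qed.

Lemma graph_pair (t : seq bool) : t != [::] -> graph_of (pairL t) (fun i j => i != j).
Proof.
move=> t0; have irr x : size x = 4 * size t -> adj x x = false.
  by move=> sx; apply/negP => /adj_irr e; move: sx; rewrite e; case: (t) t0.
move=> [|[|//]] [|[|//]] _ _ /=; rewrite ?irr ?size_cM ?size_cN //.
  by rewrite adjMN.
by rewrite adj_sym adjMN.
Qed.

Lemma starN_ne t x : x \in starN t -> x != [::].
Proof. by case: t => //= b t; rewrite inE => /orP[/eqP->|/mapP[y _ ->]]; case: b. Qed.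

Lemma size_starN t : size (starN t) = size t.
Proof. by elim: t => //= b t IH; rewrite size_map IH. Qed.

Lemma uniq_starN t : uniq (starN t).
Proof.
elim: t => //= b t IH; rewrite (map_inj_uniq (@wM_inj b)) IH andbT.
apply/mapP => -[y hy]; have [y' ->] := dyck_head (dyck_starN hy) (starN_ne hy).
by case: (b).
Qed.

Lemma star_irr t : adj (cX t) (cX t) = false.
Proof. by apply/negP => /adj_irr. Qed.

Lemma closed_star (t : seq bool) : closed_list (2 * size t).+1 (starL t).
Proof.
split.
- rewrite /= uniq_starN andbT; apply/negP => /starX; by rewrite star_irr.
- move=> x; rewrite inE => /orP[/eqP->|hx].
    by rewrite size_cX; split; [exact: dyck_cX|lia].
  by rewrite -(adj_size (starX hx)) size_cX; split; [exact: dyck_starN hx|lia].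
- move=> x; rewrite inE => /orP[/eqP->|hx] V a; rewrite inE.
    by rewrite (nbX a) orbT.
  by rewrite (nb_starN hx a) eqxx.
apply: (@conn_star _ (cX t)) => x; rewrite inE => /orP[/eqP->|hx]; first exact: conn_refl.
exact/conn_sym/conn1/starX.
Qed.

Lemma graph_star t : graph_of (starL t) (fun i j => (i == 0) != (j == 0)).
Proof.
move=> [|i] [|j] hi hj /=; rewrite ?star_irr //.
- by rewrite starX // mem_nth.
- by rewrite adj_sym starX // mem_nth.
have hi' : i < size (starN t) by []. have hj' : j < size (starN t) by [].
apply/negP => a; have e := nb_starN (mem_nth [::] hi') a.
by have := starX (mem_nth [::] hj'); rewrite e star_irr.
Qed.

Definition rel_medL m i j :=
  if i < 3 * m then (3 * m <= j) && rel_med i (j - 3 * m)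
  else (j < 3 * m) && rel_med j (i - 3 * m).

Lemma closed_med b (t : seq bool) : closed_list (2 * size t).+4 (medL (b :: t)).
Proof.
have cc : {in medL (b :: t), forall x, conn x (A1 b t)}.
  by move=> x; rewrite mem_cat => /orP[/LM_conn|/LN_conn].
split.
- exact: uniq_med.
- move=> x hx; split.
    by move: hx; rewrite mem_cat => /orP[/dyck_LM|/dyck_LN].
  by rewrite (conn_size (cc x hx)) size_mid size_cX; lia.
- move=> x; rewrite !mem_cat => /orP[hx|hx] V a; rewrite mem_cat.
    by rewrite (LM_closed hx a) orbT.
  by rewrite (LN_closed hx a).
exact: conn_star cc.
Qed.

Lemma graph_med (t : seq bool) : graph_of (medL t) (rel_medL (size t)).
Proof.
move=> i j; rewrite size_cat size_LM size_LN => hi hj; rewrite /rel_medL !nth_cat size_LM.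
case: (ltnP i (3 * size t)) => hi'; case: (ltnP j (3 * size t)) => hj' /=.
- apply/negP => a; have hx := mem_nth [::] (eq_ind_r (fun n => i < n) hi' (size_LM t)).
  have := LM_closed hx a => /tip_LN.
  by rewrite (tip_LM (mem_nth [::] (eq_ind_r (fun n => j < n) hj' (size_LM t)))).
- by rewrite adj_med //; lia.
- by rewrite adj_sym adj_med //; lia.
apply/negP => a.
have hx : nth [::] (LN t) (i - 3 * size t) \in LN t by rewrite mem_nth // size_LN; lia.
have hy : nth [::] (LN t) (j - 3 * size t) \in LN t by rewrite mem_nth // size_LN; lia.
by have := LN_closed hx a => /tip_LM; rewrite (tip_LN hy).
Qed.

(** * Many words are connected to the ring *)

(** At least [3k - 5] words, one more than the middle component has for even [k]. *)
Definition many k := exists L : seq word,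
  [/\ uniq L, {in L, forall w, conn w (leaves k)} & 3 * k <= size L + 5].

Lemma known_conn k cert w : 1 < k -> w \in known [:: leaves k] cert -> conn w (leaves k).
Proof.
move=> hk /grow_sound -/(_ [:: leaves k]) [|y].
  by move=> _ /mapP[y hy ->]; have [r ->] := canonP y; apply: reach_turn; apply: reach_root.
rewrite inE => /eqP-> [r c]; apply: conn_trans c _; exact: conn_iter_leaves.
Qed.

Lemma known_many k cert : 1 < k ->
  uniq (known [:: leaves k] cert) && (3 * k <= size (known [:: leaves k] cert) + 5) -> many k.
Proof.
move=> hk /andP[u s]; exists (known [:: leaves k] cert).
by split=> // w; exact: known_conn.
Qed.

Lemma many9 : many 9.
Proof. by apply: (known_many (cert := cert9)) => //; vm_compute. Qed.

Lemma many10 : many 10.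
Proof. by apply: (known_many (cert := cert10)) => //; vm_compute. Qed.

(** Putting either of the two quadrilaterals in front doubles the list and stays connected to the
    ring by [big_ins]; twice [3(k - 2) - 5] exceeds [3k - 5] for the [k] in question. *)
Lemma many_big k : 9 <= k -> many k.
Proof.
elim: {k}k.+1 {-2}k (leqnn k.+1) => // n IH k hk k9.
have [h|h] := leqP 11 k; last first.
  have : k = 9 \/ k = 10 by lia.
  by case=> ->; [exact: many9|exact: many10].
have [L [u c s]] := IH (k - 2) ltac:(lia) ltac:(lia).
have e : k = (k - 2).+2 by lia.
exists (map (cat (leaves 2)) L ++ map (cat (wrap (leaves 1))) L); split.
- rewrite cat_uniq !map_inj_uniq ?u ?andbT /=.
    by apply/hasPn => x /mapP[y _ ->]; apply/mapP => -[z _].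
  + by move=> x y /= [].
  + by move=> x y /= [].
- have go p w : p \in quad -> w \in L -> conn (p ++ w) (leaves k).
    move=> hp hw; have cw := c w hw.
    have sw : size w = 2 * (k - 2) by rewrite (conn_size cw) size_leaves.
    have hh : (size w)./2 = k - 2 by lia.
    have bw : big w by rewrite /big hh; apply: reach_conn cw _; apply: reach_root; rewrite inE.
    have := @big_ins 0 p w; rewrite sw => H.
    have {H} := H ltac:(lia) ltac:(lia) hp isT bw.
    rewrite /ins take0 drop0 cat0s => /big_conn; rewrite size_cat (quad_size hp) sw.
    have -> : (4 + 2 * (k - 2))./2 = k by lia.
    by apply; lia.
  move=> w; rewrite mem_cat => /orP[]/mapP[x hx ->]; apply: go => //; by rewrite !inE eqxx ?orbT.
- by rewrite size_cat !size_map; lia.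
Qed.

(** * Orders and isomorphism classes of the components *)

Definition family k n R (L : seq word) := [/\ closed_list k L, size L = n & graph_of L R].

Definition meets k n R w := exists L x, [/\ family k n R L, x \in L & conn w x].

Lemma family_turn k n R L r : family k n R L -> family k n R (map (iter r turn) L).
Proof.
by case=> c s g; split; [exact: closed_turn|rewrite size_map|exact: graph_turn c g].
Qed.

Lemma meets_turn k n R L r x w : family k n R L -> x \in L -> conn w (iter r turn x) -> meets k n R w.
Proof.
move=> f hx c; exists (map (iter r turn) L), (iter r turn x).
by split=> //; [exact: family_turn|exact: map_f].
Qed.

Lemma component_meets k n R (M : matching k) : meets k n R (word_of M) ->
  exists2 L, family k n R L & component M = [set N | word_of N \in L].
Proof. by case=> L [x [f hx c]]; exists L; last by case: f => cl _ _; exact: (component_list cl hx c). Qed.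

Lemma card_family k n R L : family k n R L -> #|[set N : matching k | word_of N \in L]| = n.
Proof. by case=> -[u d _ _] s _; rewrite card_list. Qed.

Lemma family_component k n R L : 0 < n -> family k n R L ->
  exists M : matching k, #|component M| = n.
Proof.
move=> n0 f; have [cl s _] := f; case: L => [|x L] in f cl s *; first by rewrite -s in n0.
have [_ d _ _] := cl; have [dx sx] := d x (mem_head _ _); have [M eM] := word_of_surj dx sx.
exists M; rewrite (component_list cl (mem_head _ _)) ?eM; [exact: card_family f|exact: conn_refl].
Qed.

(** The condition on [b] and [many_big] make the ring component the largest. The three orders are
    then distinct, so the order of a component reveals its type, and equal type gives isomorphism
    or, for the ring, equality. *)
Lemma three_orders k a b Ra Rb : 9 <= k -> 0 < a < b -> b + 5 < 3 * k ->
  (exists L, family k a Ra L) -> (exists L, family k b Rb L) ->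
  (forall M : matching k,
     [\/ meets k a Ra (word_of M), meets k b Rb (word_of M) | conn (word_of M) (leaves k)]) ->
  exists a b c : nat,
    [/\ a < b < c,
        (forall M : matching k,
            #|component M| = a \/ #|component M| = b \/ #|component M| = c),
        (exists M : matching k, #|component M| = a)
        /\ (forall M N : matching k, #|component M| = a -> #|component N| = a ->
              iso_sub (component M) (component N)),
        (exists M : matching k, #|component M| = b)
        /\ (forall M N : matching k, #|component M| = b -> #|component N| = b ->
              iso_sub (component M) (component N)) &
        (exists M : matching k, #|component M| = c)
        /\ (forall M N : matching k, #|component M| = c -> #|component N| = c ->
              component M = component N)].
Proof.
move=> k9 /andP[a0 ab] bk [La fa] [Lb fb] cls.
have [O eO] : exists O : matching k, word_of O = leaves k.
  by apply: word_of_surj; [exact: dyck_leaves|exact: size_leaves].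
have ringE (M : matching k) : conn (word_of M) (leaves k) -> component M = component O.
  rewrite -eO => /connect_conn h; apply/setP => N; rewrite !inE.
  have h' : connect (@dcm k) O M by apply/connect_conn/conn_sym/connect_conn.
  by apply/idP/idP; apply: connect_trans.
have bc : b < #|component O|.
  have [L [u c s]] := many_big k9.
  have d : {in L, forall x, dyck x /\ size x = 2 * k}.
    move=> x /c h; split; last by rewrite (conn_size h) size_leaves.
    by case: (conn_sym h) => [|y z _ /adj_dyckr //]; exact: dyck_leaves.
  apply: (@leq_trans (size L)); first by lia.
  rewrite -(card_list u d); apply/subset_leq_card/subsetP => N; rewrite !inE => /c h.
  by apply/connect_conn; rewrite eO; apply: conn_sym.
have only n R (M : matching k) : meets k n R (word_of M) -> #|component M| = n.
  by case/component_meets=> L f ->; apply: card_family f.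
have iso n R (M N : matching k) : meets k n R (word_of M) -> meets k n R (word_of N) ->
    iso_sub (component M) (component N).
  case/component_meets=> L1 [c1 s1 g1] ->; case/component_meets=> L2 [c2 s2 g2] ->.
  by apply: iso_lists g1 g2; rewrite // s1.
exists a, b, #|component O|; split.
- by rewrite ab.
- by move=> M; case: (cls M) => [/only->|/only->|/ringE->]; auto.
- split=> [|M N]; first exact: family_component fa.
  case: (cls M) => [hM _|/only->|/ringE->]; try by lia.
  by case: (cls N) => [hN _|/only->|/ringE->]; try lia; exact: iso hM hN.
- split=> [|M N]; first by apply: family_component fb; lia.
  case: (cls M) => [/only->|hM _|/ringE->]; try by lia.
  by case: (cls N) => [/only->|hN _|/ringE->]; try lia; exact: iso hM hN.
split=> [|M N]; first by exists O.
case: (cls M) => [/only->|/only->|/ringE->]; try by lia.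
by case: (cls N) => [/only->|/only->|/ringE->]; try lia.
Qed.

Lemma family_rigid k w : dyck w -> size w = 2 * k -> 0 < k -> (forall V, adj w V = false) ->
  family k 1 (fun _ _ => false) [:: w].
Proof.
move=> dw sw k0 r; split=> //; last by move=> [|//] [|//] _ _.
split=> //.
- by move=> x; rewrite inE => /eqP->.
- by move=> x; rewrite inE => /eqP-> V; rewrite r.
by move=> x y; rewrite !inE => /eqP-> /eqP->; apply: conn_refl.
Qed.

Lemma family_pair m t : 0 < m -> size t = m -> family (2 * m) 2 (fun i j => i != j) (pairL t).
Proof.
move=> m0 s; have t0 : t != [::] by rewrite -size_eq0 s -lt0n.
by split=> //; [rewrite -s; exact: closed_pair|exact: graph_pair].
Qed.

Lemma family_star m t : size t = m ->
  family (2 * m).+1 m.+1 (fun i j => (i == 0) != (j == 0)) (starL t).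
Proof.
by move=> s; split; [rewrite -s; exact: closed_star|rewrite /= size_starN s|exact: graph_star].
Qed.

Lemma family_med m t : 0 < m -> size t = m -> family (2 * m).+2 (6 * m) (rel_medL m) (medL t).
Proof.
case: t => [|b t] m0 s; first by rewrite -s in m0.
split; last by rewrite -s; exact: graph_med.
  by have := closed_med b t; rewrite -s /= mulnS.
by rewrite size_cat size_LM size_LN s; lia.
Qed.

Theorem theorem1 (k : nat) (hk : 9 <= k) :
  exists a b c : nat,
    [/\ a < b < c,
        (forall M : matching k,
            #|component M| = a \/ #|component M| = b \/ #|component M| = c),
        (exists M : matching k, #|component M| = a)
        /\ (forall M N : matching k, #|component M| = a -> #|component N| = a ->
              iso_sub (component M) (component N)),
        (exists M : matching k, #|component M| = b)
        /\ (forall M N : matching k, #|component M| = b -> #|component N| = b ->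
              iso_sub (component M) (component N)) &
        (exists M : matching k, #|component M| = c)
        /\ (forall M N : matching k, #|component M| = c -> #|component N| = c ->
              component M = component N)].
Proof.
have hw (M : matching k) : (size (word_of M))./2 = k by rewrite size_word_of; lia.
case: (boolP (odd k)) => ok; last first.
  have [m [m0 ek]] : exists m, 0 < m /\ k = (2 * m).+2 by exists k./2.-1; lia.
  apply: (@three_orders k 2 (6 * m) (fun i j => i != j) (rel_medL m)) => //; try lia.
  - exists (pairL (nseq m.+1 true)).
    by have := @family_pair m.+1 _ isT (size_nseq m.+1 true); rewrite mulnS add2n -ek.
  - by exists (medL (nseq m true)); rewrite ek; apply: family_med; rewrite ?size_nseq.
  (* For even [k] no matching is isolated, so the pairs [cM t], [cN t] are the smallest
     components. *)
  move=> M; have [] := flex_reach (even_flex (dyck_word_of M) _); rewrite hw // => y.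
  have k3 : 3 < k by lia.
  have k8 : (k == 8) = false by lia.
  rewrite /roots (negbTE ok) k3 k8.
  rewrite mem_cat => /orP[/mapP[t /size_words st ->]|].
    move=> [r c]; apply: Or31; apply: (meets_turn _ (mem_head _ _) c).
    have -> : k = 2 * k./2 by lia.
    by apply: family_pair => //; lia.
  rewrite mem_cat => /orP[/mapP[t /size_words st ->]|].
    move=> [r c]; apply: Or32.
    have f : family k (6 * m) (rel_medL m) (medL t) by rewrite ek; apply: family_med; [|rewrite st]; lia.
    apply: (meets_turn f _ c); case: t {c f} st => [|b t _]; first by rewrite /=; lia.
    by rewrite mem_cat /= mem_head.
  rewrite inE => /eqP-> [r c]; apply: Or33; apply: conn_trans c _.
  by apply: conn_iter_leaves; lia.
have [m ek] : exists m, k = (2 * m).+1 by exists k./2; lia.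
apply: (@three_orders k 1 m.+1 (fun _ _ => false) (fun i j => (i == 0) != (j == 0))) => //; try lia.
- exists [:: lside true ++ cN (nseq m true) ++ rside true]; apply: family_rigid; last exact: rigid_side.
  + by apply: dyck_side; exact: dyck_cN.
  + by rewrite !size_cat size_cN size_nseq /=; lia.
  + by lia.
- by exists (starL (nseq m true)); rewrite ek; apply: family_star; rewrite size_nseq.
(* For odd [k] a matching without neighbour is a component of order 1; only the others are subject
   to [flex_reach]. *)
move=> M; case: (pickP (dcm M)) => [N a|no]; last first.
  apply: Or31; exists [:: word_of M], (word_of M); split; [|exact: mem_head|exact: conn_refl].
  apply: family_rigid; [exact: dyck_word_of|exact: size_word_of|by lia|].
  move=> V; apply/negP => a; have dV := adj_dyckr a.
  have [N e] := word_of_surj dV (etrans (esym (adj_size a)) (size_word_of M)).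
  by have := no N; rewrite -adj_word_of e a.
have [] := @flex_reach (word_of M) _; first by exists (word_of N); rewrite adj_word_of.
have k7 : (k == 7) = false by lia.
rewrite hw => y; rewrite /roots ok k7.
rewrite mem_cat => /orP[/mapP[t /size_words st ->]|].
  move=> [r c]; apply: Or32; apply: (meets_turn _ (mem_head _ _) c).
  by rewrite ek; apply: family_star; rewrite st; lia.
rewrite inE => /eqP-> [r c]; apply: Or33; apply: conn_trans c _.
by apply: conn_iter_leaves; lia.
Qed.
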